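(* Let $C>1$, $\beta=\int\phi\in(0,\infty)$, $0<z\le\min\{Ce^{-C\beta},2Ce^{-2C\beta}\}$ (and $z<C/2$ if $C\beta=\ln 2$), let $\alpha_1$ be as defined below, and assume $\bar\phi:=\sup_{x\in\mathbb R^d}\phi(x)<\infty$. Then for every $\alpha\in(\alpha_1,1)$ there is a constant $A>0$ depending only on $\alpha$, $C$ and $\bar\phi$ such that for every $k\in\mathcal K_{\alpha C}$, $t\ge0$ and $\varepsilon>0$, $$\|\hat T^*_{\varepsilon,\mathrm{ren}}(t)k-\hat T^*_V(t)k\|_{\mathcal K_C}\le\varepsilon tA\|k\|_{\mathcal K_{\alpha C}}.$$
   Context: $\Gamma_0$: finite subsets of $\mathbb R^d$ with Lebesgue–Poisson measure $\lambda=\sum_{n\ge0}\frac1{n!}m^{(n)}$ ($m^{(0)}=\delta_\emptyset$, $m^{(n)}$ the image of Lebesgue measure on $n$-tuples of distinct points). $|\eta|$ cardinality, $\xi\cup x:=\xi\cup\{x\}$. $e_\lambda(f,\eta)=\prod_{x\in\eta}f(x)$, $e_\lambda(f,\emptyset)=1$. $\mathcal L_C$: measurable $G$ with $\|G\|_C=\int|G(\eta)|C^{|\eta|}d\lambda(\eta)<\infty$; $\mathcal K_C$: measurable $k$ with $\|k\|_{\mathcal K_C}=\operatorname{ess\,sup}_\eta C^{-|\eta|}|k(\eta)|<\infty$; pairing $\langle G,k\rangle=\int Gk\,d\lambda$. $\phi:\mathbb R^d\to[0,\infty)$ even measurable. $(L_1G)(\eta)=-|\eta|G(\eta)$; $(L_{2,\varepsilon}G)(\eta)=z\sum_{\xi\subset\eta}\int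 e_\lambda(e^{-\varepsilon\phi(x-\cdot)},\xi)e_\lambda\big(\tfrac{e^{-\varepsilon\phi(x-\cdot)}-1}{\varepsilon},\eta\setminus\xi\big)G(\xi\cup x)dx$; $(L_2^VG)(\eta)=z\sum_{\xi\subset\eta}\int G(\xi\cup x)e_\lambda(-\phi(x-\cdot),\eta\setminus\xi)dx$; $\hat L_{\varepsilon,\mathrm{ren}}=L_1+L_{2,\varepsilon}$, $\hat L_V=L_1+L_2^V$ on $\mathcal L_{2C}$. Under the hypotheses these are closable in $\mathcal L_C$ and their closures generate strongly continuous contraction semigroups $\hat T_{\varepsilon,\mathrm{ren}}(t)$, $\hat T_V(t)$ on $\mathcal L_C$; their adjoint semigroups $\hat T^*_{\varepsilon,\mathrm{ren}}(t)$, $\hat T^*_V(t)$ on $\mathcal K_C$ are defined by $\langle G,\hat T^*(t)k\rangle=\langle\hat T(t)G,k\rangle$ for all $G\in\mathcal L_C$, $k\in\mathcal K_C$. Definition of $\alpha_1$: let $x_1\in(0,1)$ be the smaller root of $xe^{-x}=z\beta$; if $C\beta>1$ put $\alpha_1=\max\{\tfrac12,\tfrac1{C\beta},\tfrac1C\}$, and if $C\beta\le1$ put $\alpha_1=\max\{\tfrac12,\tfrac{x_1}{C\beta},\tfrac1C\}$. *)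

(* Defs.v *)
From HB Require Import structures.
From mathcomp Require Import all_boot all_order all_algebra.
From mathcomp Require Import all_classical all_reals all_analysis.
From mathcomp Require Import finmap.

Set Implicit Arguments.
Unset Strict Implicit.
Unset Printing Implicit Defensive.

Import Order.TTheory GRing.Theory Num.Theory.
Import numFieldNormedType.Exports.

Local Open Scope classical_set_scope.
Local Open Scope ring_scope.

Section Defs.
Variable R : realType.

(* Points of R^d : d-tuples of reals, with the product (Borel)        *)
(* sigma-algebra provided by mathcomp-analysis on tuples.             *)
Definition pt (d : nat) := d.-tuple R.

Definition tsub (d : nat) (x y : pt d) : pt d :=
  [tuple tnth x i - tnth y i | i < d].
Definition topp (d : nat) (x : pt d) : pt d := [tuple - tnth x i | i < d].

Definition conf (d : nat) := {fset pt d}.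

(* iterated integral over n.-tuples of T, given an integral I on T
   (for nonnegative integrands; equals the product-measure integral by
   Tonelli for measurable integrands) *)
Fixpoint iint (T : Type) (I : (T -> \bar R) -> \bar R) (n : nat)
  : (n.-tuple T -> \bar R) -> \bar R :=
  match n with
  | 0 => fun F => F [tuple]
  | m.+1 => fun F => I (fun x => iint I (fun t : m.-tuple T => F (cons_tuple x t)))
  end.

Definition intRd (d : nat) (F : pt d -> \bar R) : \bar R :=
  @iint R (fun f => (\int[@lebesgue_measure R]_x f x)%E) d F.

Definition RintRd (d : nat) (f : pt d -> R) : R :=
  fine (intRd (fun x => (Num.max (f x) 0)%:E) - intRd (fun x => (Num.max (- f x) 0)%:E))%E.

Definition intRdn (d n : nat) (F : n.-tuple (pt d) -> \bar R) : \bar R :=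
  @iint (pt d) (@intRd d) n F.

Definition conf_of (d n : nat) (t : n.-tuple (pt d)) : conf d := [fset x in (t : seq _)]%fset.

Definition LPint (d : nat) (H : conf d -> \bar R) : \bar R :=
  (\sum_(n <oo) ((n`!%:R)^-1)%:E *
     intRdn (fun t : n.-tuple (pt d) => if uniq t then H (conf_of t) else 0%E))%E.

Definition conf_measurable (d : nat) (G : conf d -> R) : Prop :=
  forall n : nat,
    measurable_fun [set: n.-tuple (pt d)]
      (fun t : n.-tuple (pt d) => if uniq t then G (conf_of t) else 0).

Definition card (d : nat) (eta : conf d) : nat := (#|` eta|)%fset.

Definition LCnorm (d : nat) (C : R) (G : conf d -> R) : \bar R :=
  LPint (fun eta => (`|G eta| * C ^+ card eta)%:E).

Definition inLC (d : nat) (C : R) (G : conf d -> R) : Prop :=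
  conf_measurable G /\ (LCnorm C G < +oo)%E.

Definition distC (d : nat) (C : R) (G H : conf d -> R) : \bar R :=
  LCnorm C (fun eta => G eta - H eta).

Definition ind (b : bool) : \bar R := if b then 1%E else 0%E.

(* || k ||_{K_C} = ess sup_eta C^{-|eta|} |k(eta)| *)
Definition KCnorm (d : nat) (C : R) (k : conf d -> R) : \bar R :=
  ereal_inf [set M%:E | M in
    [set M : R | 0 <= M /\ LPint (fun eta => ind (M * C ^+ card eta < `|k eta|)) = 0%E]].

Definition inKC (d : nat) (C : R) (k : conf d -> R) : Prop :=
  conf_measurable k /\ (KCnorm C k < +oo)%E.

Definition pairing (d : nat) (G k : conf d -> R) : \bar R :=
  (LPint (fun eta => (Num.max (G eta * k eta) 0)%:E)
   - LPint (fun eta => (Num.max (- (G eta * k eta)) 0)%:E))%E.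

Definition elam (d : nat) (f : pt d -> R) (eta : conf d) : R := \prod_(x <- eta) f x.

Definition L1 (d : nat) (G : conf d -> R) : conf d -> R :=
  fun eta => - (card eta)%:R * G eta.

Definition L2eps (d : nat) (phi : pt d -> R) (z eps : R) (G : conf d -> R)
  : conf d -> R :=
  fun eta => z * \sum_(xi <- fpowerset eta)
    RintRd (fun x =>
      elam (fun y => expR (- (eps * phi (tsub x y)))) xi
      * elam (fun y => (expR (- (eps * phi (tsub x y))) - 1) / eps) (eta `\` xi)%fset
      * G (xi `|` [fset x])%fset).

Definition L2V (d : nat) (phi : pt d -> R) (z : R) (G : conf d -> R)
  : conf d -> R :=
  fun eta => z * \sum_(xi <- fpowerset eta)
    RintRd (fun x =>
      G (xi `|` [fset x])%fset * elam (fun y => - phi (tsub x y)) (eta `\` xi)%fset).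

Definition Lren (d : nat) phi z eps (G : conf d -> R) : conf d -> R :=
  fun eta => L1 G eta + L2eps phi z eps G eta.

Definition LV (d : nat) phi z (G : conf d -> R) : conf d -> R :=
  fun eta => L1 G eta + L2V phi z G eta.

Definition gen_pair (d : nat) (C : R) (T : R -> (conf d -> R) -> conf d -> R)
  (G H : conf d -> R) : Prop :=
  forall e : R, 0 < e -> exists2 delta : R, 0 < delta &
    forall t : R, 0 < t -> t < delta ->
      (distC C (fun eta => (T t G eta - G eta) / t)%R H < e%:E)%E.

Definition closure_pair (d : nat) (C : R) (L : (conf d -> R) -> conf d -> R)
  (G H : conf d -> R) : Prop :=
  exists Gs : nat -> conf d -> R,
    (forall n, inLC (2 * C) (Gs n)) /\
    (forall e : R, 0 < e -> exists N : nat, forall n : nat, (N <= n)%N ->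
        (distC C (Gs n) G < e%:E)%E /\ (distC C (L (Gs n)) H < e%:E)%E).

(* T is a strongly continuous contraction semigroup on L_C (functions
   being identified when they agree lambda-a.e., i.e. at L_C-distance 0)
   whose generator is the closure of L (defined on L_{2C}). *)
Definition generated_semigroup (d : nat) (C : R) (L : (conf d -> R) -> conf d -> R)
  (T : R -> (conf d -> R) -> conf d -> R) : Prop :=
  (forall t G, 0 <= t -> inLC C G -> inLC C (T t G)) /\
  (forall t G H, 0 <= t -> inLC C G -> inLC C H -> distC C G H = 0%E ->
      distC C (T t G) (T t H) = 0%E) /\
  (forall t (a b : R) G H, 0 <= t -> inLC C G -> inLC C H ->
      distC C (T t (fun eta => a * G eta + b * H eta))
              (fun eta => a * T t G eta + b * T t H eta) = 0%E) /\
  (forall G, inLC C G -> distC C (T 0 G) G = 0%E) /\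
  (forall s t G, 0 <= s -> 0 <= t -> inLC C G ->
      distC C (T (s + t) G) (T s (T t G)) = 0%E) /\
  (forall t G, 0 <= t -> inLC C G -> (LCnorm C (T t G) <= LCnorm C G)%E) /\
  (forall G, inLC C G -> forall e : R, 0 < e -> exists2 delta : R, 0 < delta &
      forall t : R, 0 <= t -> t < delta -> (distC C (T t G) G < e%:E)%E) /\
  (forall G H, inLC C G -> inLC C H -> (gen_pair C T G H <-> closure_pair C L G H)).

Definition adjoint_semigroup (d : nat) (C : R)
  (T Ts : R -> (conf d -> R) -> conf d -> R) : Prop :=
  forall t k, 0 <= t -> inKC C k ->
    inKC C (Ts t k) /\
    (forall G, inLC C G -> pairing G (Ts t k) = pairing (T t G) k).

Definition smaller_root (z beta x1 : R) : Prop :=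
  0 < x1 < 1 /\ x1 * expR (- x1) = z * beta /\
  (forall y : R, 0 < y -> y * expR (- y) = z * beta -> x1 <= y).

Definition alpha1 (C beta x1 : R) : R :=
  if 1 < C * beta then Num.max (2^-1) (Num.max (C * beta)^-1 C^-1)
  else Num.max (2^-1) (Num.max (x1 / (C * beta)) C^-1).

End Defs.

(* Main.v *)
Require Import Defs.
From HB Require Import structures.
From mathcomp Require Import all_boot all_order all_algebra.
From mathcomp Require Import all_classical all_reals all_analysis.
From mathcomp Require Import finmap measurable_realfun.
From mathcomp Require Import ring lra.
Set Implicit Arguments.
Unset Strict Implicit.
Unset Printing Implicit Defensive.
Import Order.TTheory GRing.Theory Num.Theory.
Import numFieldNormedType.Exports.
Local Open Scope classical_set_scope.
Local Open Scope ring_scope.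

(** By duality it suffices to bound [T_ren(t) G - T_V(t) G] in [L_(alpha C)] by
    [eps t A ||G||_C] for [G] in [L_(2C)]. Three facts about the generators give
    this.

    Both [L_2eps G] and [L_2^V G] are majorized pointwise by the positive
    operator [M |G|] obtained by replacing the weights by [phi], and a Mecke-type
    identity gives [||M |G| ||_B <= z e^(B beta) / B || |.| G ||_B]. The choice
    of [alpha_1] makes the constant at most [1] for [B = alpha C], so that [L_V]
    is dissipative in [L_(alpha C)].

    The difference of the two weights is at most [eps phibar |eta|] times the
    weight of [M]; the factor [|eta|] is absorbed by passing from [alpha] to
    [sqrt alpha] and then to [1], so [L_ren - L_V] is of norm [O(eps)] from [L_C]
    to [L_(alpha C)].

    Hence one implicit Euler step of length [h] satisfies
    [||u - v|| <= ||(u - v) - h (L_ren u - L_V v)|| + h eps A ||u||_C], and this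
    survives passing to the closures. Along the two orbits the Euler residual is
    [o(h)] uniformly in time because the semigroups are contractions, so summing
    over [t / h] steps and letting [h] tend to [0] gives the bound.

    Points are not null in dimension [0], where the majorization fails; there
    the contraction hypothesis itself provides dissipativity in [L_C], and the
    configuration space has only two elements. *)

(** * Iterated integrals as integrals against product measures *)

(** A Duhamel formula would need [T_V(t)] to act as a contraction on [L_(alpha C)], whereas the
    semigroups are given on [L_C] only and their orbits lie merely in the domain of a closure. An
    implicit Euler step asks for less: an inequality between two graphs, checked on the core
    [L_(2C)] and stable under limits in [L_C]. It is asymmetric on purpose: the weaker norm measures
    the difference, while the source term involves only [||u||_C] along the orbit of [T_ren], which
    does not grow. So the steps add up to a bound linear in [t].

    The factor [|eta|] has to be absorbed twice, once from comparing products of weights and once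
    from the Mecke-type identity; each time costs one passage by [q = sqrt alpha], with
    [n q^n <= 1 / (q^-1 - 1)]. This explains the square in [A] and the smallness condition at both
    [q C] and [q^2 C = alpha C].

    Functions are not identified with their classes, and the operators are evaluated pointwise,
    possibly at divergent integrals; the estimates therefore concern representatives, use seminorms,
    and rely on the default value zero of a divergent integral. *)

Section iterated_integral.
Context {R : realType}.
Local Open Scope ereal_scope.

(** The integrals of the statement iterate a bare functional. Identifying it with a measure integral
    on nonnegative measurable functions gives access to Tonelli's theorem. *)
Definition represents dd (T : measurableType dd)
    (mu : {sigma_finite_measure set T -> \bar R}) (I : (T -> \bar R) -> \bar R) :=
  forall f : T -> \bar R, measurable_fun setT f -> (forall x, 0 <= f x) ->
  I f = \int[mu]_x f x.

Section cons_measure.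
Context dd (T : measurableType dd) (n : nat)
  (mu : {sigma_finite_measure set T -> \bar R})
  (nu : {sigma_finite_measure set (n.-tuple T) -> \bar R}).

Definition cons_pair (p : T * n.-tuple T) : n.+1.-tuple T := cons_tuple p.1 p.2.

Lemma measurable_cons_pair : measurable_fun setT cons_pair.
Proof. exact: measurable_cons. Qed.

Definition cons_measure := pushforward (mu \x nu) cons_pair.

Let cons_measure0 : cons_measure set0 = 0.
Proof. by rewrite /cons_measure /pushforward preimage_set0 measure0. Qed.

Let cons_measure_ge0 A : 0 <= cons_measure A.
Proof. by rewrite /cons_measure /pushforward; apply: measure_ge0. Qed.

Let cons_measure_sigma_additive : semi_sigma_additive cons_measure.
Proof.
move=> F mF tF mUF; rewrite /cons_measure /pushforward preimage_bigcup.
have mc := measurable_cons_pair.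
apply: measure_semi_sigma_additive.
- by move=> i; rewrite -[X in measurable X]setTI; exact: mc.
- apply/trivIsetP => /= i j _ _ ij; rewrite -preimage_setI.
  by move/trivIsetP : tF => /(_ _ _ _ _ ij) ->//; rewrite preimage_set0.
- by rewrite -preimage_bigcup -[X in measurable X]setTI; exact: mc.
Qed.

HB.instance Definition _ := isMeasure.Build _ _ _ cons_measure
  cons_measure0 cons_measure_ge0 cons_measure_sigma_additive.

Let sigma_finite_cons_measure : sigma_finite setT cons_measure.
Proof.
have [F [TF ndF mF]] := (sigma_finiteP setT mu).1 (sigma_finiteT mu).
have [G [TG ndG mG]] := (sigma_finiteP setT nu).1 (sigma_finiteT nu).
(* Exhaustion by products of the two exhausting sequences. Both increase, so a point covered at
   stages [i] and [j] is covered at their maximum. *)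
exists (fun i => [set t : n.+1.-tuple T | F i (thead t) /\ G i [tuple of behead t]]).
  apply/seteqP; split => // t _.
  have : setT (thead t) by []. rewrite TF => -[i _ Fi].
  have : setT [tuple of behead t] by []. rewrite TG => -[j _ Gj].
  exists (maxn i j) => //; split.
    by move/subsetPset: (ndF _ _ (leq_maxl i j)); apply.
  by move/subsetPset: (ndG _ _ (leq_maxr i j)); apply.
move=> i; split.
  apply: measurableI.
    rewrite -[X in measurable X]setTI.
    by apply: (measurable_tnth ord0) => //; exact: (mF i).1.
  rewrite -[X in measurable X]setTI.
  by apply: measurable_behead => //; exact: (mG i).1.
rewrite /cons_measure /pushforward.
rewrite (_ : cons_pair @^-1` _ = F i `*` G i).
  rewrite product_measure1E; [|exact: (mF i).1|exact: (mG i).1].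
  apply: lte_mul_pinfty => //; last exact: (mG i).2.
  by rewrite ge0_fin_numE//; exact: (mF i).2.
apply/seteqP; split => -[x t] /=; rewrite /cons_pair/=.
  move=> [Fx Gt]; split => //.
  by rewrite (_ : t = [tuple of behead (cons_tuple x t)])//; apply/val_inj.
move=> [Fx Gt]; split => //.
by rewrite (_ : [tuple of behead (cons_tuple x t)] = t)//; apply/val_inj.
Qed.

HB.instance Definition _ := @Measure_isSigmaFinite.Build _ _ _ cons_measure
  sigma_finite_cons_measure.

Lemma integral_cons_measure (F : n.+1.-tuple T -> \bar R) :
  measurable_fun setT F -> (forall t, 0 <= F t) ->
  \int[cons_measure]_t F t = \int[mu]_x \int[nu]_t F (cons_tuple x t).
Proof.
move=> mF F0; rewrite /cons_measure.
rewrite (ge0_integral_pushforward measurable_cons_pair)//.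
rewrite preimage_setT (fubini_tonelli1 (F \o cons_pair))//.
  by apply: measurableT_comp => //; exact: measurable_cons_pair.
by move=> p; exact: F0.
Qed.

End cons_measure.

Fixpoint tuple_measure dd (T : measurableType dd)
    (mu : {sigma_finite_measure set T -> \bar R}) (n : nat) :
    {sigma_finite_measure set (n.-tuple T) -> \bar R} :=
  match n with
  | 0 => \d_([tuple] : 0.-tuple T)
  | m.+1 => cons_measure mu (tuple_measure mu m)
  end.

Lemma measurable_cons_tuple dd (T : measurableType dd) n (x : T) :
  measurable_fun setT (fun t : n.-tuple T => cons_tuple x t).
Proof. exact: (measurable_cons (measurable_cst x) (@measurable_id _ _ _)). Qed.

(** Induction on [n]: the inner iterated integral is an integral over sections, measurable in the
    first coordinate by Tonelli, so the outer functional can be replaced as well. *)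
Lemma represents_iint dd (T : measurableType dd)
    (mu : {sigma_finite_measure set T -> \bar R}) I n :
  represents mu I -> represents (tuple_measure mu n) (@iint R T I n).
Proof.
move=> rI; elim: n => [|n IH] F mF F0 /=.
  by rewrite integral_dirac// diracT mul1e.
rewrite integral_cons_measure//.
have iE x : iint I (fun t : n.-tuple T => F (cons_tuple x t)) =
    \int[tuple_measure mu n]_t F (cons_tuple x t).
  by apply: IH => //; apply: measurableT_comp => //; exact: measurable_cons_tuple.
under eq_fun do rewrite iE.
apply: rI => [|x]; last exact: integral_ge0.
apply: (measurable_fun_fubini_tonelli_F (F \o @cons_pair _ T n)).
  by apply: measurableT_comp => //; exact: measurable_cons_pair.
by move=> p; exact: F0.
Qed.

(* The canonical measurable structure on [R] carries another display than
   [measurableTypeR R]; the measurable sets are convertible. *)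
Definition lebesgueR : set R -> \bar R :=
  pushforward (@lebesgue_measure R) (idfun : measurableTypeR R -> R).

HB.instance Definition _ := isMeasure.Build _ _ _ lebesgueR
  (measure0 (@lebesgue_measure R)) (measure_ge0 (@lebesgue_measure R))
  (@measure_semi_sigma_additive _ _ _ (@lebesgue_measure R)).

Let sigma_finite_lebesgueR : sigma_finite setT lebesgueR.
Proof. exact: (sigma_finiteT (@lebesgue_measure R)). Qed.

HB.instance Definition _ := @Measure_isSigmaFinite.Build _ _ _ lebesgueR
  sigma_finite_lebesgueR.

Lemma integral_lebesgueR (f : R -> \bar R) :
  measurable_fun setT f -> (forall x, 0 <= f x) ->
  \int[lebesgueR]_x f x = \int[@lebesgue_measure R]_x f x.
Proof.
move=> mf f0; have mi : measurable_fun setT (idfun : measurableTypeR R -> R).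
  exact: (@measurable_id _ (measurableTypeR R)).
by rewrite /lebesgueR (ge0_integral_pushforward mi)// preimage_setT.
Qed.

Definition muRd d : {sigma_finite_measure set (pt R d) -> \bar R} :=
  tuple_measure lebesgueR d.

Lemma intRdE d (F : pt R d -> \bar R) :
  measurable_fun setT F -> (forall t, 0 <= F t) ->
  intRd F = \int[muRd d]_x F x.
Proof.
by apply: represents_iint => f mf f0; rewrite integral_lebesgueR.
Qed.

Lemma intRdnE d n (F : n.-tuple (pt R d) -> \bar R) :
  measurable_fun setT F -> (forall t, 0 <= F t) ->
  intRdn F = \int[tuple_measure (muRd d) n]_x F x.
Proof. by apply: represents_iint => f mf f0; exact: intRdE. Qed.

(** * Translation invariance and null sets *)

Section shift.
Variable a : R.

Let sh (x : measurableTypeR R) : measurableTypeR R := (x - a)%R.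

Let msh : measurable_fun setT sh.
Proof. by apply: measurable_funB. Qed.

(** The pushforward under translation has the right value on half-open intervals, which determines
    Lebesgue measure. *)
Lemma lebesgue_measure_shift (A : set (measurableTypeR R)) : measurable A ->
  lebesgue_measure A = pushforward (@lebesgue_measure R) sh A.
Proof.
move=> mA.
apply: (@lebesgue_measure_unique R (Measure.clone _ _ _
  (pushforward (@lebesgue_measure R) sh) _)) => // X.
move=> /ocitvP[->|[[x y] /= xy ->]].
  by rewrite /= /pushforward preimage_set0 !measure0.
rewrite /= /pushforward (_ : sh @^-1` _ = `]x + a, y + a]%classic)%R.
  rewrite !lebesgue_measure_itv /= !lte_fin ltrD2r.
  by case: ifP => // _; rewrite -!EFinB; congr EFin; ring.
apply/seteqP; split => t /=; rewrite /sh !in_itv/=; lra.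
Qed.

Lemma lebesgue_integral_shift (f : R -> \bar R) :
  measurable_fun setT f -> (forall x, 0 <= f x) ->
  \int[@lebesgue_measure R]_x f (x - a)%R = \int[@lebesgue_measure R]_x f x.
Proof.
move=> mf f0.
have E := ge0_integral_pushforward msh (@lebesgue_measure R) measurableT mf.
rewrite [RHS](_ : _ = \int[pushforward (@lebesgue_measure R) sh]_x f x).
  by rewrite E// preimage_setT.
by apply: eq_measure_integral => A mA _; exact: lebesgue_measure_shift.
Qed.

End shift.

Lemma measurable_intRd_cons d (F : pt R d.+1 -> \bar R) :
  measurable_fun setT F -> (forall x, 0 <= F x) ->
  measurable_fun setT (fun a : R => intRd (fun y : pt R d => F (cons_tuple a y))).
Proof.
move=> mF F0.
have iE a : intRd (fun y : pt R d => F (cons_tuple a y)) =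
    \int[muRd d]_y F (cons_tuple a y).
  by rewrite intRdE//; apply: measurableT_comp => //; exact: measurable_cons_tuple.
under eq_fun do rewrite iE.
apply: (measurable_fun_fubini_tonelli_F (F \o @cons_pair _ R d)).
  by apply: measurableT_comp => //; exact: measurable_cons_pair.
by move=> p; exact: F0.
Qed.

Lemma intRd_ge0 d (F : pt R d -> \bar R) : (forall x, 0 <= F x) -> 0 <= intRd F.
Proof.
elim: d F => [|d IH] F F0; first exact: F0.
by apply: integral_ge0 => x _; apply: IH.
Qed.

(** One coordinate at a time: the induction hypothesis translates the tail, the one-dimensional
    invariance the head. *)
Lemma intRd_shift d (F : pt R d -> \bar R) (x : pt R d) :
  measurable_fun setT F -> (forall y, 0 <= F y) ->
  intRd (fun y => F (tsub y x)) = intRd F.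
Proof.
elim: d F x => [|d IH] F x mF F0.
  by congr F; exact: tuple0.
have mFc a : measurable_fun setT (fun y : pt R d => F (cons_tuple a y)).
  by apply: measurableT_comp => //; exact: measurable_cons_tuple.
transitivity (\int[@lebesgue_measure R]_a
    intRd (fun y : pt R d => F (cons_tuple (a - thead x)%R y))).
  apply: eq_integral => a _.
  rewrite -[RHS](IH _ [tuple of behead x])//.
  congr (intRd _); apply/funext => y; congr F.
  apply: eq_from_tnth => i; rewrite tnth_mktuple.
  case: (unliftP ord0 i) => [j ->|->].
    by rewrite !tnthS tnth_mktuple {1}(tuple_eta x) tnthS.
  by rewrite /thead !tnth0.
rewrite (@lebesgue_integral_shift (thead x)
  (fun a => intRd (fun y : pt R d => F (cons_tuple a y))))//.
  exact: measurable_intRd_cons.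
by move=> a; exact: intRd_ge0.
Qed.

Lemma muRd_thead0 d (a : R) : muRd d.+1 [set x : pt R d.+1 | thead x = a] = 0.
Proof.
rewrite /muRd /= /cons_measure /pushforward.
rewrite (_ : _ @^-1` _ = [set a] `*` setT).
  rewrite product_measure1E//.
  by rewrite [X in X * _](lebesgue_measure_set1 a) mul0e.
by apply/seteqP; split => -[b t] //= [-> _].
Qed.

(** Each point lies in the null hyperplane of points sharing its first coordinate. Hence the point
    integrated over in [L_2] may be assumed to lie outside a given configuration. *)
Lemma ae_notin d (s : seq (pt R d.+1)) : {ae muRd d.+1, forall x, x \notin s}.
Proof.
elim: s => [|a s IH]; first exact: aeW.
have H : {ae muRd d.+1, forall x, x != a}.
  exists [set x : pt R d.+1 | thead x = thead a]; split.
  - rewrite -[X in measurable X]setTI.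
    exact: (measurable_tnth (T := R) (ord0 : 'I_d.+1) measurableT
      (measurable_set1 (thead a))).
  - exact: muRd_thead0.
  - by move=> x /= /negP; rewrite negbK => /eqP ->.
by apply: filterS2 IH H => x xs xa; rewrite inE negb_or xa.
Qed.

End iterated_integral.

(** * Configurations as duplicate-free sequences *)

Section masks.

(** Masks encode the subsets of a configuration listed without repetition. Sums over subsets then
    run over a list depending on the cardinality only, so they commute with integration over
    tuples. *)
Fixpoint masks (n : nat) : seq (seq bool) :=
  if n is n'.+1 then map (cons true) (masks n') ++ map (cons false) (masks n')
  else [:: [::]].

Lemma mem_masks n m : (m \in masks n) = (size m == n).
Proof.
elim: n m => [|n IH] [|b m] //=.
  by rewrite mem_cat; apply/negbTE; rewrite negb_or; apply/andP; split; apply/mapP => -[].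
rewrite mem_cat eqSS -IH.
apply/orP/idP => [[/mapP[m' ? [_ ->]]|/mapP[m' ? [_ ->]]]//|mm].
by case: b; [left|right]; apply/mapP; exists m.
Qed.

Lemma uniq_masks n : uniq (masks n).
Proof.
elim: n => // n IH; rewrite /= cat_uniq !map_inj_uniq; try by move=> ? ? [].
rewrite IH /= andbT; apply/hasPn => _ /mapP[m _ ->]; apply/negP => /mapP[m' _].
by [].
Qed.

(** Masks are grouped by their number of true entries. Splitting on the first entry, the induction
    step is Pascal's rule. *)
Lemma sum_masks (V : nmodType) n (F : nat -> nat -> V) :
  \sum_(m <- masks n) F (count id m) (count negb m) =
  \sum_(k < n.+1) F k (n - k)%N *+ 'C(n, k).
Proof.
elim: n F => [|n IH] F.
  by rewrite big_seq1 big_ord_recl big_ord0 addr0 subn0 bin0.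
rewrite /= big_cat/= !big_map/=.
under eq_bigr do rewrite add1n add0n.
under [X in _ + X]eq_bigr do rewrite add1n add0n.
rewrite (IH (fun i j => F i.+1 j)) (IH (fun i j => F i j.+1)).
rewrite [RHS]big_ord_recl/= bin0 subn0.
under [in RHS]eq_bigr do rewrite /bump/= add1n binS mulrnDr subSS.
rewrite big_split/= addrA [LHS]addrC; congr (_ + _).
rewrite big_ord_recl/= bin0 subn0; congr (_ + _).
rewrite [in RHS]big_ord_recr/= bin_small// mulr0n addr0.
by apply: eq_bigr => i _; rewrite /bump/= add1n subnSK.
Qed.

End masks.

Section conf_seq.
Context {R : realType} {d : nat}.
Notation T := (pt R d).
Local Open Scope fset_scope.

Definition confs (s : seq T) : conf R d := [fset x in s].

Lemma confsE n (t : n.-tuple T) : conf_of t = confs t. Proof. by []. Qed.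

Lemma mem_confs s x : (x \in confs s) = (x \in s).
Proof. by rewrite in_fset. Qed.

Lemma perm_confs s : uniq s -> perm_eq (enum_fset (confs s)) s.
Proof.
by move=> us; apply: uniq_perm => // x; exact: mem_confs.
Qed.

Lemma card_confs s : uniq s -> Defs.card (confs s) = size s.
Proof. by move=> us; rewrite /Defs.card (perm_size (perm_confs us)). Qed.

Lemma elam_confs (f : T -> R) s : uniq s -> elam f (confs s) = \prod_(x <- s) f x.
Proof. by move=> us; rewrite /elam (perm_big _ (perm_confs us)). Qed.

Lemma confs_cons x s : confs s `|` [fset x] = confs (x :: s).
Proof.
by apply/fsetP => y; rewrite in_fsetU in_fset1 !mem_confs inE orbC.
Qed.

Lemma mem_mask_negb (m : seq bool) (s : seq T) x : uniq s -> size m = size s ->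
  (x \in mask (map negb m) s) = (x \in s) && (x \notin mask m s).
Proof.
move=> us sz; rewrite !in_mask//.
case xs: (x \in s) => //=.
by rewrite (nth_map false)// sz index_mem.
Qed.

Lemma confs_mask_negb m s : uniq s -> size m = size s ->
  confs s `\` confs (mask m s) = confs (mask (map negb m) s).
Proof.
move=> us sz; apply/fsetP => y.
by rewrite in_fsetD !mem_confs mem_mask_negb// andbC.
Qed.

(** As [s] has no repetition, a mask is recovered from the subset it selects; conversely a subset is
    selected by the mask of its membership test along [s]. *)
Lemma perm_fpowerset_confs s : uniq s ->
  perm_eq (enum_fset (fpowerset (confs s))) [seq confs (mask m s) | m <- masks (size s)].
Proof.
move=> us; apply: uniq_perm; first exact: fset_uniq.
  rewrite map_inj_in_uniq ?uniq_masks// => m1 m2.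
  rewrite !mem_masks => /eqP s1 /eqP s2 /fsetP E.
  apply: (@eq_from_nth _ false) => [|i]; first by rewrite s1.
  rewrite s1 => is'; have x0 : T by case: (s) is'.
  have := E (nth x0 s i); rewrite !mem_confs !in_mask// !index_uniq//.
  by rewrite mem_nth.
move=> A; rewrite fpowersetE; apply/idP/mapP => [/fsubsetP AS|[m _ ->]].
  exists [seq x \in A | x <- s]; first by rewrite mem_masks size_map.
  apply/fsetP => x; rewrite mem_confs -filter_mask mem_filter.
  by case xA: (x \in A) => //=; have := AS x xA; rewrite mem_confs => ->.
by apply/fsubsetP => x; rewrite !mem_confs; exact: mem_mask.
Qed.

Lemma sum_fpowerset_confs (V : nmodType) s (F : conf R d -> V) : uniq s ->
  \sum_(xi <- fpowerset (confs s)) F xi =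
  \sum_(m <- masks (size s)) F (confs (mask m s)).
Proof.
by move=> us; rewrite (perm_big _ (perm_fpowerset_confs us)) /= big_map.
Qed.

End conf_seq.

(** * Measurability of functions of finite sequences *)

Section seq_measurable.
Context {R : realType} {d : nat}.
Notation T := (pt R d).

(** Measurability for the disjoint union of the tuple spaces, tested length by length. *)
Definition smeas dU (U : measurableType dU) (g : seq T -> U) :=
  forall n, measurable_fun [set: n.-tuple T] (fun t : n.-tuple T => g t).

(** The length of the list is fixed by [l], so it is a tuple with measurable entries. Masks and
    insertions are brought to this form by listing coordinates by position. *)
Lemma smeas_map dU (U : measurableType dU) (g : seq T -> U) dS
    (S : measurableType dS) (I : Type) (f : I -> S -> T) (l : seq I) :
  smeas g -> (forall i, measurable_fun setT (f i)) ->
  measurable_fun setT (fun s => g [seq f i s | i <- l]).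
Proof.
move=> mg mf.
pose h (s : S) : (size l).-tuple T := [tuple of map (f^~ s) (in_tuple l)].
apply: (measurableT_comp (mg (size l)) (_ : measurable_fun setT h)).
apply/measurable_fun_tnthP => i.
rewrite (_ : _ \o _ = f (tnth (in_tuple l) i)); first exact: mf.
by apply/funext => s /=; rewrite tnth_map.
Qed.

Lemma measurable_nth n (x0 : T) i :
  measurable_fun setT (fun t : n.-tuple T => nth x0 t i).
Proof.
have [ni|ni] := ltnP i n; last first.
  rewrite (_ : (fun _ => _) = cst x0); first exact: measurable_cst.
  by apply/funext => t; rewrite nth_default// size_tuple.
rewrite (_ : (fun _ => _) = (fun t : n.-tuple T => tnth t (Ordinal ni))).
  exact: measurable_tnth.
by apply/funext => t; rewrite (tnth_nth x0).
Qed.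

Lemma mask_nth_iota (x0 : T) (m : seq bool) (s : seq T) :
  mask m s = [seq nth x0 s i | i <- mask m (iota 0 (size s))].
Proof.
by rewrite map_mask -/(mkseq (nth x0 s) (size s)) mkseq_nth.
Qed.

Let x0 : T := [tuple 0 | i < d].

Lemma smeas_mask dU (U : measurableType dU) (g : seq T -> U) m n :
  smeas g -> measurable_fun setT (fun t : n.-tuple T => g (mask m t)).
Proof.
move=> mg.
rewrite (_ : (fun _ => _) =
    (fun t : n.-tuple T => g [seq nth x0 t i | i <- mask m (iota 0 n)])).
  by apply: (@smeas_map _ _ g _ (n.-tuple T) nat (fun i t => nth x0 t i)) => // i;
    exact: measurable_nth.
by apply/funext => t; rewrite (mask_nth_iota x0) size_tuple.
Qed.

Lemma smeas_cons_mask dU (U : measurableType dU) (g : seq T -> U) m n :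
  smeas g ->
  measurable_fun setT (fun p : T * n.-tuple T => g (p.1 :: mask m p.2)).
Proof.
move=> mg.
rewrite (_ : (fun _ => _) = (fun p : T * n.-tuple T =>
   g [seq (if i is Some j then nth x0 p.2 j else p.1)
     | i <- None :: map Some (mask m (iota 0 n))])).
  apply: (@smeas_map _ _ g _ (T * n.-tuple T)%type (option nat)
    (fun i p => if i is Some j then nth x0 p.2 j else p.1)) => // -[j|].
    by apply: (measurableT_comp (@measurable_nth n x0 j)).
  exact: measurable_fst.
apply/funext => p /=; rewrite -map_comp.
by rewrite (mask_nth_iota x0) size_tuple.
Qed.

Lemma smeas_cons dU (U : measurableType dU) (g : seq T -> U) x :
  smeas g -> smeas (fun s => g (x :: s)).
Proof.
move=> mg n; apply: (measurableT_comp (mg n.+1)).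
exact: measurable_cons_tuple.
Qed.

Lemma measurable_tsub dS (S : measurableType dS) (f g : S -> T) :
  measurable_fun setT f -> measurable_fun setT g ->
  measurable_fun setT (fun s => tsub (f s) (g s)).
Proof.
move=> mf mg; apply/measurable_fun_tnthP => i.
rewrite (_ : _ \o _ = (fun s => tnth (f s) i - tnth (g s) i)).
  by apply: measurable_funB; apply: (measurableT_comp (measurable_tnth i)).
by apply/funext => s /=; rewrite tnth_mktuple.
Qed.

Lemma measurable_eq_pt dS (S : measurableType dS) (f g : S -> T) :
  measurable_fun setT f -> measurable_fun setT g ->
  measurable_fun setT (fun s => f s == g s).
Proof.
move=> mf mg.
have E s : (f s == g s) = all (fun i => tnth (f s) i == tnth (g s) i) (enum 'I_d).
  apply/eqP/allP => [-> //|H]; apply: eq_from_tnth => i.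
  by apply/eqP/H; rewrite mem_enum.
under eq_fun do rewrite E.
elim: (enum 'I_d) => [|i l IH] /=; first exact: measurable_cst.
apply: measurable_and => //.
by apply: measurable_fun_eqr; apply: (measurableT_comp (measurable_tnth i)).
Qed.

Lemma measurable_mem_map dS (S : measurableType dS) (x : S -> T) (I : Type)
    (f : I -> S -> T) (l : seq I) :
  measurable_fun setT x -> (forall i, measurable_fun setT (f i)) ->
  measurable_fun setT (fun s => x s \in [seq f i s | i <- l]).
Proof.
move=> mx mf; elim: l => [|i l IH] /=; first exact: measurable_cst.
under eq_fun do rewrite inE.
by apply: measurable_or => //; exact: measurable_eq_pt.
Qed.

Lemma measurable_uniq_map dS (S : measurableType dS) (I : Type)
    (f : I -> S -> T) (l : seq I) :
  (forall i, measurable_fun setT (f i)) ->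
  measurable_fun setT (fun s => uniq [seq f i s | i <- l]).
Proof.
move=> mf; elim: l => [|i l IH] /=; first exact: measurable_cst.
by apply: measurable_and => //; apply: measurable_neg; exact: measurable_mem_map.
Qed.

Lemma smeas_uniq : smeas (fun s => uniq s : bool).
Proof.
move=> n.
rewrite (_ : (fun _ => _) =
    (fun t : n.-tuple T => uniq [seq nth x0 t i | i <- iota 0 n])).
  by apply: (@measurable_uniq_map _ (n.-tuple T) nat (fun i t => nth x0 t i)) => i;
    exact: measurable_nth.
by apply/funext => t; rewrite -{1}(mkseq_nth x0 t) size_tuple.
Qed.

Lemma measurable_mem_mask m n :
  measurable_fun setT (fun p : T * n.-tuple T => p.1 \in mask m p.2).
Proof.
rewrite (_ : (fun _ => _) = (fun p : T * n.-tuple T =>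
   p.1 \in [seq nth x0 p.2 i | i <- mask m (iota 0 n)])).
  apply: (@measurable_mem_map _ (T * n.-tuple T)%type fst nat
    (fun i p => nth x0 p.2 i)); first exact: measurable_fst.
  by move=> i; apply: (measurableT_comp (@measurable_nth n x0 i)).
by apply/funext => p; rewrite (mask_nth_iota x0) size_tuple.
Qed.

Lemma measurable_prod_mask (f : T -> R) m n : measurable_fun setT f ->
  measurable_fun setT (fun p : T * n.-tuple T =>
    \prod_(y <- mask m p.2) f (tsub p.1 y)).
Proof.
move=> mf.
rewrite (_ : (fun _ => _) = (fun p : T * n.-tuple T =>
   \prod_(i <- mask m (iota 0 n)) f (tsub p.1 (nth x0 p.2 i)))).
  apply: measurable_prod => i _; apply: (measurableT_comp mf).
  apply: measurable_tsub; first exact: measurable_fst.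
  by apply: (measurableT_comp (@measurable_nth n x0 i)).
by apply/funext => p; rewrite (mask_nth_iota x0) size_tuple big_map.
Qed.

End seq_measurable.

(** * The positive majorant and its Mecke-type identity *)

Section seq_integral.
Context {R : realType} {d : nat}.
Notation T := (pt R d).
Notation smeas := (@smeas R d).
Local Open Scope ereal_scope.

Definition sint n (g : seq T -> \bar R) : \bar R :=
  \int[tuple_measure (muRd d) n]_t g t.

Lemma sintS n (g : seq T -> \bar R) : smeas g -> (forall s, 0 <= g s) ->
  sint n.+1 g = \int[muRd d]_x sint n (fun s => g (x :: s)).
Proof. by move=> mg g0; rewrite /sint integral_cons_measure. Qed.

Lemma sint0 (g : seq T -> \bar R) : smeas g -> sint 0 g = g [::].
Proof.
move=> mg; rewrite /sint/= integral_dirac//; last exact: mg.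
by rewrite diracT mul1e.
Qed.

Lemma sint_ge0 n (g : seq T -> \bar R) : (forall s, 0 <= g s) -> 0 <= sint n g.
Proof. by move=> g0; apply: integral_ge0. Qed.

Lemma measurable_sint_cons n (g : seq T -> \bar R) :
  smeas g -> (forall s, 0 <= g s) ->
  measurable_fun setT (fun x => sint n (fun s => g (x :: s))).
Proof.
move=> mg g0.
apply: (measurable_fun_fubini_tonelli_F
  (fun p : T * n.-tuple T => g (p.1 :: p.2))) => //.
exact: (measurableT_comp (mg n.+1) (@measurable_cons_pair _ T n)).
Qed.

Variables (phi : T -> R) (beta : R).
Hypothesis mphi : measurable_fun setT phi.
Hypothesis phi_ge0 : forall x, (0 <= phi x)%R.
Hypothesis beta_ge0 : (0 <= beta)%R.
Hypothesis int_phi : forall x, \int[muRd d]_y (phi (tsub x y))%:E = beta%:E.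

Definition kern (m : seq bool) (t : seq T) (x : T) : R :=
  (\prod_(y <- mask (map negb m) t) phi (tsub x y))%R.

Lemma kern_ge0 m t x : (0 <= kern m t x)%R.
Proof. by apply: prodr_ge0. Qed.

Lemma measurable_kern m n : measurable_fun setT
  (fun p : T * n.-tuple T => kern m p.2 p.1).
Proof. exact: measurable_prod_mask. Qed.

Lemma smeas_kern m x : smeas (fun s => kern m s x).
Proof.
move=> n; apply: (measurableT_comp (@measurable_kern m n)
  (_ : measurable_fun setT (fun t : n.-tuple T => (x, t)))).
exact: measurable_pair1.
Qed.

(** Tonelli, one coordinate at a time: a coordinate left out by the mask integrates its own factor
    [phi] to [beta], a retained one becomes an argument of [g]. *)
Lemma sint_mask (g : seq T -> \bar R) (x : T) m :
  smeas g -> (forall s, 0 <= g s) ->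
  sint (size m) (fun t => g (mask m t) * (kern m t x)%:E) =
  (beta ^+ count negb m)%:E * sint (count id m) g.
Proof.
elim: m g => [|b m IH] g mg g0.
  rewrite /= !sint0 ?mul1e//; first by rewrite /kern big_nil mule1.
  move=> n; apply: emeasurable_funM; first exact: smeas_mask.
  by apply: measurableT_comp => //; exact: smeas_kern.
rewrite sintS; last 2 first.
- move=> n; apply: emeasurable_funM; first exact: smeas_mask.
  by apply: measurableT_comp => //; exact: smeas_kern.
- by move=> s; rewrite mule_ge0// lee_fin kern_ge0.
case: b.
  under eq_integral => y _.
    rewrite (_ : (fun s => _) = (fun s => g (y :: mask m s) * (kern m s x)%:E))//.
    rewrite (IH (fun s => g (y :: s)))//; last exact: smeas_cons.
    over.
  rewrite /= add0n add1n sintS// ge0_integralZl_EFin//.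
  - by move=> y _; exact: sint_ge0.
  - exact: measurable_sint_cons.
  - exact: exprn_ge0.
under eq_integral => y _.
  rewrite (_ : (fun s => _) = (fun s => (phi (tsub x y))%:E *
      (g (mask m s) * (kern m s x)%:E))).
    rewrite /sint ge0_integralZl_EFin//.
    - rewrite -/(sint _ (fun t => g (mask m t) * (kern m t x)%:E)) IH// muleC.
      over.
    - by move=> s _; rewrite mule_ge0// lee_fin kern_ge0.
    - apply: emeasurable_funM; first exact: smeas_mask.
      by apply: measurableT_comp => //; exact: smeas_kern.
  by apply/funext => s; rewrite /kern /= big_cons EFinM muleCA.
rewrite ge0_integralZl//=; last 3 first.
- apply: measurableT_comp => //; apply: measurableT_comp => //.
  by apply: measurable_tsub => //; exact: measurable_cst.
- by move=> y _; rewrite lee_fin.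
- by rewrite mule_ge0 ?sint_ge0// lee_fin exprn_ge0.
by rewrite int_phi add1n add0n exprSr EFinM -muleA [X in _ * X]muleC muleA.
Qed.

(* The operator [M] of the introduction, on sequences; [mask m t] plays the role
   of the subset [xi] and the complementary mask that of [eta \ xi]. *)
Definition Mop (z : R) (g : seq T -> \bar R) (t : seq T) : \bar R :=
  z%:E * \sum_(m <- masks (size t))
    \int[muRd d]_x (g (x :: mask m t) * (kern m t x)%:E).

Lemma measurable_Mop_integrand (g : seq T -> \bar R) m n : smeas g ->
  measurable_fun setT (fun p : T * n.-tuple T =>
    g (p.1 :: mask m p.2) * (kern m p.2 p.1)%:E).
Proof.
move=> mg; apply: emeasurable_funM; first exact: smeas_cons_mask.
by apply: measurableT_comp => //; exact: measurable_kern.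
Qed.

Lemma smeas_Mop z g : smeas g -> (forall s, 0 <= g s) -> smeas (Mop z g).
Proof.
move=> mg g0 n; rewrite /Mop; under eq_fun do rewrite size_tuple.
apply: measurable_funeM; apply: emeasurable_sum => m.
apply: (measurable_fun_fubini_tonelli_G (fun p : T * n.-tuple T =>
    g (p.1 :: mask m p.2) * (kern m p.2 p.1)%:E)).
  exact: measurable_Mop_integrand.
by move=> p; rewrite mule_ge0// lee_fin kern_ge0.
Qed.

Lemma Mop_ge0 z g s : (0 <= z)%R -> (forall s, 0 <= g s) -> 0 <= Mop z g s.
Proof.
move=> z0 g0; rewrite mule_ge0//; apply: sume_ge0 => m _; apply: integral_ge0.
by move=> x _; rewrite mule_ge0// lee_fin kern_ge0.
Qed.

(** After exchanging the integrations over [x] and over the tuple, [x] is one more argument of [g];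
    hence the successor on the right. *)
Lemma sint_Mop n z g : (0 <= z)%R -> smeas g -> (forall s, 0 <= g s) ->
  sint n (Mop z g) = z%:E * \sum_(m <- masks n)
    (beta ^+ count negb m)%:E * sint (count id m).+1 g.
Proof.
move=> z0 mg g0; rewrite [LHS]/sint /Mop.
under eq_integral do rewrite size_tuple.
have F0 m (p : T * n.-tuple T) :
    0 <= g (p.1 :: mask m p.2) * (kern m p.2 p.1)%:E.
  by rewrite mule_ge0// lee_fin kern_ge0.
have mFt m := measurable_fun_fubini_tonelli_G (m1 := muRd d) _
  (@measurable_Mop_integrand g m n mg) (F0 m).
rewrite ge0_integralZl_EFin//; last 2 first.
- move=> t _; apply: sume_ge0 => m _; apply: integral_ge0 => x _.
  exact: (F0 m (x, t)).
- apply: emeasurable_sum => m; exact: mFt.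
congr (_ * _).
rewrite ge0_integral_sum//; last first.
  by move=> m t _; apply: integral_ge0 => x _; exact: (F0 m (x, t)).
apply: eq_big_seq => m; rewrite mem_masks => /eqP sm.
have := fubini_tonelli (m1 := muRd d) (m2 := tuple_measure (muRd d) n) _
  (@measurable_Mop_integrand g m n mg) (F0 m).
rewrite /= => <-.
rewrite sintS// -ge0_integralZl_EFin//; last 3 first.
- by move=> x _; exact: sint_ge0.
- exact: measurable_sint_cons.
- exact: exprn_ge0.
apply: eq_integral => x _; rewrite -sm.
by rewrite -(sint_mask x m (smeas_cons x mg)).
Qed.

End seq_integral.

(** * The exponential series in the Mecke-type bound *)

Section series_bound.
Context {R : realType}.

Lemma sum_exp_coeff_le (x : R) N : 0 <= x ->
  \sum_(j < N) x ^+ j / j`!%:R <= expR x.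
Proof.
move=> x0; have := @nondecreasing_cvgn_le R (series (exp_coeff x)).
move=> /(_ _ (is_cvg_series_exp_coeff x) N) H.
rewrite (le_trans _ (H _))//.
  by rewrite /series/= big_mkord; apply: ler_sum => j _.
apply/nondecreasing_seqP => n; rewrite /series /= big_nat_recr//= lerDl.
by rewrite /exp_coeff/= divr_ge0// exprn_ge0.
Qed.

Local Open Scope ereal_scope.

(** The antidiagonals below [N] fill a triangle contained in the square. *)
Lemma sum_antidiagonal_le (F : nat -> nat -> \bar R) N :
  (forall k j, 0 <= F k j) ->
  \sum_(n < N) \sum_(k < n.+1) F k (n - k)%N <= \sum_(k < N) \sum_(j < N) F k j.
Proof.
move=> F0.
have -> : \sum_(n < N) \sum_(k < n.+1) F k (n - k)%N =
    \sum_(k < N) \sum_(j < N - k) F k j.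
  elim: N => [|N IH]; first by rewrite !big_ord0.
  rewrite big_ord_recr/= IH.
  have -> : \sum_(k < N) \sum_(j < N - k) F k j =
      \sum_(k < N.+1) \sum_(j < N - k) F k j.
    by rewrite big_ord_recr/= subnn big_ord0 adde0.
  rewrite -big_split/=; apply: eq_bigr => k _.
  by rewrite subSn ?big_ord_recr// -ltnS.
apply: lee_sum => k _.
by rewrite -[X in X <= _](big_mkord xpredT) -[X in _ <= X](big_mkord xpredT)
  lee_sum_nneg_natr// leq_subr.
Qed.

Lemma mulrn_erealE (x : \bar R) n : (x *+ n)%R = n%:R%:E * x.
Proof. by rewrite mule_natl. Qed.

(** Writing [n = k + j], with [k] the number of true entries, the binomial coefficient turns [n!]
    into [k! j!]. The sum over [j] gives [e^(B beta)], and [B^k / k!] equals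
    [(k+1) B^(k+1) / (k+1)!] divided by [B], which produces both the factor [n] and the division by
    [B]. *)
Lemma binomial_series_le (B beta z : R) (a : nat -> \bar R) :
  (0 < B)%R -> (0 <= beta)%R -> (0 <= z)%R -> (forall k, 0 <= a k) ->
  \sum_(n <oo) (B ^+ n / n`!%:R)%:E *
    (z%:E * \sum_(m <- masks n) (beta ^+ count negb m)%:E * a (count id m).+1)
  <= (z * expR (B * beta) / B)%:E *
     \sum_(n <oo) (n%:R * B ^+ n / n`!%:R)%:E * a n.
Proof.
move=> B0 be0 z0 a0.
have u0 n : 0 <= (B ^+ n / n`!%:R)%:E *
    (z%:E * \sum_(m <- masks n) (beta ^+ count negb m)%:E * a (count id m).+1).
  apply: mule_ge0; first by rewrite lee_fin divr_ge0// exprn_ge0// ltW.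
  apply: mule_ge0; first by rewrite lee_fin.
  by apply: sume_ge0 => m _; rewrite mule_ge0// lee_fin exprn_ge0.
have v0 n : 0 <= (n%:R * B ^+ n / n`!%:R)%:E * a n.
  by rewrite mule_ge0// lee_fin divr_ge0// mulr_ge0// exprn_ge0// ltW.
apply: lime_le; first by apply: is_cvg_nneseries => n _ _; exact: u0.
(* Comparing partial sums avoids rearranging a double series. *)
near=> N; rewrite big_mkord.
pose F k j := (z * (B ^+ k / k`!%:R) * ((B * beta) ^+ j / j`!%:R))%:E * a k.+1.
have F0 k j : 0 <= F k j.
  rewrite mule_ge0// lee_fin !mulr_ge0 ?invr_ge0 ?exprn_ge0 ?mulr_ge0//;
    exact: ltW.
rewrite [leLHS](_ : _ = \sum_(n < N) \sum_(k < n.+1) F k (n - k)%N); last first.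
  apply: eq_bigr => n _.
  rewrite (sum_masks _ (fun i j => (beta ^+ j)%:E * a i.+1)).
  rewrite muleA -EFinM ge0_sume_distrr; last first.
    move=> k _; rewrite mulrn_erealE mule_ge0// ?lee_fin//.
    by rewrite mule_ge0// lee_fin exprn_ge0.
  apply: eq_bigr => k _.
  have kn : (k <= n)%N by rewrite -ltnS.
  rewrite /F mulrn_erealE !muleA -!EFinM; congr (_%:E * _).
  rewrite exprMn -{1}(subnKC kn) exprD.
  rewrite -(bin_fact kn) !natrM.
  have := fact_gt0 k; have := fact_gt0 (n - k); rewrite -!(ltr0n R).
  have : (0 < 'C(n, k))%N by rewrite bin_gt0.
  rewrite -(ltr0n R).
  by move=> /gt_eqF c /gt_eqF f1 /gt_eqF f2; field; rewrite c f1 f2.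
apply: (le_trans (sum_antidiagonal_le N F0)).
apply: (@le_trans _ _ ((z * expR (B * beta) / B)%:E *
    \sum_(0 <= n < N.+1) (n%:R * B ^+ n / n`!%:R)%:E * a n)); last first.
  apply: lee_wpmul2l.
    by rewrite lee_fin divr_ge0 ?mulr_ge0 ?expR_ge0// ltW.
  by apply: nneseries_lim_ge => n _ _; exact: v0.
(* The term of index zero vanishes through its factor [n]; this absorbs the shift from [k] to
   [k + 1]. *)
rewrite big_nat_recl// !mul0r mul0e add0e big_mkord.
rewrite ge0_sume_distrr; last by move=> n _; exact: v0.
apply: lee_sum => k _.
rewrite /F -ge0_sume_distrl; last first.
  move=> j _; rewrite lee_fin !mulr_ge0 ?invr_ge0 ?exprn_ge0 ?mulr_ge0//;
    exact: ltW.
rewrite muleA lee_wpmul2r//.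
rewrite sumEFin -EFinM lee_fin -mulr_sumr.
rewrite (@le_trans _ _ (z * (B ^+ k / k`!%:R) * expR (B * beta))%R)//.
  rewrite ler_wpM2l ?sum_exp_coeff_le//.
    by rewrite mulr_ge0// divr_ge0// exprn_ge0// ltW.
  by rewrite mulr_ge0// ltW.
rewrite factS natrM exprS le_eqVlt; apply/orP; left; apply/eqP.
have := fact_gt0 k; rewrite -(ltr0n R) => /gt_eqF f.
have k1 : (k.+1%:R == 0%R :> R) = false by rewrite pnatr_eq0.
move: k1 f; move: (k.+1%:R)%R (k`!%:R)%R => c e c0 e0.
by field; rewrite c0 e0 gt_eqF.
Unshelve. all: by end_near. Qed.

End series_bound.

(** * Lebesgue-Poisson integrals *)

Section conf_measurable_theory.
Context {R : realType} {d : nat}.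
Notation T := (pt R d).
Implicit Types (G : conf R d -> R) (H : conf R d -> \bar R).

(** The function on tuples that the Lebesgue-Poisson integral of [H] actually integrates: tuples
    with a repeated point are given the default value. *)
Definition on_uniq (V : Type) (v0 : V) (H : conf R d -> V) (s : seq T) : V :=
  if uniq s then H (confs s) else v0.

Lemma conf_measurableE G : conf_measurable G <-> smeas (on_uniq 0 G).
Proof. by []. Qed.

Lemma conf_measurable_comp2 (h : R * R -> R) G1 G2 :
  measurable_fun setT h -> conf_measurable G1 -> conf_measurable G2 ->
  conf_measurable (fun eta => h (G1 eta, G2 eta)).
Proof.
move=> mh m1 m2 n.
rewrite (_ : (fun _ => _) = (fun t : n.-tuple T => if uniq t then
    h (on_uniq 0 G1 t, on_uniq 0 G2 t) else 0)).
  apply: measurable_fun_ifT; first exact: smeas_uniq.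
    apply: (measurableT_comp mh).
    by apply/measurable_fun_pairP; split; [exact: m1|exact: m2].
  exact: measurable_cst.
by apply/funext => t; rewrite /on_uniq; case: ifP => // ->.
Qed.

Lemma conf_measurable_card (f : nat -> R) :
  conf_measurable (fun eta : conf R d => f (Defs.card eta)).
Proof.
move=> n.
rewrite (_ : (fun _ => _) = (fun t : n.-tuple T => if uniq t then f n else 0)).
  by apply: measurable_fun_ifT; [exact: smeas_uniq|exact: measurable_cst..].
by apply/funext => t; case: ifP => // u; rewrite confsE card_confs// size_tuple.
Qed.

Lemma conf_measurable_cst (c : R) : conf_measurable (fun _ : conf R d => c).
Proof. exact: (conf_measurable_card (fun=> c)). Qed.

Lemma conf_measurableD G1 G2 : conf_measurable G1 -> conf_measurable G2 ->
  conf_measurable (fun eta => G1 eta + G2 eta).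
Proof.
apply: (@conf_measurable_comp2 (fun p => p.1 + p.2)).
by apply: measurable_funD; [exact: measurable_fst|exact: measurable_snd].
Qed.

Lemma conf_measurableB G1 G2 : conf_measurable G1 -> conf_measurable G2 ->
  conf_measurable (fun eta => G1 eta - G2 eta).
Proof.
apply: (@conf_measurable_comp2 (fun p => p.1 - p.2)).
by apply: measurable_funB; [exact: measurable_fst|exact: measurable_snd].
Qed.

Lemma conf_measurableM G1 G2 : conf_measurable G1 -> conf_measurable G2 ->
  conf_measurable (fun eta => G1 eta * G2 eta).
Proof.
apply: (@conf_measurable_comp2 (fun p => p.1 * p.2)).
by apply: measurable_funM; [exact: measurable_fst|exact: measurable_snd].
Qed.

Lemma conf_measurable_comp (h : R -> R) G :
  measurable_fun setT h -> conf_measurable G ->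
  conf_measurable (fun eta => h (G eta)).
Proof.
move=> mh mG; apply: (@conf_measurable_comp2 (fun p => h p.1) G G) => //.
by apply: (measurableT_comp mh); exact: measurable_fst.
Qed.

Lemma conf_measurable_norm G : conf_measurable G ->
  conf_measurable (fun eta => `|G eta|).
Proof. exact: (conf_measurable_comp (@normr_measurable R setT)). Qed.

Lemma conf_measurableN G : conf_measurable G ->
  conf_measurable (fun eta => - G eta).
Proof. exact: (conf_measurable_comp (@oppr_measurable R setT)). Qed.

Lemma conf_measurable_pos G : conf_measurable G ->
  conf_measurable (fun eta => Num.max (G eta) 0).
Proof.
apply: (@conf_measurable_comp (fun x => Num.max x 0)).
by apply: measurable_maxr; [exact: measurable_id|exact: measurable_cst].
Qed.

Definition cmeas H := smeas (on_uniq 0%E H).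

Lemma cmeas_EFin G : conf_measurable G -> cmeas (fun eta => (G eta)%:E).
Proof.
move=> mG n.
rewrite (_ : (fun _ => _) = (fun t : n.-tuple T => (on_uniq 0 G t)%:E)).
  exact: (measurableT_comp _ (mG n)).
by apply/funext => t; rewrite /on_uniq; case: ifP.
Qed.

Lemma cmeasD H1 H2 : cmeas H1 -> cmeas H2 -> cmeas (fun eta => H1 eta + H2 eta)%E.
Proof.
move=> m1 m2 n.
rewrite (_ : (fun _ => _) =
  (fun t : n.-tuple T => on_uniq 0%E H1 t + on_uniq 0%E H2 t)%E).
  exact: (emeasurable_funD (m1 n) (m2 n)).
by apply/funext => t; rewrite /on_uniq; case: ifP => // _; rewrite adde0.
Qed.

Lemma cmeasM H1 H2 : cmeas H1 -> cmeas H2 -> cmeas (fun eta => H1 eta * H2 eta)%E.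
Proof.
move=> m1 m2 n.
rewrite (_ : (fun _ => _) =
  (fun t : n.-tuple T => on_uniq 0%E H1 t * on_uniq 0%E H2 t)%E).
  exact: (emeasurable_funM (m1 n) (m2 n)).
by apply/funext => t; rewrite /on_uniq; case: ifP => // _; rewrite mule0.
Qed.

Local Open Scope ereal_scope.

Lemma on_uniq_ge0 H s : (forall eta, 0 <= H eta) -> 0 <= on_uniq 0 H s.
Proof. by move=> H0; rewrite /on_uniq; case: ifP. Qed.

(** The Lebesgue-Poisson integral extended to functions of sequences. Majorants such as [Mop] live
    there: they are not functions of configurations and need not vanish on repeated points. *)
Definition ssum (g : seq T -> \bar R) : \bar R :=
  \sum_(n <oo) (n`!%:R^-1)%:E * sint n g.

Let fact_ge0 n : 0 <= (n`!%:R^-1 : R)%:E.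
Proof. by rewrite lee_fin invr_ge0. Qed.

Lemma ssum_ge0 g : (forall s, 0 <= g s) -> 0 <= ssum g.
Proof. by move=> g0; apply: nneseries_ge0 => n _ _; rewrite mule_ge0// sint_ge0. Qed.

Lemma ssum_le g1 g2 : smeas g1 -> smeas g2 -> (forall s, 0 <= g1 s) ->
  (forall s, g1 s <= g2 s) -> ssum g1 <= ssum g2.
Proof.
move=> m1 m2 g10 g12; apply: lee_nneseries => n.
  by move=> _; rewrite mule_ge0// sint_ge0.
move=> _; apply: lee_wpmul2l => //; apply: ge0_le_integral => //.
- exact: m1.
- exact: m2.
Qed.

Lemma ssumD g1 g2 : smeas g1 -> smeas g2 -> (forall s, 0 <= g1 s) ->
  (forall s, 0 <= g2 s) -> ssum (fun s => g1 s + g2 s) = ssum g1 + ssum g2.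
Proof.
move=> m1 m2 g10 g20; rewrite /ssum -nneseriesD; last 2 first.
- by move=> n _ _; rewrite mule_ge0// sint_ge0.
- by move=> n _ _; rewrite mule_ge0// sint_ge0.
congr (limn _); apply/funext => N; apply: eq_bigr => n _.
rewrite -ge0_muleDr ?sint_ge0//; congr (_ * _); rewrite /sint ge0_integralD//.
- exact: m1.
- exact: m2.
Qed.

Lemma ssumZ (c : R) g : (0 <= c)%R -> smeas g -> (forall s, 0 <= g s) ->
  ssum (fun s => c%:E * g s) = c%:E * ssum g.
Proof.
move=> c0 mg g0; rewrite /ssum -nneseriesZl; last first.
  by move=> n _; rewrite mule_ge0// sint_ge0.
congr (limn _); apply/funext => N; apply: eq_bigr => n _.
rewrite muleCA; congr (_ * _); rewrite /sint ge0_integralZl//.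
exact: mg.
Qed.

Lemma smeas_size (f : nat -> R) : smeas (fun s : seq T => (f (size s))%:E).
Proof. by move=> n; under eq_fun do rewrite size_tuple; exact: measurable_cst. Qed.

Lemma ssum_size (f : nat -> R) g : (forall n, 0 <= f n)%R -> smeas g ->
  (forall s, 0 <= g s) ->
  ssum (fun s => (f (size s))%:E * g s) =
  \sum_(n <oo) (f n / n`!%:R)%:E * sint n g.
Proof.
move=> f0 mg g0; congr (limn _); apply/funext => N; apply: eq_bigr => n _.
rewrite mulrC EFinM -muleA; congr (_ * _); rewrite /sint.
under eq_integral do rewrite size_tuple.
by rewrite ge0_integralZl//; [exact: mg|rewrite lee_fin].
Qed.

Lemma LPintE H : cmeas H -> (forall eta, 0 <= H eta) ->
  LPint H = ssum (on_uniq 0 H).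
Proof.
move=> mH H0; rewrite /LPint /ssum; congr (limn _); apply/funext => N.
apply: eq_bigr => n _; congr (_ * _).
rewrite intRdnE//; first exact: (mH n).
by move=> t; exact: (on_uniq_ge0 t H0).
Qed.

Lemma LPint_ge0 H : cmeas H -> (forall eta, 0 <= H eta) -> 0 <= LPint H.
Proof.
by move=> mH H0; rewrite LPintE//; apply: ssum_ge0 => s; exact: on_uniq_ge0.
Qed.

Lemma LPint_le_ssum H (g : seq T -> \bar R) : cmeas H -> smeas g ->
  (forall eta, 0 <= H eta) -> (forall s, 0 <= g s) ->
  (forall s, uniq s -> H (confs s) <= g s) -> LPint H <= ssum g.
Proof.
move=> mH mg H0 g0 Hg; rewrite LPintE//; apply: ssum_le => // s.
  exact: on_uniq_ge0.
by rewrite /on_uniq; case: ifP => [/Hg|].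
Qed.

Lemma LPint_le H1 H2 : cmeas H1 -> cmeas H2 -> (forall eta, 0 <= H1 eta) ->
  (forall eta, H1 eta <= H2 eta) -> LPint H1 <= LPint H2.
Proof.
move=> m1 m2 H10 H12; have H20 eta : 0 <= H2 eta by exact: le_trans (H12 eta).
rewrite [leRHS]LPintE//; apply: LPint_le_ssum => // [s|s us].
  exact: on_uniq_ge0.
by rewrite /on_uniq us.
Qed.

Lemma LPintD H1 H2 : cmeas H1 -> cmeas H2 ->
  (forall eta, 0 <= H1 eta) -> (forall eta, 0 <= H2 eta) ->
  LPint (fun eta => H1 eta + H2 eta) = LPint H1 + LPint H2.
Proof.
move=> m1 m2 H10 H20.
rewrite !LPintE//; [|exact: cmeasD|by move=> eta; rewrite adde_ge0].
rewrite -ssumD//; [|by move=> s; exact: on_uniq_ge0..].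
congr ssum; apply/funext => s; rewrite /on_uniq; case: ifP => // _.
by rewrite adde0.
Qed.

Lemma LPintZ (c : R) H : (0 <= c)%R -> cmeas H -> (forall eta, 0 <= H eta) ->
  LPint (fun eta => c%:E * H eta) = c%:E * LPint H.
Proof.
move=> c0 mH H0; rewrite !LPintE//; last 2 first.
- by apply: cmeasM => //; exact: (cmeas_EFin (conf_measurable_cst c)).
- by move=> eta; rewrite mule_ge0.
rewrite -ssumZ//; last by move=> s; exact: on_uniq_ge0.
congr ssum; apply/funext => s; rewrite /on_uniq; case: ifP => // _.
by rewrite mule0.
Qed.

Lemma LPint_eq0_sint H : cmeas H -> (forall eta, 0 <= H eta) ->
  LPint H = 0 <-> forall n, sint n (on_uniq 0 H) = 0.
Proof.
move=> mH H0; rewrite LPintE// /ssum; split => [H00 n|H00]; last first.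
  by rewrite eseries0// => n _ _; rewrite H00 mule0.
have t0 m : 0 <= (m`!%:R^-1)%:E * sint m (on_uniq 0 H).
  by rewrite mule_ge0// sint_ge0// => s; exact: on_uniq_ge0.
have : (n`!%:R^-1)%:E * sint n (on_uniq 0 H) <= 0.
  rewrite -[leRHS]H00; apply: le_trans (nneseries_lim_ge n.+1 _); last first.
    by move=> m _ _; exact: t0.
  by rewrite big_nat_recr//= leeDr// sume_ge0.
move=> le0; have : (n`!%:R^-1)%:E * sint n (on_uniq 0 H) = 0.
  by apply/eqP; rewrite eq_le le0 t0.
move=> /eqP; rewrite mule_eq0 eqe invr_eq0 pnatr_eq0 => /orP[|/eqP//].
by rewrite -leqn0 leqNgt fact_gt0.
Qed.

(** [+oo] times [H1], with [+oo * 0 = 0], still has integral zero and dominates [H2]. *)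
Lemma LPint_null H1 H2 : cmeas H1 -> cmeas H2 ->
  (forall eta, 0 <= H1 eta) -> (forall eta, 0 <= H2 eta) ->
  (forall eta, H1 eta = 0 -> H2 eta = 0) -> LPint H1 = 0 -> LPint H2 = 0.
Proof.
move=> m1 m2 H10 H20 H12 /LPint_eq0_sint => /(_ m1 H10) z1.
apply/LPint_eq0_sint => // n; apply/eqP; rewrite eq_le; apply/andP; split;
  last by apply: sint_ge0 => s; exact: on_uniq_ge0.
rewrite [leRHS](_ : _ = +oo * sint n (on_uniq 0 H1)); last by rewrite z1 mule0.
rewrite /sint -ge0_integralZl//; [|exact: m1|by move=> t _; exact: on_uniq_ge0].
apply: ge0_le_integral => //.
- by move=> t _; exact: on_uniq_ge0.
- exact: m2.
- by apply: emeasurable_funM => //; exact: m1.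
move=> t _; rewrite /on_uniq; case: ifP => _; last by rewrite mule0.
have := H10 (confs t); rewrite le_eqVlt => /orP[/eqP/esym h|h].
  by rewrite h mule0 H12.
by rewrite gt0_mulye// leey.
Qed.

End conf_measurable_theory.

(** * The generators *)

Section RintRd_theory.
Context {R : realType} {d : nat}.
Notation T := (pt R d).
Implicit Types (f g : T -> R).

Let mpos f : measurable_fun setT f ->
  measurable_fun setT (fun x => (Num.max (f x) 0)%:E).
Proof.
move=> mf; apply: measurableT_comp => //.
by apply: measurable_maxr => //; exact: measurable_cst.
Qed.

Lemma RintRdE f : measurable_fun setT f ->
  RintRd f = fine (\int[muRd d]_x (f x)%:E)%E.
Proof.
move=> mf; rewrite /RintRd !intRdE//; last 4 first.
- exact: (mpos (measurableT_comp (@oppr_measurable R setT) mf)).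
- by move=> x; rewrite lee_fin le_max lexx orbT.
- exact: mpos.
- by move=> x; rewrite lee_fin le_max lexx orbT.
rewrite [in RHS]integralE; congr (fine (_ - _)); apply: eq_integral => x _.
  by rewrite funeposE EFin_max.
by rewrite funenegE EFin_max.
Qed.

Lemma measurable_RintRd dS (S : measurableType dS) (f : T * S -> R) :
  measurable_fun setT f -> measurable_fun setT (fun s => RintRd (fun x => f (x, s))).
Proof.
move=> mf.
have mfs s : measurable_fun setT (fun x => f (x, s)).
  exact: (measurableT_comp mf (measurable_pair2 s)).
have E s : RintRd (fun x => f (x, s)) =
   fine (\int[muRd d]_x (Num.max (f (x, s)) 0)%:E -
         \int[muRd d]_x (Num.max (- f (x, s)) 0)%:E)%E.
  rewrite /RintRd !intRdE//; last 4 first.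
  - exact: (mpos (measurableT_comp (@oppr_measurable R setT) (mfs s))).
  - by move=> x; rewrite lee_fin le_max lexx orbT.
  - exact: mpos.
  - by move=> x; rewrite lee_fin le_max lexx orbT.
under eq_fun do rewrite E.
apply: (measurableT_comp (fine_measurable measurableT)).
apply: emeasurable_funB.
  apply: (measurable_fun_fubini_tonelli_G (fun p => (Num.max (f p) 0)%:E)).
    apply: measurableT_comp => //.
    by apply: measurable_maxr => //; exact: measurable_cst.
  by move=> x; rewrite lee_fin le_max lexx orbT.
apply: (measurable_fun_fubini_tonelli_G (fun p => (Num.max (- f p) 0)%:E)).
  apply: measurableT_comp => //.
  apply: measurable_maxr; last exact: measurable_cst.
  exact: measurableT_comp.
by move=> x; rewrite lee_fin le_max lexx orbT.
Qed.

(** If the positive or the negative part has infinite integral, the difference is infinite, even for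
    [+oo - +oo], and [fine] sends it to zero. *)
Lemma RintRd_nonintegrable f : measurable_fun setT f ->
  ~ (muRd d).-integrable setT (EFin \o f) -> RintRd f = 0.
Proof.
move=> mf nf; have mEf : measurable_fun setT (EFin \o f) by exact: measurableT_comp.
have : (\int[muRd d]_x `|(EFin \o f) x| = +oo)%E.
  apply/eqP; rewrite -leye_eq leNgt; apply/negP => h; apply: nf.
  exact/integrableP.
rewrite RintRdE// [in X in fine X]integralE.
rewrite -[(fun x => `|_|)%E]/(abse \o (EFin \o f)) fune_abse.
rewrite ge0_integralD//; [|exact: measurable_funepos|exact: measurable_funeneg].
have : (0 <= \int[muRd d]_x (EFin \o f)^\- x)%E by exact: integral_ge0.
have : (0 <= \int[muRd d]_x (EFin \o f)^\+ x)%E by exact: integral_ge0.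
rewrite /=.
move: (\int[_]_x _)%E (\int[_]_x _)%E => [p| |] [q| |] //=.
Qed.

(* Holds without integrability: [RintRd] vanishes on nonintegrable functions. *)
Lemma le_normB_RintRd f g : measurable_fun setT f -> measurable_fun setT g ->
  (`|RintRd f - RintRd g|%:E <= \int[muRd d]_x `|f x - g x|%:E)%E.
Proof.
move=> mf mg.
have mfg : measurable_fun setT (fun x => (f x - g x)%:E).
  by apply: measurableT_comp => //; exact: measurable_funB.
have ge0 : (0 <= \int[muRd d]_x `|f x - g x|%:E)%E by apply: integral_ge0.
have [fi|nf] := pselect ((muRd d).-integrable setT (EFin \o f));
have [gi|ng] := pselect ((muRd d).-integrable setT (EFin \o g)).
- rewrite !RintRdE// -fineB; [|exact: integrable_fin_num..].
  rewrite -[in leLHS]integralB_EFin//.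
  rewrite -abse_EFin fineK.
    by apply: le_abse_integral.
  exact/integrable_fin_num/integrableB.
(* Only [f] is integrable here. Were the right-hand side finite, [g = f - (f - g)] would be
   integrable too. *)
- rewrite [leRHS](_ : _ = +oo%E) ?leey//.
  apply/eqP; rewrite -leye_eq leNgt; apply/negP => h; apply: ng.
  have hi : (muRd d).-integrable setT (fun x => (f x - g x)%:E).
    by apply/integrableP; split.
  have := integrableB measurableT fi hi.
  apply: eq_integrable => // x _ /=.
  by rewrite -EFinB; congr EFin; ring.
- rewrite [leRHS](_ : _ = +oo%E) ?leey//.
  apply/eqP; rewrite -leye_eq leNgt; apply/negP => h; apply: nf.
  have hi : (muRd d).-integrable setT (fun x => (f x - g x)%:E).
    by apply/integrableP; split.
  have := integrableD measurableT gi hi.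
  apply: eq_integrable => // x _ /=.
  by rewrite -EFinD; congr EFin; ring.
- by rewrite !RintRd_nonintegrable// subrr normr0.
Qed.

End RintRd_theory.

(** * A common form for the two operators *)

Section L2gen.
Context {R : realType} {d : nat}.
Notation T := (pt R d).
Local Open Scope fset_scope.
Implicit Types (a b : T -> R) (G : conf R d -> R).

(** [a] weighs the retained points and [b] the others; the limit operator has [a = 1] and
    [b = - phi]. *)
Definition L2gen a b (z : R) G : conf R d -> R :=
  fun eta => z * \sum_(xi <- fpowerset eta)
    RintRd (fun x => elam (fun y => a (tsub x y)) xi
      * elam (fun y => b (tsub x y)) (eta `\` xi) * G (xi `|` [fset x])).

Lemma L2epsE phi z eps G : L2eps phi z eps G =
  L2gen (fun v => expR (- (eps * phi v)))
        (fun v => (expR (- (eps * phi v)) - 1) / eps) z G.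
Proof. by []. Qed.

Lemma L2VE phi z G : L2V phi z G = L2gen (fun=> 1) (fun v => - phi v) z G.
Proof.
apply/funext => eta; rewrite /L2V /L2gen; congr (_ * _); apply: eq_bigr => xi _.
congr RintRd; apply/funext => x; rewrite mulrC; congr (_ * _).
by rewrite {2}/elam big1// mul1r.
Qed.

Definition wker a b (m : seq bool) (s : seq T) (x : T) : R :=
  (\prod_(y <- mask m s) a (tsub x y)) *
  (\prod_(y <- mask (map negb m) s) b (tsub x y)).

Lemma L2gen_confs a b z G s : uniq s -> L2gen a b z G (confs s) =
  z * \sum_(m <- masks (size s))
    RintRd (fun x => wker a b m s x * G (confs (x :: mask m s))).
Proof.
move=> us; rewrite /L2gen sum_fpowerset_confs//; congr (_ * _).
apply: eq_big_seq => m; rewrite mem_masks => /eqP sm.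
congr RintRd; apply/funext => x; rewrite confs_cons confs_mask_negb//.
by rewrite !elam_confs// mask_uniq.
Qed.

Lemma L2gen0 a b z eta : L2gen a b z (fun=> 0) eta = 0.
Proof.
rewrite /L2gen big1 ?mulr0// => xi _.
under eq_fun do rewrite mulr0.
rewrite RintRdE; last exact: measurable_cst.
by rewrite integral0.
Qed.

Lemma measurable_wker a b m n :
  measurable_fun setT a -> measurable_fun setT b ->
  measurable_fun setT (fun p : T * n.-tuple T => wker a b m p.2 p.1).
Proof.
by move=> ma mb; apply: measurable_funM; exact: measurable_prod_mask.
Qed.

(** When [x] already belongs to [s], the configuration of [x :: s] is that of [s], although the
    tuple has a repetition. Measurability of [G] being known on duplicate-free tuples only, the two
    cases are separated. *)
Definition insert_val G (x : T) (s : seq T) : R :=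
  if x \in s then on_uniq 0 G s else on_uniq 0 G (x :: s).

Lemma insert_valE G x s : uniq s -> G (confs (x :: s)) = insert_val G x s.
Proof.
move=> us; rewrite /insert_val /on_uniq /= us andbT.
case: ifP => [xs|->//].
by congr G; apply/fsetP => y; rewrite !mem_confs inE; case: eqP => // ->.
Qed.

Lemma measurable_insert_val G m n : conf_measurable G ->
  measurable_fun setT (fun p : T * n.-tuple T => insert_val G p.1 (mask m p.2)).
Proof.
move=> /conf_measurableE mG; apply: measurable_fun_ifT.
- exact: measurable_mem_mask.
- by apply: (measurableT_comp (smeas_mask m mG)); exact: measurable_snd.
- exact: smeas_cons_mask.
Qed.

Lemma conf_measurable_L2gen a b z G : measurable_fun setT a ->
  measurable_fun setT b -> conf_measurable G -> conf_measurable (L2gen a b z G).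
Proof.
move=> ma mb mG n.
rewrite (_ : (fun _ => _) = (fun t : n.-tuple T => if uniq t then
    z * \sum_(m <- masks n) RintRd (fun x => wker a b m t x *
      insert_val G x (mask m t)) else 0)).
  apply: measurable_fun_ifT; [exact: smeas_uniq| |exact: measurable_cst].
  apply: measurable_funM; first exact: measurable_cst.
  apply: measurable_sum => m.
  apply: (measurable_RintRd (f := fun p : T * n.-tuple T =>
    wker a b m p.2 p.1 * insert_val G p.1 (mask m p.2))).
  by apply: measurable_funM; [exact: measurable_wker|exact: measurable_insert_val].
apply/funext => t; case: ifP => // ut; rewrite confsE L2gen_confs// size_tuple.
congr (_ * _); apply: eq_bigr => m _; congr RintRd; apply/funext => x.
by rewrite insert_valE// mask_uniq.
Qed.

Lemma measurable_L2gen_integrand a b G m s : measurable_fun setT a ->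
  measurable_fun setT b -> conf_measurable G -> uniq s ->
  measurable_fun setT (fun x => wker a b m s x * G (confs (x :: mask m s))).
Proof.
move=> ma mb mG us.
under eq_fun do rewrite insert_valE ?mask_uniq//.
apply: (measurableT_comp (_ : measurable_fun setT (fun p : T * (size s).-tuple T =>
    wker a b m p.2 p.1 * insert_val G p.1 (mask m p.2)))
  (measurable_pair2 (in_tuple s))).
by apply: measurable_funM; [exact: measurable_wker|exact: measurable_insert_val].
Qed.

End L2gen.

(** * Scalar inequalities and comparison of the weights *)

Section scalar_estimates.
Context {R : realType}.

(** The quadratic bound follows from [(1 + x) e^(-x) <= 1] and [(1 + x)(1 - x + x^2) = 1 + x^3]. *)
Lemma expRN_bounds (x : R) : 0 <= x ->
  [/\ 0 <= expR (- x), expR (- x) <= 1, 1 - x <= expR (- x)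
    & expR (- x) <= 1 - x + x ^+ 2].
Proof.
move=> x0; split; first exact: expR_ge0.
- by rewrite -expR0 ler_expR oppr_le0.
- exact: expR_ge1Dx.
have h : (1 + x) * expR (- x) <= 1.
  rewrite expRN ler_pdivrMr ?expR_gt0// mul1r; exact: expR_ge1Dx.
have h3 : 0 <= x ^+ 3 by exact: exprn_ge0.
rewrite -(@ler_pM2l _ (1 + x)); last by lra.
apply: (le_trans h); rewrite -subr_ge0.
by rewrite (_ : _ - 1 = x ^+ 3)//; ring.
Qed.

Lemma prod_sub1_le (I : Type) (l : seq I) (a : I -> R) (delta : R) :
  (forall i, 0 <= a i <= 1) -> (forall i, `|a i - 1| <= delta) ->
  `|\prod_(i <- l) a i - 1| <= delta * (size l)%:R.
Proof.
move=> a01 ad; elim: l => [|i l IH]; first by rewrite big_nil subrr normr0 mulr0.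
rewrite big_cons (_ : _ - 1 = (a i - 1) * \prod_(j <- l) a j
  + (\prod_(j <- l) a j - 1)); last by ring.
rewrite (le_trans (ler_normD _ _))//= mulrS mulrDr mulr1 lerD//.
rewrite normrM -[leRHS]mulr1 ler_pM//.
rewrite ger0_norm; last by apply: prodr_ge0 => j _; case/andP: (a01 j).
by apply: prodr_ile1 => j _; exact: a01.
Qed.

(** Telescoping with a relative error: a replaced factor keeps its majorant [c i], so the full
    product of the [c i] survives in the bound. *)
Lemma prod_opp_le (I : Type) (l : seq I) (b c : I -> R) (delta : R) :
  (forall i, 0 <= c i) -> (forall i, `|b i| <= c i) ->
  (forall i, `|b i + c i| <= delta * c i) ->
  `|\prod_(i <- l) b i - \prod_(i <- l) - c i| <=
    delta * (size l)%:R * \prod_(i <- l) c i.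
Proof.
move=> c0 bc bd.
elim: l => [|i l IH]; first by rewrite !big_nil subrr normr0 mulr0 mul0r.
rewrite !big_cons (_ : _ - _ = (b i + c i) * \prod_(j <- l) b j +
  - c i * (\prod_(j <- l) b j - \prod_(j <- l) - c j)); last by ring.
rewrite (le_trans (ler_normD _ _))//= mulrS.
rewrite (_ : _ * (1 + _) * _ = (delta * c i) * \prod_(j <- l) c j
  + c i * (delta * (size l)%:R * \prod_(j <- l) c j)); last by ring.
apply: lerD; rewrite normrM.
  apply: ler_pM => //; rewrite normr_prod; apply: ler_prod => j _.
  by rewrite normr_ge0 bc.
by rewrite normrN (ger0_norm (c0 i)) ler_wpM2l.
Qed.

(** Bernoulli's inequality for the powers of [q^-1]. *)
Lemma nat_mul_exp_le (q : R) n : 0 < q -> q < 1 ->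
  n%:R * q ^+ n <= (q^-1 - 1)^-1.
Proof.
move=> q0 q1; have qi : 1 < q^-1 by rewrite invf_gt1.
have qi0 : 0 < q^-1 - 1 by lra.
have : 1 + n%:R * (q^-1 - 1) <= q^-1 ^+ n.
  elim: n => [|n IH]; first by rewrite mul0r addr0.
  rewrite exprS (@le_trans _ _ (q^-1 * (1 + n%:R * (q^-1 - 1))))//.
    rewrite -subr_ge0 -natr1 (_ : _ - _ = n%:R * (q^-1 - 1) ^+ 2); last by ring.
    by rewrite mulr_ge0// sqr_ge0.
  by rewrite ler_wpM2l// ltW// (lt_trans ltr01).
move=> h; rewrite -(@ler_pM2r _ (q^-1 - 1))// mulVf ?gt_eqF//.
rewrite mulrAC -(@ler_pM2r _ (q^-1 ^+ n)); last by rewrite exprn_gt0// invr_gt0.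
rewrite -[leLHS]mulrA -exprMn mulfV ?gt_eqF// expr1n mulr1 mul1r; lra.
Qed.

Lemma nat_le_exp2 n : (n%:R : R) <= 2 ^+ n.
Proof. by rewrite -natrX ler_nat ltnW// ltn_expl. Qed.

End scalar_estimates.

Section weights.
Context {R : realType} {d : nat}.
Notation T := (pt R d).
Variables (phi : T -> R) (phibar eps : R).
Hypothesis phi_ge0 : forall x, 0 <= phi x.
Hypothesis phi_le : forall x, phi x <= phibar.
Hypothesis eps_gt0 : 0 < eps.

Definition aeps (v : T) : R := expR (- (eps * phi v)).
Definition beps (v : T) : R := (expR (- (eps * phi v)) - 1) / eps.

Lemma aepsP v : 0 <= aeps v <= 1 /\ `|aeps v - 1| <= eps * phibar.
Proof.
have x0 : 0 <= eps * phi v by rewrite mulr_ge0// ltW.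
have [e0 e1 e2 _] := expRN_bounds x0; rewrite /aeps e0 e1; split=> //.
have : eps * phi v <= eps * phibar by rewrite ler_pM2l.
by rewrite ler_norml; lra.
Qed.

(** The quadratic bound on the exponential leaves an error [eps phi^2]. One factor is estimated by
    [phibar], the other is kept because the kernel must remain integrable. *)
Lemma bepsP v : `|beps v| <= phi v /\ `|beps v + phi v| <= eps * phibar * phi v.
Proof.
have x0 : 0 <= eps * phi v by rewrite mulr_ge0// ltW.
have [e0 e1 e2 e3] := expRN_bounds x0; rewrite /beps; split.
  rewrite normrM normfV (gtr0_norm eps_gt0) ler_pdivrMr// ler_norml.
  by rewrite mulrC in e1 e2 *; lra.
have -> : (expR (- (eps * phi v)) - 1) / eps + phi v =
    (expR (- (eps * phi v)) - 1 + eps * phi v) / eps.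
  by field; rewrite gt_eqF.
rewrite normrM normfV (gtr0_norm eps_gt0) ler_pdivrMr//.
rewrite ger0_norm; last by lra.
apply: (@le_trans _ _ ((eps * phi v) ^+ 2)); first by lra.
rewrite (_ : _ ^+ 2 = eps * phi v * phi v * eps); last by ring.
rewrite ler_wpM2r//; first exact: ltW.
by rewrite ler_wpM2r// ler_pM2l.
Qed.

Lemma wker_V m s x : `|wker (fun=> 1) (fun v => - phi v) m s x| = kern phi m s x.
Proof.
rewrite /wker big1// mul1r normr_prod; apply: eq_bigr => y _.
by rewrite normrN ger0_norm.
Qed.

Lemma wker_eps m s x : `|wker aeps beps m s x| <= kern phi m s x.
Proof.
rewrite normrM -[leRHS]mul1r ler_pM//.
  rewrite ger0_norm; last by apply: prodr_ge0 => y _; case: (aepsP (tsub x y)) => /andP[].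
  by apply: prodr_ile1 => y _; case: (aepsP (tsub x y)).
rewrite normr_prod; apply: ler_prod => y _.
by rewrite normr_ge0; case: (bepsP (tsub x y)).
Qed.

(** With [A] the retained product, [B] the other one and [P] its limit,
    [A B - P = (A - 1) B + (B - P)]. The two errors are proportional to the numbers of retained and
    of removed points, which add up to [size s]. *)
Lemma wker_eps_V m s x : size m = size s ->
  `|wker aeps beps m s x - wker (fun=> 1) (fun v => - phi v) m s x| <=
  eps * phibar * (size s)%:R * kern phi m s x.
Proof.
move=> sm; rewrite /wker [X in _ - X * _]big1// mul1r.
set A := \prod_(y <- mask m s) _; set B := \prod_(y <- mask _ s) beps _.
set P := \prod_(y <- _) - _.
have -> : A * B - P = (A - 1) * B + (B - P) by ring.
have k0 : 0 <= kern phi m s x by exact: kern_ge0.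
have hA : `|A - 1| <= eps * phibar * (count id m)%:R.
  rewrite -(size_mask sm); apply: prod_sub1_le => y.
    by case: (aepsP (tsub x y)).
  by case: (aepsP (tsub x y)).
have hB : `|B| <= kern phi m s x.
  rewrite normr_prod; apply: ler_prod => y _.
  by rewrite normr_ge0; case: (bepsP (tsub x y)).
have hBP : `|B - P| <= eps * phibar * (count negb m)%:R * kern phi m s x.
  have -> : count negb m = size (mask (map negb m) s).
    by rewrite size_mask ?size_map// count_map; apply: eq_count => b.
  apply: prod_opp_le => y //.
    by case: (bepsP (tsub x y)).
  by case: (bepsP (tsub x y)).
have cs : (size s)%:R = (count id m)%:R + (count negb m)%:R :> R.
  by rewrite -sm -natrD -(count_predC id m); congr ((_ + _)%:R).
rewrite cs mulrDr mulrDl; apply: (le_trans (ler_normD _ _)); apply: lerD => //.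
by rewrite normrM; exact: ler_pM.
Qed.

End weights.

Section LCnorm_theory.
Context {R : realType} {d : nat}.
Implicit Types (G H : conf R d -> R) (B C : R).
Local Open Scope ereal_scope.

Lemma cmeas_LC (f : nat -> R) G : conf_measurable G ->
  cmeas (fun eta => (`|G eta| * f (Defs.card eta))%:E).
Proof.
move=> mG; apply: (cmeas_EFin (G := fun eta => (`|G eta| * f (Defs.card eta))%R)).
apply: conf_measurableM; [exact: conf_measurable_norm|exact: conf_measurable_card].
Qed.

Lemma LC_ge0 B G eta : (0 <= B)%R -> 0 <= (`|G eta| * B ^+ Defs.card eta)%:E.
Proof. by move=> B0; rewrite lee_fin mulr_ge0// exprn_ge0. Qed.

Lemma LCnorm_ge0 B G : (0 <= B)%R -> conf_measurable G -> 0 <= LCnorm B G.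
Proof.
move=> B0 mG; apply: LPint_ge0; first exact: (@cmeas_LC (fun n => B ^+ n)%R).
by move=> eta; exact: LC_ge0.
Qed.

Lemma LCnorm_le B1 B2 G : (0 <= B1)%R -> (B1 <= B2)%R -> conf_measurable G ->
  LCnorm B1 G <= LCnorm B2 G.
Proof.
move=> B0 B12 mG; apply: LPint_le.
- exact: (@cmeas_LC (fun n => B1 ^+ n)%R).
- exact: (@cmeas_LC (fun n => B2 ^+ n)%R).
- by move=> eta; exact: LC_ge0.
- move=> eta; rewrite lee_fin ler_wpM2l// lerXn2r// nnegrE//.
  exact: le_trans B12.
Qed.

Lemma LCnormD B G H : (0 <= B)%R -> conf_measurable G -> conf_measurable H ->
  LCnorm B (fun eta => G eta + H eta)%R <= LCnorm B G + LCnorm B H.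
Proof.
move=> B0 mG mH; rewrite /LCnorm -LPintD.
- apply: LPint_le.
  + exact: (@cmeas_LC (fun n => B ^+ n)%R _ (conf_measurableD mG mH)).
  + apply: cmeasD; [exact: (@cmeas_LC (fun n => B ^+ n)%R _ mG)|].
    exact: (@cmeas_LC (fun n => B ^+ n)%R _ mH).
  + by move=> eta; exact: (LC_ge0 (fun eta => G eta + H eta)%R).
  + move=> eta; rewrite -EFinD lee_fin -mulrDl ler_wpM2r ?exprn_ge0//.
    exact: ler_normD.
- exact: (@cmeas_LC (fun n => B ^+ n)%R _ mG).
- exact: (@cmeas_LC (fun n => B ^+ n)%R _ mH).
- by move=> eta; exact: LC_ge0.
- by move=> eta; exact: LC_ge0.
Qed.

Lemma LCnormZ B (c : R) G : (0 <= B)%R -> conf_measurable G ->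
  LCnorm B (fun eta => c * G eta)%R = `|c|%:E * LCnorm B G.
Proof.
move=> B0 mG; rewrite /LCnorm -LPintZ//.
- by congr LPint; apply/funext => eta; rewrite -EFinM normrM mulrA.
- exact: (@cmeas_LC (fun n => B ^+ n)%R _ mG).
- by move=> eta; exact: LC_ge0.
Qed.

End LCnorm_theory.

(** * Domination of [L_2] by the majorant *)

Section operator_estimates.
Context {R : realType} {d : nat}.
Notation T := (pt R d.+1).
Variables (phi : T -> R) (beta z : R).
Hypothesis mphi : measurable_fun setT phi.
Hypothesis phi_ge0 : forall x, 0 <= phi x.
Hypothesis phi_even : forall x, phi (topp x) = phi x.
Hypothesis int_phi : intRd (fun x => (phi x)%:E) = beta%:E.
Hypothesis beta_gt0 : 0 < beta.
Hypothesis z_ge0 : 0 <= z.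
Implicit Types (G U V : conf R d.+1 -> R).
Local Open Scope ereal_scope.

Let mEphi : measurable_fun setT (fun x => (phi x)%:E).
Proof. exact: measurableT_comp. Qed.

(** Evenness exchanges [x - y] and [y - x]; translation invariance does the rest. *)
Lemma integral_phi_tsub (x : T) : \int[muRd d.+1]_y (phi (tsub x y))%:E = beta%:E.
Proof.
have p0 (y : T) : 0 <= (phi y)%:E by rewrite lee_fin.
rewrite -int_phi -(intRd_shift x mEphi p0) intRdE//; last first.
  apply: (measurableT_comp mEphi).
  by apply: measurable_tsub; [exact: measurable_id|exact: measurable_cst].
apply: eq_integral => y _; congr EFin; rewrite -phi_even; congr phi.
by apply: eq_from_tnth => i; rewrite !tnth_mktuple opprB.
Qed.

Definition absval G : seq T -> \bar R := on_uniq 0 (fun eta => `|G eta|%:E).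

Lemma absval_ge0 G s : 0 <= absval G s.
Proof. by apply: on_uniq_ge0 => eta; rewrite lee_fin. Qed.

Lemma smeas_absval G : conf_measurable G -> smeas (absval G).
Proof. by move=> /conf_measurable_norm/cmeas_EFin. Qed.

(** The right-hand side is the norm of [L1 G]: under the condition on [B], the part [L_2] is bounded
    relative to [L_1] with constant one. *)
Lemma ssum_Mop_le B G : (0 < B)%R -> (z * expR (B * beta) <= B)%R ->
  conf_measurable G ->
  ssum (fun s => (B ^+ size s)%:E * Mop phi z (absval G) s) <=
  LPint (fun eta => (`|G eta| * ((Defs.card eta)%:R * B ^+ Defs.card eta))%:E).
Proof.
move=> B0 zB mG.
have mg := smeas_absval mG; have g0 := absval_ge0 G.
rewrite (ssum_size (f := fun n => B ^+ n)%R)//; last 3 first.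
- by move=> n; rewrite exprn_ge0// ltW.
- exact: smeas_Mop.
- by move=> s; exact: Mop_ge0.
rewrite (eq_eseriesr (g := fun n => (B ^+ n / n`!%:R)%:E * (z%:E *
    \sum_(m <- masks n) (beta ^+ count negb m)%:E *
      sint (count id m).+1 (absval G)))); last first.
  move=> n _; rewrite (sint_Mop mphi phi_ge0 (ltW beta_gt0) integral_phi_tsub)//.
apply: le_trans (binomial_series_le (a := fun n => sint n (absval G)) B0
  (ltW beta_gt0) z_ge0 _) _.
  by move=> n; exact: sint_ge0.
rewrite LPintE; last 2 first.
- exact: (@cmeas_LC _ _ (fun n => n%:R * B ^+ n)%R _ mG).
- by move=> eta; rewrite lee_fin mulr_ge0// mulr_ge0// exprn_ge0// ltW.
rewrite [leRHS](_ : _ = ssum (fun s =>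
    ((size s)%:R * B ^+ size s)%:E * absval G s)); last first.
  congr ssum; apply/funext => s; rewrite /absval /on_uniq; case: ifP => us.
    by rewrite card_confs// -EFinM mulrC.
  by rewrite mule0.
have nB0 n : (0 <= n%:R * B ^+ n)%R by rewrite mulr_ge0// exprn_ge0// ltW.
rewrite (ssum_size (f := fun n => n%:R * B ^+ n)%R)// -[leRHS]mul1e.
apply: lee_wpmul2r.
  apply: nneseries_ge0 => n _ _; rewrite mule_ge0 ?sint_ge0// lee_fin.
  by rewrite divr_ge0.
by rewrite lee_fin ler_pdivrMr// mul1r.
Qed.

(** The integrand splits as [w' (U - V) + (w - w') U]. The first term serves dissipativity and the
    second carries the perturbation, placed on [U] alone since only [U] is measured in the stronger
    norm. *)
Lemma L2gen_diff (a b a' b' : T -> R) (c : R) U V s :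
  measurable_fun setT a -> measurable_fun setT b ->
  measurable_fun setT a' -> measurable_fun setT b' ->
  conf_measurable U -> conf_measurable V -> uniq s -> (0 <= c)%R ->
  (forall m x, size m = size s -> `|wker a' b' m s x| <= kern phi m s x)%R ->
  (forall m x, size m = size s ->
    `|wker a b m s x - wker a' b' m s x| <= c * kern phi m s x)%R ->
  `|L2gen a b z U (confs s) - L2gen a' b' z V (confs s)|%:E <=
  Mop phi z (absval (fun eta => U eta - V eta)%R) s +
  c%:E * Mop phi z (absval U) s.
Proof.
move=> ma mb ma' mb' mU mV us c0 w' ww'.
have mUV := conf_measurableB mU mV.
have mk m : measurable_fun setT (fun x => (kern phi m s x)%:E).
  apply: measurableT_comp => //.
  exact: (measurableT_comp (measurable_kern mphi m (n := size s))
    (measurable_pair2 (in_tuple s))).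
have mab G m : conf_measurable G ->
    measurable_fun setT (fun x => absval G (x :: mask m s)).
  move=> mG; exact: (measurableT_comp (smeas_cons_mask m (smeas_absval mG) (n := size s))
    (measurable_pair2 (in_tuple s))).
have mabk G m : conf_measurable G ->
    measurable_fun setT (fun x => absval G (x :: mask m s) * (kern phi m s x)%:E).
  by move=> mG; apply: emeasurable_funM => //; exact: mab.
have abk0 G m x : 0 <= absval G (x :: mask m s) * (kern phi m s x)%:E.
  by rewrite mule_ge0 ?absval_ge0// lee_fin kern_ge0.
rewrite /Mop muleCA -ge0_muleDr; last 2 first.
- by apply: sume_ge0 => m _; exact: integral_ge0.
- by rewrite mule_ge0//; apply: sume_ge0 => m _; exact: integral_ge0.
rewrite !L2gen_confs// -mulrBr normrM (ger0_norm z_ge0) EFinM.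
apply: lee_wpmul2l; first by rewrite lee_fin.
rewrite -sumrB; apply: le_trans (_ : (\sum_(m <- masks (size s))
  `|RintRd (fun x => wker a b m s x * U (confs (x :: mask m s))) -
    RintRd (fun x => wker a' b' m s x * V (confs (x :: mask m s)))|)%R%:E <= _).
  by rewrite lee_fin ler_norm_sum.
rewrite -sumEFin ge0_sume_distrr; last by move=> m _; exact: integral_ge0.
rewrite -big_split/= big_seq [leRHS]big_seq; apply: lee_sum => m.
rewrite mem_masks => /eqP sm.
have mwU := measurable_L2gen_integrand m ma mb mU us.
have mwV := measurable_L2gen_integrand m ma' mb' mV us.
apply: le_trans (le_normB_RintRd mwU mwV) _.
rewrite -ge0_integralZl_EFin//; last exact: mabk.
rewrite -ge0_integralD//; last 3 first.
- exact: mabk.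
- by move=> x _; rewrite mule_ge0.
- by apply: measurable_funeM; exact: mabk.
apply: ae_ge0_le_integral => //.
- apply: measurableT_comp => //; apply: measurableT_comp => //.
  exact: measurable_funB.
- by move=> x _; rewrite adde_ge0// mule_ge0.
- apply: emeasurable_funD; first exact: mabk.
  by apply: measurable_funeM; exact: mabk.
(* For [x] in the mask the majorant vanishes while the integrand may not; such [x] form a null
   set. *)
apply: filterS (ae_notin (mask m s)) => x xs _.
have ux : uniq (x :: mask m s) by rewrite /= xs mask_uniq.
rewrite /absval /on_uniq ux -!EFinM -EFinD lee_fin.
set u := U _; set v := V _.
rewrite (_ : _ - _ = wker a' b' m s x * (u - v) +
  (wker a b m s x - wker a' b' m s x) * u)%R; last by ring.
apply: (le_trans (ler_normD _ _)); apply: lerD; rewrite normrM.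
  by rewrite [leRHS]mulrC ler_wpM2r// w'.
by rewrite mulrCA [leRHS]mulrC ler_wpM2r// ww'.
Qed.

End operator_estimates.

(** * Domains of the generators and the Euler inequality *)

Section generator_estimates.
Context {R : realType} {d : nat}.
Notation T := (pt R d.+1).
Variables (phi : T -> R) (beta z : R).
Hypothesis mphi : measurable_fun setT phi.
Hypothesis phi_ge0 : forall x, 0 <= phi x.
Hypothesis phi_even : forall x, phi (topp x) = phi x.
Hypothesis int_phi : intRd (fun x => (phi x)%:E) = beta%:E.
Hypothesis beta_gt0 : 0 < beta.
Hypothesis z_ge0 : 0 <= z.
Implicit Types (G U V : conf R d.+1 -> R).
Local Open Scope ereal_scope.

Definition card_norm (C : R) G : \bar R :=
  LPint (fun eta => (`|G eta| * ((Defs.card eta)%:R * C ^+ Defs.card eta))%:E).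

Lemma cmeas_card_norm C G : conf_measurable G ->
  cmeas (fun eta => (`|G eta| * ((Defs.card eta)%:R * C ^+ Defs.card eta))%:E).
Proof. by move=> mG; exact: (@cmeas_LC _ _ (fun n => n%:R * C ^+ n)%R _ mG). Qed.

Let card_norm_integrand_ge0 C G eta : (0 <= C)%R ->
  0 <= (`|G eta| * ((Defs.card eta)%:R * C ^+ Defs.card eta))%:E.
Proof. by move=> C0; rewrite lee_fin mulr_ge0// mulr_ge0// exprn_ge0. Qed.

(** From [n <= 2^n]: this is how membership in [L_(2C)] makes [L1 G] integrable. *)
Lemma card_norm_le C G : (0 <= C)%R -> conf_measurable G ->
  card_norm C G <= LCnorm (2 * C) G.
Proof.
move=> C0 mG; apply: LPint_le.
- exact: cmeas_card_norm.
- exact: (@cmeas_LC _ _ (fun n => (2 * C) ^+ n)%R _ mG).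
- by move=> eta; exact: card_norm_integrand_ge0.
- move=> eta; rewrite lee_fin ler_wpM2l// exprMn ler_wpM2r ?exprn_ge0//.
  exact: nat_le_exp2.
Qed.

Lemma LCnorm_L1 C G : LCnorm C (L1 G) = card_norm C G.
Proof.
congr LPint; apply/funext => eta; congr EFin.
by rewrite /L1 mulNr normrN normrM normr_nat mulrCA mulrA.
Qed.

Lemma conf_measurable_L1 G : conf_measurable G -> conf_measurable (L1 G).
Proof.
move=> mG; apply: (conf_measurableM _ mG).
exact: (conf_measurable_card (fun n => - n%:R)%R).
Qed.

Lemma inLC_generator (a b : T -> R) C G :
  measurable_fun setT a -> measurable_fun setT b -> (0 < C)%R ->
  (z * expR (C * beta) <= C)%R ->
  (forall m s x, `|wker a b m s x| <= kern phi m s x)%R ->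
  inLC (2 * C) G -> inLC C (fun eta => L1 G eta + L2gen a b z G eta)%R.
Proof.
move=> ma mb C0 zC w [mG nG].
have mL := conf_measurable_L2gen z ma mb mG.
have m1 := conf_measurable_L1 mG.
split; first exact: conf_measurableD.
apply: le_lt_trans (LCnormD (ltW C0) m1 mL) _.
rewrite lte_add_pinfty// ?LCnorm_L1; apply: le_lt_trans nG.
  exact: (card_norm_le (ltW C0) mG).
apply: le_trans (card_norm_le (ltW C0) mG).
apply: le_trans (ssum_Mop_le mphi phi_ge0 phi_even int_phi beta_gt0 z_ge0 C0 zC mG).
apply: LPint_le_ssum.
- exact: (@cmeas_LC _ _ (fun n => C ^+ n)%R _ mL).
- move=> n; apply: emeasurable_funM; first exact: (smeas_size (fun n => C ^+ n)%R).
  by apply: smeas_Mop => //; [exact: smeas_absval|exact: absval_ge0].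
- by move=> eta; apply: LC_ge0; exact: ltW.
- move=> s; apply: mule_ge0; first by rewrite lee_fin exprn_ge0// ltW.
  by apply: Mop_ge0 => // t; exact: absval_ge0.
move=> s us; rewrite card_confs// mulrC EFinM.
apply: lee_wpmul2l; first by rewrite lee_fin exprn_ge0// ltW.
(* With [V = 0], equal weights and [c = 0], the difference estimate reduces to domination of [L2gen]
   by the majorant. *)
have := @L2gen_diff _ _ phi z mphi phi_ge0 z_ge0 a b a b 0%R G (fun=> 0%R) s ma mb ma mb mG
  (conf_measurable_cst 0) us (lexx _).
rewrite L2gen0 mul0e adde0 subr0.
rewrite (_ : (fun eta => _) = G); last by apply/funext => eta; rewrite subr0.
by apply => m x sm //; rewrite subrr normr0 mul0r.
Qed.

Let mcst1 : measurable_fun [set: T] (fun=> 1%R : R).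
Proof. exact: measurable_cst. Qed.

Let mNphi : measurable_fun setT (fun v : T => - phi v)%R.
Proof. exact: measurableT_comp. Qed.

Lemma inLC_LV C G : (0 < C)%R -> (z * expR (C * beta) <= C)%R ->
  inLC (2 * C) G -> inLC C (LV phi z G).
Proof.
move=> C0 zC mG; rewrite /LV L2VE; apply: inLC_generator => //.
by move=> m s x; rewrite wker_V.
Qed.

Variables (phibar eps : R).
Hypothesis phi_le : forall x, (phi x <= phibar)%R.
Hypothesis eps_gt0 : (0 < eps)%R.

Let maeps : measurable_fun setT (aeps phi eps).
Proof.
apply: measurableT_comp; first exact: measurable_expR.
apply: measurableT_comp => //.
by apply: measurable_funM => //; exact: measurable_cst.
Qed.

Let mbeps : measurable_fun setT (beps phi eps).
Proof.
by apply: measurable_funM => //; apply: measurable_funB.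
Qed.

Lemma inLC_Lren C G : (0 < C)%R -> (z * expR (C * beta) <= C)%R ->
  inLC (2 * C) G -> inLC C (Lren phi z eps G).
Proof.
move=> C0 zC mG; rewrite /Lren L2epsE; apply: (inLC_generator maeps mbeps) => //.
by move=> m s x; apply: wker_eps.
Qed.

Lemma phibar_ge0 : (0 <= phibar)%R.
Proof. exact: le_trans (phi_ge0 [tuple 0%R | i < d.+1]) (phi_le _). Qed.

(** The factor [size s] is absorbed between the levels [q^2 C] and [q C]. The Mecke-type bound at
    level [q C] then creates a new factor [n], absorbed between [q C] and [C]; hence the square. *)
Lemma ssum_size_Mop_le C q U : (0 < C)%R -> (0 < q < 1)%R ->
  (z * expR (q * C * beta) <= q * C)%R -> conf_measurable U ->
  ssum (fun s => ((size s)%:R * (q ^+ 2 * C) ^+ size s)%:E *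
    Mop phi z (absval U) s) <= ((q^-1 - 1)^-1 ^+ 2)%:E * LCnorm C U.
Proof.
move=> C0 /andP[q0 q1] zq mU; set c := (q^-1 - 1)^-1%R.
have qC : (0 < q * C)%R by rewrite mulr_gt0.
have c0 : (0 <= c)%R.
  by rewrite invr_ge0 subr_ge0 ltW// invf_gt1.
have mM : smeas (Mop phi z (absval U)).
  by apply: smeas_Mop => //; [exact: smeas_absval|exact: absval_ge0].
have M0 s : 0 <= Mop phi z (absval U) s.
  by apply: Mop_ge0 => // t; exact: absval_ge0.
apply: (@le_trans _ _ (c%:E * card_norm (q * C) U)).
  apply: le_trans (lee_wpmul2l _ (ssum_Mop_le mphi phi_ge0 phi_even int_phi
    beta_gt0 z_ge0 qC zq mU)); last by rewrite lee_fin.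
  rewrite -ssumZ//; last 2 first.
  - move=> n; apply: emeasurable_funM; last exact: mM.
    exact: (smeas_size (fun n => (q * C) ^+ n)%R).
  - by move=> s; rewrite mule_ge0// lee_fin exprn_ge0// ltW.
  apply: ssum_le.
  - move=> n; apply: emeasurable_funM; last exact: mM.
    exact: (smeas_size (fun n => n%:R * (q ^+ 2 * C) ^+ n)%R).
  - move=> n; apply: measurable_funeM; apply: emeasurable_funM; last exact: mM.
    exact: (smeas_size (fun n => (q * C) ^+ n)%R).
  - move=> s; rewrite mule_ge0// lee_fin mulr_ge0// exprn_ge0// ltW//.
    by rewrite mulr_gt0// exprn_gt0.
  - move=> s; rewrite [leRHS]muleA -EFinM; apply: lee_wpmul2r => //.
    rewrite lee_fin (_ : q ^+ 2 * C = q * (q * C))%R; last by rewrite expr2 mulrA.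
    rewrite exprMn mulrA; apply: ler_wpM2r; last exact: nat_mul_exp_le.
    by rewrite exprn_ge0// ltW.
rewrite expr2 EFinM -muleA; apply: lee_wpmul2l; first by rewrite lee_fin.
rewrite -LPintZ//; last 2 first.
- exact: (@cmeas_LC _ _ (fun n => C ^+ n)%R _ mU).
- by move=> eta; apply: LC_ge0; exact: ltW.
apply: LPint_le.
- exact: cmeas_card_norm.
- apply: cmeasM; first exact: (cmeas_EFin (conf_measurable_cst c)).
  exact: (@cmeas_LC _ _ (fun n => C ^+ n)%R _ mU).
- by move=> eta; apply: card_norm_integrand_ge0; exact: ltW.
- move=> eta; rewrite -EFinM lee_fin [leRHS]mulrCA ler_wpM2l// exprMn mulrA.
  by apply: ler_wpM2r; [rewrite exprn_ge0// ltW|exact: nat_mul_exp_le].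
Qed.

(** With [W = U - V] and [X] the Euler residual, the negative diagonal operator [L1] gives [(1 + h
    n) |W| <= |X| + h |L_2eps U - L_2V V|] on configurations of [n] points. After integration the
    extra term [h n |W|] compensates exactly the bound for the majorant applied to [W], and only the
    perturbation remains. *)
Lemma LCnorm_step_le C q h U V : (0 < C)%R -> (0 < q < 1)%R ->
  (z * expR (q * C * beta) <= q * C)%R ->
  (z * expR (q ^+ 2 * C * beta) <= q ^+ 2 * C)%R ->
  (0 <= h)%R -> inLC (2 * C) U -> inLC (2 * C) V ->
  LCnorm (q ^+ 2 * C) (fun eta => U eta - V eta)%R <=
  LCnorm (q ^+ 2 * C) (fun eta => U eta - V eta
    - h * (Lren phi z eps U eta - LV phi z V eta))%R +
  (h * eps * (phibar * (q^-1 - 1)^-1 ^+ 2))%:E * LCnorm C U.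
Proof.
move=> C0 q01 zq zq2 h0 [mU nU] [mV nV]; have /andP[q0 q1] := q01.
set B := (q ^+ 2 * C)%R; have B0 : (0 < B)%R by rewrite mulr_gt0// exprn_gt0.
have B0' := ltW B0.
pose W eta := (U eta - V eta)%R; rewrite -/W.
have mW : conf_measurable W by exact: conf_measurableB.
pose X eta := (U eta - V eta - h * (Lren phi z eps U eta - LV phi z V eta))%R.
rewrite -/X.
have mLU : conf_measurable (Lren phi z eps U).
  rewrite /Lren L2epsE; apply: conf_measurableD; first exact: conf_measurable_L1.
  exact: (conf_measurable_L2gen z maeps mbeps).
have mLV : conf_measurable (LV phi z V).
  rewrite /LV L2VE; apply: conf_measurableD; first exact: conf_measurable_L1.
  exact: (conf_measurable_L2gen z mcst1 mNphi).
have mX : conf_measurable X.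
  apply: conf_measurableB => //; apply: conf_measurableM.
    exact: conf_measurable_cst.
  exact: conf_measurableB.
have mM G : conf_measurable G -> smeas (Mop phi z (absval G)).
  by move=> mG; apply: smeas_Mop => //; [exact: smeas_absval|exact: absval_ge0].
have M0 G s : 0 <= Mop phi z (absval G) s.
  by apply: Mop_ge0 => // t; exact: absval_ge0.
(* This finiteness, due to [U] and [V] lying in [L_(2C)], is what permits the final cancellation. *)
have card_normW : card_norm B W \is a fin_num.
  rewrite ge0_fin_numE; last first.
    by apply: LPint_ge0; [exact: cmeas_card_norm|move=> eta; exact: card_norm_integrand_ge0].
  apply: le_lt_trans (card_norm_le B0' mW) _.
  apply: le_lt_trans (LCnormD _ mU (conf_measurableN mV)) _.
    by rewrite mulr_ge0.
  have BC : (2 * B <= 2 * C)%R.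
    by rewrite ler_pM2l// /B ger_pMl// exprn_ile1// ltW.
  have B20 : (0 <= 2 * B)%R by rewrite mulr_ge0.
  rewrite lte_add_pinfty//.
    exact: le_lt_trans (LCnorm_le B20 BC mU) nU.
  apply: le_lt_trans nV.
  rewrite (_ : LCnorm _ _ = LCnorm (2 * B) V); first exact: LCnorm_le.
  by congr LPint; apply/funext => eta; rewrite normrN.
have c0 : (0 <= eps * phibar)%R by rewrite mulr_ge0 ?phibar_ge0// ltW.
have mhN : cmeas (fun eta => h%:E *
    (`|W eta| * ((Defs.card eta)%:R * B ^+ Defs.card eta))%:E).
  apply: cmeasM; [exact: (cmeas_EFin (conf_measurable_cst h))|exact: cmeas_card_norm].
have mBW := @cmeas_LC _ _ (fun n => B ^+ n)%R _ mW.
have mBX := @cmeas_LC _ _ (fun n => B ^+ n)%R _ mX.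
have sBn : smeas (fun s => (B ^+ size s)%:E * Mop phi z (absval W) s).
  move=> n; apply: emeasurable_funM; last exact: mM.
  exact: (smeas_size (fun n => B ^+ n)%R).
have snBn : smeas (fun s => ((size s)%:R * B ^+ size s)%:E *
    Mop phi z (absval U) s).
  move=> n; apply: emeasurable_funM; last exact: mM.
  exact: (smeas_size (fun n => n%:R * B ^+ n)%R).
have sBn0 s : 0 <= (B ^+ size s)%:E * Mop phi z (absval W) s.
  by rewrite mule_ge0// lee_fin exprn_ge0.
have snBn0 s : 0 <= ((size s)%:R * B ^+ size s)%:E * Mop phi z (absval U) s.
  by rewrite mule_ge0// lee_fin mulr_ge0// exprn_ge0.
pose g s := on_uniq 0 (fun eta => (`|X eta| * B ^+ Defs.card eta)%:E) s +
  (h%:E * ((B ^+ size s)%:E * Mop phi z (absval W) s) +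
   (h * (eps * phibar))%:E *
     (((size s)%:R * B ^+ size s)%:E * Mop phi z (absval U) s)).
have hc0 : (0 <= h * (eps * phibar))%R by rewrite mulr_ge0.
have main : LPint (fun eta => (`|W eta| * B ^+ Defs.card eta)%:E +
    h%:E * (`|W eta| * ((Defs.card eta)%:R * B ^+ Defs.card eta))%:E) <= ssum g.
  apply: LPint_le_ssum.
  - exact: cmeasD.
  - move=> n; apply: emeasurable_funD; first exact: mBX.
    by apply: emeasurable_funD; apply: measurable_funeM; [exact: sBn|exact: snBn].
  - move=> eta; apply: adde_ge0; first exact: LC_ge0.
    by apply: mule_ge0; [rewrite lee_fin|exact: card_norm_integrand_ge0].
  - move=> s; apply: adde_ge0; first by apply: on_uniq_ge0 => eta; exact: LC_ge0.
    by apply: adde_ge0; apply: mule_ge0; rewrite ?lee_fin.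
  move=> s us; rewrite /g /on_uniq us !card_confs//.
  set n := size s; set eta := confs s.
  have hd := @L2gen_diff _ _ phi z mphi phi_ge0 z_ge0 _ _ _ _
     (eps * phibar * n%:R)%R U V s maeps mbeps mcst1 mNphi mU mV us.
  have {}hd : `|L2eps phi z eps U eta - L2V phi z V eta|%:E <=
      Mop phi z (absval W) s +
      (eps * phibar * n%:R)%:E * Mop phi z (absval U) s.
    rewrite L2epsE L2VE; apply: hd.
    - by rewrite mulr_ge0.
    - by move=> m x _; rewrite wker_V.
    - by move=> m x sm; apply: wker_eps_V.
  (* In [X] the diagonal parts contribute [h n W], whence [(1 + h n) W] equals [X] plus [h] times
     the difference of the [L_2] terms. *)
  have h1 : ((1 + h * n%:R) * `|W eta| <=
      `|X eta| + h * `|L2eps phi z eps U eta - L2V phi z V eta|)%R.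
    rewrite -{2}(ger0_norm h0) -normrM.
    rewrite -[X in (X * _ <= _)%R]ger0_norm; last by rewrite addr_ge0// mulr_ge0.
    rewrite -normrM; apply: le_trans (ler_normD _ _).
    rewrite le_eqVlt; apply/orP; left; apply/eqP; congr (`|_|%R).
    rewrite /X /W /Lren /LV /L1 card_confs//; ring.
  apply: (@le_trans _ _ ((B ^+ n)%:E * ((`|X eta|)%:E +
     h%:E * (`|L2eps phi z eps U eta - L2V phi z V eta|)%:E))).
    rewrite -!EFinM -!EFinD lee_fin.
    rewrite (_ : _ + _ = B ^+ n * ((1 + h * n%:R) * `|W eta|))%R; last by ring.
    by rewrite ler_wpM2l// exprn_ge0.
  have Bn0 : 0 <= (B ^+ n)%:E by rewrite lee_fin exprn_ge0.
  rewrite (ge0_muleDr); last 2 first.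
  - by rewrite lee_fin.
  - by rewrite mule_ge0// lee_fin.
  rewrite -EFinM mulrC; apply: leeD => //.
  apply: (@le_trans _ _ ((B ^+ n)%:E * (h%:E * (Mop phi z (absval W) s +
      (eps * phibar * n%:R)%:E * Mop phi z (absval U) s)))).
    by apply: lee_wpmul2l => //; apply: lee_wpmul2l => //; rewrite lee_fin.
  have k0 : 0 <= (eps * phibar * n%:R)%:E by rewrite lee_fin mulr_ge0.
  move: (Mop phi z (absval W) s) (Mop phi z (absval U) s) (M0 W s) (M0 U s).
  move=> MW MU MW0 MU0.
  have hE : 0 <= h%:E by rewrite lee_fin.
  rewrite (@ge0_muleDr _ h%:E)//; last exact: mule_ge0.
  rewrite (@ge0_muleDr _ (B ^+ n)%:E); [|exact: mule_ge0|
    by apply: mule_ge0 => //; exact: mule_ge0].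
  apply: leeD; first by rewrite muleCA.
  rewrite !muleA -!EFinM.
  by rewrite (_ : (B ^+ n * _ * _ = h * (eps * phibar) * (n%:R * B ^+ n))%R)//; ring.
move: main; rewrite LPintD//; last 2 first.
- by move=> eta; exact: LC_ge0.
- by move=> eta; apply: mule_ge0; [rewrite lee_fin|exact: card_norm_integrand_ge0].
rewrite LPintZ//; [|exact: cmeas_card_norm|by move=> eta; exact: card_norm_integrand_ge0].
rewrite /g ssumD//; last 3 first.
- move=> n; by apply: emeasurable_funD; apply: measurable_funeM; [exact: sBn|exact: snBn].
- by move=> s; apply: on_uniq_ge0 => eta; exact: LC_ge0.
- by move=> s; apply: adde_ge0; apply: mule_ge0; rewrite ?lee_fin.
rewrite ssumD//; last 4 first.
- by move=> n; apply: measurable_funeM; exact: sBn.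
- by move=> n; apply: measurable_funeM; exact: snBn.
- by move=> s; rewrite mule_ge0// lee_fin.
- by move=> s; rewrite mule_ge0// lee_fin.
rewrite !ssumZ// -LPintE//; last by move=> eta; exact: LC_ge0.
rewrite -/(LCnorm B W) -/(LCnorm B X) -/(card_norm B W) => main.
have hN : h%:E * card_norm B W \is a fin_num by rewrite fin_numM.
(* The term [h * card_norm B W] is added to both sides: on the left it comes from [L1], on the right
   it bounds the majorant applied to [W]. *)
rewrite -(leeD2rE _ _ hN).
apply: (le_trans main); rewrite -addeA; apply: leeD => //.
rewrite [leLHS]addeC; apply: leeD.
  rewrite (_ : h * eps * _ = h * (eps * phibar) * (q^-1 - 1)^-1 ^+ 2)%R; last by ring.
  rewrite [in leRHS]EFinM -muleA; apply: lee_wpmul2l; first by rewrite lee_fin.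
  exact: ssum_size_Mop_le.
apply: lee_wpmul2l; first by rewrite lee_fin.
exact: (ssum_Mop_le mphi phi_ge0 phi_even int_phi beta_gt0 z_ge0 B0 zq2 mW).
Qed.

End generator_estimates.

(** * Comparison of contraction semigroups *)

Lemma subr_swap (V : zmodType) (x a b c e : V) :
  x - a + b - (x - c + e) = (b - e) - (a - c).
Proof.
rewrite opprD opprB addrACA (_ : x - a + (c - x) = c - a).
  by rewrite opprB addrC.
by rewrite addrC addrA subrK.
Qed.

Lemma subrBB (V : zmodType) (a b c e : V) : (a - b) - (c - e) = (a - c) - (b - e).
Proof. by rewrite !opprB addrACA [RHS]addrACA [- b - c]addrC. Qed.

Section seminorm.
Context {R : realType} {V : lmodType R}.
Variables (P : V -> Prop).

(** Functions at distance zero are not identified, and the real-valued norm is meaningful only where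
    it is finite; hence a seminorm with its laws restricted to [P]. *)
Record seminorm_on (n : V -> R) : Prop := SeminormOn {
  sn_ge0 : forall f, P f -> 0 <= n f;
  sn_add : forall f g, P f -> P g -> n (f + g) <= n f + n g;
  sn_scale : forall a f, P f -> n (a *: f) = `|a| * n f }.

Hypothesis PD : forall f g, P f -> P g -> P (f + g).
Hypothesis PZ : forall a f, P f -> P (a *: f).

Lemma P_opp f : P f -> P (- f).
Proof. by move=> /(PZ (- 1)); rewrite scaleN1r. Qed.

Lemma P_sub f g : P f -> P g -> P (f - g).
Proof. by move=> Pf /P_opp; exact: PD. Qed.

Variable n : V -> R.
Hypothesis sn : seminorm_on n.

Lemma sn_opp f : P f -> n (- f) = n f.
Proof. by move=> Pf; rewrite -scaleN1r sn_scale// normrN1 mul1r. Qed.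

Lemma sn_sub f g : P f -> P g -> n (f - g) <= n f + n g.
Proof. by move=> Pf Pg; rewrite -(sn_opp Pg); apply: sn_add => //; exact: P_opp. Qed.

Lemma sn_subC f g : P f -> P g -> n (f - g) = n (g - f).
Proof. by move=> Pf Pg; rewrite -sn_opp ?opprB//; exact: P_sub. Qed.

Lemma sn_tri f g h : P f -> P g -> P h -> n (f - h) <= n (f - g) + n (g - h).
Proof.
move=> Pf Pg Ph; rewrite -[f - h](subrKA g); apply: sn_add => //; exact: P_sub.
Qed.

Lemma sn_le f g : P f -> P g -> n f <= n g + n (f - g).
Proof.
move=> Pf Pg; rewrite -[X in n X <= _](subrK g) addrC; apply: sn_add => //.
exact: P_sub.
Qed.

Lemma sn0 f : P f -> n 0 = 0.
Proof. by move=> Pf; rewrite -(scale0r f) sn_scale// normr0 mul0r. Qed.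

End seminorm.

Section semigroup.
Context {R : realType} {V : lmodType R}.
Variables (P : V -> Prop) (nC : V -> R).
Hypothesis PD : forall f g, P f -> P g -> P (f + g).
Hypothesis PZ : forall a f, P f -> P (a *: f).
Hypothesis snC : seminorm_on P nC.

Record contraction_semigroup (T : R -> V -> V) : Prop := ContractionSemigroup {
  cs_in : forall t G, 0 <= t -> P G -> P (T t G);
  cs_lin : forall t (a b : R) G H, 0 <= t -> P G -> P H ->
    nC (T t (a *: G + b *: H) - (a *: T t G + b *: T t H)) = 0;
  cs_0 : forall G, P G -> nC (T 0 G - G) = 0;
  cs_add : forall s t G, 0 <= s -> 0 <= t -> P G ->
    nC (T (s + t) G - T s (T t G)) = 0;
  cs_contr : forall t G, 0 <= t -> P G -> nC (T t G) <= nC G;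
  cs_cont : forall G, P G -> forall e : R, 0 < e -> exists2 delta : R, 0 < delta &
    forall t, 0 <= t -> t < delta -> nC (T t G - G) < e }.

Definition generates (T : R -> V -> V) (G H : V) : Prop :=
  forall e : R, 0 < e -> exists2 delta : R, 0 < delta &
    forall t : R, 0 < t -> t < delta -> nC (t^-1 *: (T t G - G) - H) < e.

(** Consistency error of an implicit Euler step per unit of time: the difference quotient against
    the generator, plus the displacement of [H], because the generator is evaluated at the end of
    the step. *)
Definition step_error (T : R -> V -> V) (G H : V) (h : R) : R :=
  nC (h^-1 *: (T h G - G) - H) + nC (T h H - H).

Local Notation PB := (P_sub PD PZ).

Section one_semigroup.
Variable T : R -> V -> V.
Hypothesis cs : contraction_semigroup T.

Let Tin := cs_in cs.

Lemma cs_sub t G H : 0 <= t -> P G -> P H ->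
  nC (T t (G - H) - (T t G - T t H)) = 0.
Proof.
move=> t0 PG PH; have := cs_lin cs 1 (-1) t0 PG PH.
by rewrite !scale1r !scaleN1r.
Qed.

Lemma cs_lip t G H : 0 <= t -> P G -> P H -> nC (T t G - T t H) <= nC (G - H).
Proof.
move=> t0 PG PH; have PGH := PB PG PH.
have Q1 := Tin t0 PG; have Q2 := Tin t0 PH; have Q3 := Tin t0 PGH.
have := sn_le PD PZ snC (PB Q1 Q2) Q3.
rewrite (sn_subC PD PZ snC (PB Q1 Q2) Q3) cs_sub// addr0 => /le_trans; apply.
exact: (cs_contr cs).
Qed.

(** If [Q] is the difference quotient at time [t], then [G - h Q = (1 + h/t) G - (h/t) T t G], whose
    norm is at least that of [G] by contraction; [Q] tends to [H]. *)
Lemma generates_contraction_dissipative G H h : P G -> P H -> 0 <= h ->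
  generates T G H -> nC G <= nC (G - h *: H).
Proof.
move=> PG PH h0 gG; apply/ler_addgt0Pl => e e0.
have e'0 : 0 < e / (1 + h) by rewrite divr_gt0// ltr_pwDl.
have [dl dl0 Hd] := gG _ e'0.
pose t := dl / 2; have t0 : 0 < t by rewrite divr_gt0.
have tdl : t < dl by rewrite /t; lra.
have {}Hd := Hd t t0 tdl.
have PT := Tin (ltW t0) PG.
have PQ : P (t^-1 *: (T t G - G)) by apply: PZ; exact: PB.
set Q := t^-1 *: (T t G - G) in Hd PQ.
have PhQ : P (G - h *: Q) by apply: PB => //; exact: PZ.
have PhH : P (G - h *: H) by apply: PB => //; exact: PZ.
have h1 := sn_le PD PZ snC PhQ PhH.
have d1 : nC (G - h *: Q - (G - h *: H)) <= h * (e / (1 + h)).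
  rewrite (_ : _ - _ = - (h *: (Q - H))); last first.
    by rewrite scalerBr !opprB addrC addrA subrK.
  rewrite (sn_opp snC); last by apply: PZ; exact: PB.
  rewrite (sn_scale snC); last exact: PB.
  by rewrite (ger0_norm h0) ler_wpM2l// ltW.
have h2 : (1 + h / t) * nC G - h / t * nC (T t G) <= nC (G - h *: Q).
  have -> : G - h *: Q = (1 + h / t) *: G - (h / t) *: T t G.
    by rewrite /Q scalerA scalerBr scalerDl scale1r opprB addrA.
  have ht0 : 0 <= h / t by rewrite divr_ge0// ltW.
  have := sn_le PD PZ snC (PZ (1 + h / t) PG) (PZ (h / t) PT).
  rewrite !(sn_scale snC)// (ger0_norm ht0) ger0_norm; last by rewrite addr_ge0.
  lra.
have h3 := cs_contr cs (ltW t0) PG.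
have h4 : h / t * nC (T t G) <= h / t * nC G.
  by rewrite ler_wpM2l// divr_ge0// ltW.
have h5 : h * (e / (1 + h)) <= e.
  rewrite mulrA ler_pdivrMr ?ltr_pwDl//; rewrite mulrDr mulr1 mulrC lerDr ltW//.
lra.
Qed.

(** [T s] maps the difference quotient of [G] to that of [T s G], up to distance zero, and it
    contracts. *)
Lemma generates_shift s G H : 0 <= s -> P G -> P H ->
  generates T G H -> generates T (T s G) (T s H).
Proof.
move=> s0 PG PH gG e e0; have [dl dl0 Hd] := gG e e0; exists dl => // t t0 tdl.
apply: le_lt_trans (Hd t t0 tdl).
have t0' := ltW t0; have st0 : 0 <= s + t by rewrite addr_ge0.
have PTt := Tin t0' PG; have PTs := Tin s0 PG; have PTsH := Tin s0 PH.
have PTst := Tin s0 PTt; have PTts := Tin t0' PTs; have PTst' := Tin st0 PG.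
have PQ : P (t^-1 *: (T t G - G)) by apply: PZ; exact: PB.
set Q := t^-1 *: (T t G - G) in PQ *.
have PTQ := Tin s0 PQ.
apply: le_trans (cs_lip s0 PQ PH).
have P1 : P (t^-1 *: (T t (T s G) - T s G)) by apply: PZ; exact: PB.
apply: le_trans (sn_tri PD PZ snC P1 PTQ PTsH) _.
rewrite gerDr; apply: le_trans (_ : _ <= 0) _ => //.
have P2 : P (t^-1 *: (T s (T t G) - T s G)) by apply: PZ; exact: PB.
apply: le_trans (sn_tri PD PZ snC P1 P2 PTQ) _.
have -> : nC (t^-1 *: (T s (T t G) - T s G) - T s Q) = 0.
  rewrite (sn_subC PD PZ snC P2 PTQ).
  have := cs_lin cs t^-1 (- t^-1) s0 PTt PG.
  by rewrite !scaleNr -!scalerBr.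
rewrite addr0 -scalerBr (sn_scale snC); last by apply: PB; exact: PB.
rewrite opprB addrA subrK.
have -> : nC (T t (T s G) - T s (T t G)) = 0; last by rewrite mulr0.
apply/eqP; rewrite eq_le (sn_ge0 snC); last exact: PB.
rewrite andbT; apply: le_trans (sn_tri PD PZ snC PTts PTst' PTst) _.
rewrite (cs_add cs)// addr0 (sn_subC PD PZ snC)// (addrC s t).
by rewrite (cs_add cs).
Qed.

(** Up to distance zero the residual of the step from [s] to [s + h] is the image under [T s] of the
    residual at time zero. Contraction makes the bound uniform in [s]. *)
Lemma step_error_bound s h G H : 0 <= s -> 0 < h -> P G -> P H ->
  nC (T s G - T (s + h) G + h *: T (s + h) H) <= h * step_error T G H h.
Proof.
move=> s0 h0 PG PH; have h0' := ltW h0.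
have sh0 : 0 <= s + h by rewrite addr_ge0.
have PhG := Tin h0' PG; have PhH := Tin h0' PH.
have PsG := Tin s0 PG; have PsH := Tin s0 PH.
have P1 := Tin sh0 PG; have P2 := Tin sh0 PH.
have P3 := Tin s0 PhG; have P4 := Tin s0 PhH.
pose E := 1 *: (G - T h G) + h *: T h H.
have PGh := PB PG PhG.
have PE : P E by apply: PD; exact: PZ.
have PTE := Tin s0 PE.
have PL : P (T s G - T (s + h) G + h *: T (s + h) H).
  by apply: PD; [exact: PB|exact: PZ].
have PM : P (T s G - T s (T h G) + h *: T s (T h H)).
  by apply: PD; [exact: PB|exact: PZ].
have PN : P (1 *: T s (G - T h G) + h *: T s (T h H)).
  by apply: PD; apply: PZ => //; exact: Tin.
have a1 : nC (T s G - T (s + h) G + h *: T (s + h) H -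
    (T s G - T s (T h G) + h *: T s (T h H))) <= 0.
  rewrite (_ : _ - _ = h *: (T (s + h) H - T s (T h H)) -
      (T (s + h) G - T s (T h G))); last first.
    by rewrite scalerBr; exact: subr_swap.
  have Pa := PB P2 P4; have Pb := PB P1 P3.
  apply: le_trans (sn_sub PZ snC (PZ h Pa) Pb) _.
  by rewrite (sn_scale snC)// !(cs_add cs)// mulr0 addr0.
have a2 : nC (T s G - T s (T h G) + h *: T s (T h H) -
   (1 *: T s (G - T h G) + h *: T s (T h H))) = 0.
  rewrite opprD addrACA subrr addr0 scale1r (sn_subC PD PZ snC).
  - exact: cs_sub.
  - exact: PB.
  - exact: Tin.
have a3 : nC (1 *: T s (G - T h G) + h *: T s (T h H) - T s E) = 0.
  by rewrite (sn_subC PD PZ snC)// (cs_lin cs).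
have b1 := sn_le PD PZ snC PL PM.
have b2 := sn_le PD PZ snC PM PN.
have b3 := sn_le PD PZ snC PN PTE.
have b4 := cs_contr cs s0 PE.
suff b5 : nC E <= h * step_error T G H h by lra.
have PQ : P (h^-1 *: (T h G - G) - H).
  by apply: PB => //; apply: PZ; exact: PB.
have PTH : P (T h H - H) by exact: PB.
have -> : E = h *: (T h H - H - (h^-1 *: (T h G - G) - H)).
  rewrite /E scale1r opprB addrA subrK scalerBr scalerA mulfV ?gt_eqF// scale1r.
  by rewrite opprB addrC.
rewrite (sn_scale snC) ?(ger0_norm h0'); last exact: PB.
by rewrite ler_pM2l// /step_error [leRHS]addrC; exact: (sn_sub PZ snC).
Qed.

Lemma step_error_cvg G H : P G -> P H -> generates T G H ->
  forall e : R, 0 < e -> exists2 delta : R, 0 < delta &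
    forall h, 0 < h -> h < delta -> step_error T G H h < e.
Proof.
move=> PG PH gG e e0; have e20 : 0 < e / 2 by rewrite divr_gt0.
have [d1 d10 H1] := gG _ e20; have [d2 d20 H2] := cs_cont cs PH e20.
exists (Num.min d1 d2); first by rewrite lt_min d10.
move=> h h0; rewrite lt_min => /andP[hd1 hd2].
by rewrite /step_error [ltRHS]splitr ltrD ?H1 ?H2// ltW.
Qed.

End one_semigroup.

(** * Summation of the Euler steps *)

Section comparison.
Variables (nB : V -> R) (D : V -> Prop) (L1 L2 : V -> V) (T1 T2 : R -> V -> V).
Variable kappa : R.
Hypothesis snB : seminorm_on P nB.
Hypothesis nB_le : forall f, P f -> nB f <= nC f.
Hypothesis DP : forall f, D f -> P f.
Hypothesis L1P : forall f, D f -> P (L1 f).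
Hypothesis L2P : forall f, D f -> P (L2 f).
Hypothesis cs1 : contraction_semigroup T1.
Hypothesis cs2 : contraction_semigroup T2.
Hypothesis kappa_ge0 : 0 <= kappa.

(** [L] is a restriction of the generator, and the graph of the generator lies in the closure of the
    graph of [L] on [D]. *)
Definition core (L : V -> V) (T : R -> V -> V) : Prop :=
  (forall f, D f -> generates T f (L f)) /\
  (forall f g, P f -> P g -> generates T f g -> forall e : R, 0 < e ->
     exists f', [/\ D f', nC (f' - f) < e & nC (L f' - g) < e]).

Hypothesis core1 : core L1 T1.
Hypothesis core2 : core L2 T2.
Hypothesis dissipative : forall h f g, 0 <= h -> D f -> D g ->
  nB (f - g) <= nB (f - g - h *: (L1 f - L2 g)) + h * kappa * nC f.

Lemma dissipative_closure h f f' g g' : 0 <= h -> P f -> P f' -> P g -> P g' ->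
  generates T1 f f' -> generates T2 g g' ->
  nB (f - g) <= nB (f - g - h *: (f' - g')) + h * kappa * nC f.
Proof.
move=> h0 Pf Pf' Pg Pg' gf gg; apply/ler_addgt0Pl => e e0.
(* The errors made in replacing [f], [g] by core elements: 2 for the difference, [2 + 2 h] for the
   residual, [h kappa] for the source term. *)
pose c := 4 + 2 * h + h * kappa.
have hk0 : 0 <= h * kappa by rewrite mulr_ge0.
have c0 : 0 < c by rewrite /c; lra.
have ec0 : 0 < e / c by rewrite divr_gt0.
have [u [Du uf uf']] := core1.2 f f' Pf Pf' gf _ ec0.
have [v [Dv vg vg']] := core2.2 g g' Pg Pg' gg _ ec0.
have Pu := DP Du; have Pv := DP Dv; have PLu := L1P Du; have PLv := L2P Dv.
have Pfg := PB Pf Pg; have Puv := PB Pu Pv.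
have PX : P (u - v - h *: (L1 u - L2 v)) by apply: PB => //; apply: PZ; exact: PB.
have PY : P (f - g - h *: (f' - g')) by apply: PB => //; apply: PZ; exact: PB.
have s1 := sn_le PD PZ snB Pfg Puv.
have s2 := dissipative h0 Du Dv.
have s3 := sn_le PD PZ snB PX PY.
have s4 := sn_le PD PZ snC Pu Pf.
have e1 : nB (f - g - (u - v)) <= 2 * (e / c).
  rewrite (_ : _ - _ = (v - g) - (u - f)); last first.
    by rewrite subrBB opprB [RHS]addrC opprB.
  apply: le_trans (sn_sub PZ snB (PB Pv Pg) (PB Pu Pf)) _.
  have := nB_le (PB Pv Pg); have := nB_le (PB Pu Pf); lra.
have e2 : nB (u - v - h *: (L1 u - L2 v) - (f - g - h *: (f' - g'))) <=
    (2 + 2 * h) * (e / c).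
  rewrite subrBB -scalerBr subrBB [L1 u - _ - _]subrBB.
  have Pa := PB Pu Pf; have Pb := PB Pv Pg.
  have Pa' := PB PLu Pf'; have Pb' := PB PLv Pg'.
  have := sn_sub PZ snB (PB Pa Pb) (PZ h (PB Pa' Pb')).
  have := sn_sub PZ snB Pa Pb; have := nB_le Pa; have := nB_le Pb.
  rewrite (sn_scale snB); last exact: PB.
  have : `|h| * nB (L1 u - f' - (L2 v - g')) <= h * (2 * (e / c)).
    rewrite (ger0_norm h0) ler_wpM2l//.
    have := sn_sub PZ snB Pa' Pb'; have := nB_le Pa'; have := nB_le Pb'; lra.
  lra.
have : h * kappa * nC u <= h * kappa * nC f + h * kappa * (e / c).
  by rewrite -mulrDr ler_wpM2l//; lra.
have : e = c * (e / c) by field; rewrite gt_eqF.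
move: e1 e2; move: (e / c) => y; rewrite /c => e1 e2.
lra.
Qed.

(** The difference at the end of a step is controlled by the difference at its beginning with factor
    one, and [nC (T1 s G) <= nC G] keeps the source term constant. The recursion is therefore
    additive, with no exponential growth in [t]. *)
Theorem semigroup_comparison G t : D G -> 0 <= t ->
  nB (T1 t G - T2 t G) <= t * kappa * nC G.
Proof.
move=> DG t0; have PG := DP DG.
have PL1 := L1P DG; have PL2 := L2P DG.
have g1 := core1.1 _ DG; have g2 := core2.1 _ DG.
have in1 := cs_in cs1; have in2 := cs_in cs2.
have iter h j : 0 < h ->
    nB (T1 (j%:R * h) G - T2 (j%:R * h) G) <= j%:R * (h * kappa * nC G +
      h * (step_error T1 G (L1 G) h + step_error T2 G (L2 G) h)).
  move=> h0; elim: j => [|j IH].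
    rewrite !mul0r.
    have Pa := PB (in1 0 G (lexx _) PG) PG; have Pb := PB (in2 0 G (lexx _) PG) PG.
    rewrite (_ : _ - _ = (T1 0 G - G) - (T2 0 G - G)); last by rewrite opprB addrA subrK.
    apply: le_trans (sn_sub PZ snB Pa Pb) _.
    have := nB_le Pa; have := nB_le Pb; rewrite (cs_0 cs1)// (cs_0 cs2)//; lra.
  set s := j%:R * h in IH *.
  have s0 : 0 <= s by rewrite mulr_ge0// ltW.
  have -> : j.+1%:R * h = s + h by rewrite -natr1 mulrDl mul1r.
  have sh0 : 0 <= s + h by rewrite addr_ge0// ltW.
  have K := dissipative_closure (ltW h0) (in1 _ _ sh0 PG) (in1 _ _ sh0 PL1)
    (in2 _ _ sh0 PG) (in2 _ _ sh0 PL2)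
    (generates_shift cs1 sh0 PG PL1 g1) (generates_shift cs2 sh0 PG PL2 g2).
  apply: (le_trans K).
  have e1 := step_error_bound cs1 s0 h0 PG PL1.
  have e2 := step_error_bound cs2 s0 h0 PG PL2.
  have c1 := cs_contr cs1 sh0 PG.
  set A1 := T1 s G - _ + _ in e1; set A2 := T2 s G - _ + _ in e2.
  have PA1 : P A1 by apply: PD; [apply: PB; exact: in1|apply: PZ; exact: in1].
  have PA2 : P A2 by apply: PD; [apply: PB; exact: in2|apply: PZ; exact: in2].
  have P0 : P (T1 s G - T2 s G) by apply: PB; [exact: in1|exact: in2].
  (* The Euler expression at time [s + h] is the difference of the orbits at time [s] minus the two
     residuals. *)
  rewrite (_ : _ - _ - _ = T1 s G - T2 s G - (A1 - A2)); last first.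
    rewrite /A1 /A2 [X in _ = _ - X](_ : _ = (T1 s G - T2 s G) -
        (T1 (s + h) G - T2 (s + h) G) +
        h *: (T1 (s + h) (L1 G) - T2 (s + h) (L2 G))).
      by rewrite opprD opprB [RHS]addrA [X in _ = X + _]addrC subrK.
    by rewrite opprD addrACA -scalerBr subrBB.
  have := sn_sub PZ snB P0 (PB PA1 PA2).
  have := sn_sub PZ snB PA1 PA2.
  have := nB_le PA1; have := nB_le PA2.
  have : h * kappa * nC (T1 (s + h) G) <= h * kappa * nC G.
    by rewrite ler_wpM2l// mulr_ge0// ltW.
  rewrite -natr1; lra.
move: t0; rewrite le_eqVlt => /orP[/eqP <-|t0].
  by have := iter 1 0%N ltr01; rewrite !mul0r.
apply/ler_addgt0Pl => e e0.
(* Over the whole time [t] the two errors then add up to at most [e]. *)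
have e20 : 0 < e / t / 2 by rewrite !divr_gt0.
have [d1 d10 H1] := step_error_cvg cs1 PG PL1 g1 e20.
have [d2 d20 H2] := step_error_cvg cs2 PG PL2 g2 e20.
have dm : 0 < Num.min d1 d2 by rewrite lt_min d10.
(* The successor makes [h = t / m] strictly smaller than both thresholds. *)
pose m := (Num.truncn (t / Num.min d1 d2)).+1.
have m0 : 0 < m%:R :> R by rewrite ltr0n.
pose h := t / m%:R; have h0 : 0 < h by rewrite divr_gt0.
have hd : h < Num.min d1 d2.
  rewrite /h ltr_pdivrMr// mulrC -ltr_pdivrMr//.
  exact: truncnS_gt.
have := iter h m h0.
have mh : m%:R * h = t by rewrite /h; field; rewrite gt_eqF.
rewrite mh (_ : m%:R * (_ + _) = t * kappa * nC G +
  t * (step_error T1 G (L1 G) h + step_error T2 G (L2 G) h)); last first.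
  by rewrite -mh; ring.
move: hd; rewrite lt_min => /andP[hd1 hd2].
have l1 := H1 h h0 hd1; have l2 := H2 h h0 hd2.
have : t * (step_error T1 G (L1 G) h + step_error T2 G (L2 G) h) <= e.
  have -> : e = t * (e / t / 2 + e / t / 2) by field; rewrite gt_eqF.
  by rewrite ler_pM2l// ltW// ltrD.
lra.
Qed.

End comparison.

End semigroup.

(** * The abstract comparison applied to [L_C] *)

Section LC_semigroup.
Context {R : realType} {d : nat}.
Variable C : R.
Hypothesis C_gt0 : 0 < C.

Local Notation V := (conf R d -> R^o).
Implicit Types (f g G H : V).

Let C_ge0 : 0 <= C := ltW C_gt0.

Definition nrm (B : R) (f : V) : R := fine (LCnorm B f).

Lemma nrmE B f : 0 <= B -> inLC B f -> LCnorm B f = (nrm B f)%:E.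
Proof. by move=> B0 [mf f1]; rewrite fineK// ge0_fin_numE// LCnorm_ge0. Qed.

Lemma inLC_add f g : inLC C f -> inLC C g -> inLC C (f + g).
Proof.
move=> [mf f1] [mg g1]; split; first exact: (conf_measurableD mf mg).
by apply: le_lt_trans (LCnormD C_ge0 mf mg) _; exact: lte_add_pinfty.
Qed.

Lemma inLC_scale a f : inLC C f -> inLC C (a *: f).
Proof.
move=> [mf f1]; split.
  exact: (conf_measurableM (conf_measurable_cst a) mf).
rewrite (LCnormZ a C_ge0 mf); apply: lte_mul_pinfty => //.
Qed.

Lemma inLC_le B f : 0 <= B -> B <= C -> inLC C f -> inLC B f.
Proof.
by move=> B0 BC [mf f1]; split => //; exact: le_lt_trans (LCnorm_le B0 BC mf) f1.
Qed.

Lemma seminorm_nrm B : 0 <= B -> B <= C -> seminorm_on (inLC C) (nrm B).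
Proof.
move=> B0 BC; split.
- by move=> f Pf; apply: fine_ge0; apply: LCnorm_ge0 => //; case: Pf.
- move=> f g Pf Pg; have Qf := inLC_le B0 BC Pf; have Qg := inLC_le B0 BC Pg.
  have Qfg := inLC_le B0 BC (inLC_add Pf Pg).
  rewrite -lee_fin EFinD -!nrmE//.
  exact: (LCnormD B0 Pf.1 Pg.1).
- move=> a f Pf; have Qf := inLC_le B0 BC Pf.
  by rewrite /nrm (LCnormZ a B0 Pf.1) nrmE// -EFinM.
Qed.

Lemma nrm_le B f : 0 <= B -> B <= C -> inLC C f -> nrm B f <= nrm C f.
Proof.
move=> B0 BC Pf; rewrite -lee_fin -!nrmE//; last exact: inLC_le Pf.
by apply: LCnorm_le => //; case: Pf.
Qed.

Let PB := P_sub inLC_add inLC_scale.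

Lemma distC_nrm f g : inLC C f -> inLC C g -> distC C f g = (nrm C (f - g))%:E.
Proof. by move=> Pf Pg; rewrite -nrmE//; exact: PB. Qed.

Lemma distC0_nrm f g : inLC C f -> inLC C g -> distC C f g = 0%E -> nrm C (f - g) = 0.
Proof. by move=> Pf Pg; rewrite distC_nrm// => -[]. Qed.

Section generated.
Variables (L : V -> V) (T : R -> V -> V).
Hypothesis gT : generated_semigroup C L T.

Lemma generated_contraction : contraction_semigroup (inLC C) (nrm C) T.
Proof.
case: gT => [Tin [_ [Tlin [T0 [Tadd [Tcontr [Tcont _]]]]]]].
have TinD t G : 0 <= t -> inLC C G -> inLC C (T t G) by exact: Tin.
split => //.
- move=> t a b G H t0 PG PH.
  apply: distC0_nrm; last exact: (Tlin t a b G H t0 PG PH).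
    by apply: TinD => //; apply: inLC_add; exact: inLC_scale.
  exact: (inLC_add (inLC_scale a (TinD _ _ t0 PG)) (inLC_scale b (TinD _ _ t0 PH))).
- move=> G PG; apply: distC0_nrm => //; last exact: T0.
  by apply: TinD.
- move=> s t G s0 t0 PG; apply: distC0_nrm; last exact: Tadd.
    by apply: TinD => //; exact: addr_ge0.
  exact: (TinD _ _ s0 (TinD _ _ t0 PG)).
- move=> t G t0 PG; rewrite -lee_fin -!nrmE//; last exact: TinD.
  exact: Tcontr.
- move=> G PG e e0; have [dl dl0 Hd] := Tcont G PG e e0; exists dl => // t t0 tdl.
  have PT := TinD t G t0 PG.
  by have := Hd t t0 tdl; rewrite distC_nrm// lte_fin.
Qed.

Let Tin t G : 0 <= t -> inLC C G -> inLC C (T t G).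
Proof. exact: (cs_in generated_contraction). Qed.

Lemma gen_pairP G H : inLC C G -> inLC C H ->
  gen_pair C T G H <-> generates (nrm C) T G H.
Proof.
move=> PG PH.
have E t : 0 < t -> distC C (fun eta => (T t G eta - G eta) / t)%R H =
    (nrm C (t^-1 *: (T t G - G) - H))%:E.
  move=> t0; rewrite -distC_nrm//.
    by congr distC; apply/funext => eta; rewrite mulrC.
  by apply: inLC_scale; apply: PB => //; apply: Tin => //; exact: ltW.
split => gp e e0; have [dl dl0 Hd] := gp e e0; exists dl => // t t0 tdl.
  by have := Hd t t0 tdl; rewrite E// lte_fin.
by have := Hd t t0 tdl; rewrite E// lte_fin.
Qed.

Hypothesis D_L : forall f, inLC (2 * C) f -> inLC C (L f).

Lemma inLC2 f : inLC (2 * C) f -> inLC C f.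
Proof.
move=> [mf f1]; split => //; apply: le_lt_trans f1; apply: LCnorm_le => //.
by rewrite ler_peMl// ler1n.
Qed.

Lemma generated_core : core (inLC C) (nrm C) (inLC (2 * C)) L T.
Proof.
case: gT => [_ [_ [_ [_ [_ [_ [_ Tgen]]]]]]]; split.
  move=> f Df; have Pf := inLC2 Df; have PL := D_L Df.
  (* The constant sequence at [f] shows that [f] and [L f] form a pair of the closure. *)
  apply/gen_pairP => //; apply/Tgen => //; exists (fun=> f); split => // e e0.
  exists 0%N => n _.
  by rewrite !distC_nrm// !subrr (sn0 (seminorm_nrm C_ge0 (lexx C)) Pf) lte_fin.
move=> f g Pf Pg /gen_pairP => /(_ Pf Pg)/Tgen => /(_ Pf Pg)[Gs [DGs cvG]] e e0.
have [N HN] := cvG e e0; have [h1 h2] := HN N (leqnn N).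
have DG := DGs N; have PG := inLC2 DG; have PLG := D_L DG.
exists (Gs N); split => //; first by move: h1; rewrite distC_nrm// lte_fin.
by move: h2; rewrite distC_nrm// lte_fin.
Qed.

End generated.

Theorem generated_comparison (B kappa : R) (L1 L2 : V -> V) (T1 T2 : R -> V -> V)
    (G : V) (t : R) :
  0 <= B -> B <= C -> 0 <= kappa ->
  generated_semigroup C L1 T1 -> generated_semigroup C L2 T2 ->
  (forall f, inLC (2 * C) f -> inLC C (L1 f)) ->
  (forall f, inLC (2 * C) f -> inLC C (L2 f)) ->
  (forall (h : R) f g, 0 <= h -> inLC (2 * C) f -> inLC (2 * C) g ->
    (LCnorm B (fun eta => f eta - g eta)%R <=
      LCnorm B (fun eta => f eta - g eta - h * (L1 f eta - L2 g eta))%R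
      + (h * kappa)%:E * LCnorm C f)%E) ->
  inLC (2 * C) G -> 0 <= t ->
  (LCnorm B (fun eta => T1 t G eta - T2 t G eta)%R <= (t * kappa)%:E * LCnorm C G)%E.
Proof.
move=> B0 BC k0 g1 g2 P1 P2 K DG t0.
have PG := inLC2 DG.
have c1 := generated_contraction g1; have c2 := generated_contraction g2.
have PT1 := cs_in c1 t0 PG; have PT2 := cs_in c2 t0 PG.
have := @semigroup_comparison R V (inLC C) (nrm C) inLC_add inLC_scale
  (seminorm_nrm C_ge0 (lexx C)) (nrm B) (inLC (2 * C)) L1 L2 T1 T2 kappa
  (seminorm_nrm B0 BC) (fun f => @nrm_le B f B0 BC) inLC2 P1 P2 c1 c2 k0
  (generated_core g1 P1) (generated_core g2 P2) _ G t DG t0.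
rewrite -lee_fin EFinM -!nrmE//; last exact: (inLC_le B0 BC (PB PT1 PT2)).
apply => h f g h0 Df Dg.
have Pf := inLC2 Df; have Pg := inLC2 Dg.
have Q1 := PB Pf Pg.
have Q2 := PB Q1 (inLC_scale h (PB (P1 _ Df) (P2 _ Dg))).
rewrite -lee_fin EFinD EFinM -!nrmE//; [exact: K| exact: (inLC_le B0 BC)..].
Qed.

End LC_semigroup.

(** * Duality *)

Section pairing_theory.
Context {R : realType} {d : nat}.
Implicit Types (F G f g h k : conf R d -> R).
Local Open Scope ereal_scope.

Definition LPsigned f : \bar R :=
  LPint (fun eta => (Num.max (f eta) 0)%:E) -
  LPint (fun eta => (Num.max (- f eta) 0)%:E).

Lemma pairingE G k : pairing G k = LPsigned (fun eta => G eta * k eta)%R.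
Proof. by []. Qed.

Let LPabs f := LPint (fun eta => `|f eta|%:E).

Let cm_pos f : conf_measurable f -> cmeas (fun eta => (Num.max (f eta) 0)%:E).
Proof. by move=> /conf_measurable_pos; exact: cmeas_EFin. Qed.

Let pos_ge0 (x : R) : 0 <= (Num.max x 0)%:E.
Proof. by rewrite lee_fin le_max lexx orbT. Qed.

Lemma LPpos_lty f : conf_measurable f -> LPabs f < +oo ->
  LPint (fun eta => (Num.max (f eta) 0)%:E) \is a fin_num.
Proof.
move=> mf f1; rewrite ge0_fin_numE; last by apply: LPint_ge0 => //; exact: cm_pos.
apply: le_lt_trans f1; apply: LPint_le => //; first exact: cm_pos.
  exact: (cmeas_EFin (conf_measurable_norm mf)).
by move=> eta; rewrite lee_fin ge_max normr_ge0 ler_norm.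
Qed.

Lemma LPneg_lty f : conf_measurable f -> LPabs f < +oo ->
  LPint (fun eta => (Num.max (- f eta) 0)%:E) \is a fin_num.
Proof.
move=> mf f1; apply: (@LPpos_lty (fun eta => - f eta)%R).
  exact: conf_measurableN.
by rewrite /LPabs; under eq_fun do rewrite normrN.
Qed.

(** The inequality is moved to positive and negative parts, [f^+ + g^- <= f^- + g^+ + h], so that
    only integrals of nonnegative functions are compared. Absolute integrability of [f] and [g] then
    allows the return to differences. *)
Lemma LPsigned_le f g h : conf_measurable f -> conf_measurable g ->
  conf_measurable h -> LPabs f < +oo -> LPabs g < +oo ->
  (forall eta, 0 <= h eta)%R -> (forall eta, f eta - g eta <= h eta)%R ->
  LPsigned f <= LPsigned g + LPint (fun eta => (h eta)%:E).
Proof.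
move=> mf mg mh f1 g1 h0 fgh.
have mh' := cmeas_EFin mh.
have h0' eta : 0 <= (h eta)%:E by rewrite lee_fin.
have [fp fn gp gn] := And4 (LPpos_lty mf f1) (LPneg_lty mf f1)
  (LPpos_lty mg g1) (LPneg_lty mg g1).
have cf := cm_pos mf; have cg := cm_pos mg.
have cf' := cm_pos (conf_measurableN mf); have cg' := cm_pos (conf_measurableN mg).
have : LPint (fun eta => (Num.max (f eta) 0)%:E) +
    LPint (fun eta => (Num.max (- g eta) 0)%:E) <=
  LPint (fun eta => (Num.max (- f eta) 0)%:E) +
    (LPint (fun eta => (Num.max (g eta) 0)%:E) + LPint (fun eta => (h eta)%:E)).
  rewrite -!LPintD//; last 2 first.
  - exact: cmeasD.
  - by move=> eta; rewrite adde_ge0.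
  apply: LPint_le.
  - exact: cmeasD.
  - by apply: cmeasD => //; exact: cmeasD.
  - by move=> eta; rewrite adde_ge0.
  - move=> eta; rewrite -!EFinD lee_fin; have := fgh eta.
    by rewrite !maxEle; do 4 case: ifP; lra.
rewrite /LPsigned.
have : 0 <= LPint (fun eta => (h eta)%:E) by exact: LPint_ge0.
rewrite -(fineK fp) -(fineK fn) -(fineK gp) -(fineK gn).
case: (LPint (fun eta => (h eta)%:E)) => [r| |] //=.
  by move=> _; rewrite -?EFinD !lee_fin; lra.
by move=> _ _; rewrite addey// leey.
Qed.

Lemma LPsigned_ge f g h : conf_measurable f -> conf_measurable g ->
  conf_measurable h -> LPabs f < +oo -> LPabs g < +oo ->
  (forall eta, 0 <= h eta)%R -> (forall eta, h eta <= f eta - g eta)%R ->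
  LPsigned g + LPint (fun eta => (h eta)%:E) <= LPsigned f.
Proof.
move=> mf mg mh f1 g1 h0 fgh.
have mh' := cmeas_EFin mh.
have h0' eta : 0 <= (h eta)%:E by rewrite lee_fin.
have [fp fn gp gn] := And4 (LPpos_lty mf f1) (LPneg_lty mf f1)
  (LPpos_lty mg g1) (LPneg_lty mg g1).
have cf := cm_pos mf; have cg := cm_pos mg.
have cf' := cm_pos (conf_measurableN mf); have cg' := cm_pos (conf_measurableN mg).
have : LPint (fun eta => (Num.max (- f eta) 0)%:E) +
    (LPint (fun eta => (Num.max (g eta) 0)%:E) + LPint (fun eta => (h eta)%:E)) <=
  LPint (fun eta => (Num.max (f eta) 0)%:E) +
    LPint (fun eta => (Num.max (- g eta) 0)%:E).
  rewrite -!LPintD//; last 2 first.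
  - exact: cmeasD.
  - by move=> eta; rewrite adde_ge0.
  apply: LPint_le.
  - by apply: cmeasD => //; exact: cmeasD.
  - exact: cmeasD.
  - by move=> eta; rewrite !adde_ge0.
  - move=> eta; rewrite -!EFinD lee_fin; have := fgh eta.
    by rewrite !maxEle; do 4 case: ifP; lra.
rewrite /LPsigned.
have : 0 <= LPint (fun eta => (h eta)%:E) by exact: LPint_ge0.
rewrite -(fineK fp) -(fineK fn) -(fineK gp) -(fineK gn).
case: (LPint (fun eta => (h eta)%:E)) => [r| |] //=.
by move=> _; rewrite -?EFinD !lee_fin; lra.
Qed.

(** [K] is one of the constants whose infimum is [KCnorm B k]. Estimates are made for each such
    constant, the infimum being taken at the end. *)
Definition null_above (B K : R) k :=
  (0 <= K)%R /\ LPint (fun eta => @ind R (K * B ^+ Defs.card eta < `|k eta|)%R) = 0.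

Lemma indE (b : bool) : @ind R b = (if b then 1 else 0)%R%:E.
Proof. by case: b. Qed.

Lemma conf_measurable_lt f g : conf_measurable f -> conf_measurable g ->
  conf_measurable (fun eta => if (f eta < g eta)%R then 1 else 0)%R.
Proof.
apply: (@conf_measurable_comp2 _ _ (fun p => if p.1 < p.2 then 1 else 0)%R).
apply: measurable_fun_ifT; [|exact: measurable_cst..].
by apply: measurable_fun_ltr; [exact: measurable_fst|exact: measurable_snd].
Qed.

Lemma cmeas_ind (B K : R) k : conf_measurable k ->
  cmeas (fun eta => @ind R (K * B ^+ Defs.card eta < `|k eta|)%R).
Proof.
move=> mk; under eq_fun do rewrite indE.
apply: (@cmeas_EFin _ _ (fun eta =>
  if (K * B ^+ Defs.card eta < `|k eta|)%R then 1 else 0)%R).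
apply: conf_measurable_lt; last exact: conf_measurable_norm.
exact: (conf_measurable_card (fun n => K * B ^+ n)%R).
Qed.

Lemma ind_ge0 b : 0 <= @ind R b.
Proof. by case: b; rewrite /ind// lee01. Qed.

Lemma LPint_mul_le B K F k : (0 <= B)%R -> conf_measurable F ->
  conf_measurable k -> null_above B K k ->
  LPint (fun eta => `|F eta * k eta|%:E) <= K%:E * LCnorm B F.
Proof.
move=> B0 mF mk [K0 nk].
have mFk := conf_measurableM mF mk.
have mI := cmeas_ind B K mk.
have mN := cmeas_EFin (conf_measurable_norm mFk).
have mL := @cmeas_LC _ _ (fun n => B ^+ n)%R _ mF.
have L0 eta : 0 <= (`|F eta| * B ^+ Defs.card eta)%:E by exact: LC_ge0.
have mKL : cmeas (fun eta => K%:E * (`|F eta| * B ^+ Defs.card eta)%:E).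
  by apply: cmeasM => //; exact: (cmeas_EFin (conf_measurable_cst K)).
have KL0 eta : 0 <= K%:E * (`|F eta| * B ^+ Defs.card eta)%:E.
  by rewrite mule_ge0.
have IF0 eta : 0 <= `|F eta * k eta|%:E *
    @ind R (K * B ^+ Defs.card eta < `|k eta|)%R.
  by rewrite mule_ge0// ind_ge0.
rewrite /LCnorm -LPintZ//.
rewrite -[leRHS]adde0.
(* The majorant is completed by [|F k|] on the exceptional set of [k], which adds an integral equal
   to zero. *)
rewrite -[X in _ + X](@LPint_null _ _ _ (fun eta => `|F eta * k eta|%:E *
    @ind R (K * B ^+ Defs.card eta < `|k eta|)%R) mI) => //; last 3 first.
- exact: cmeasM.
- by move=> eta; exact: ind_ge0.
- by move=> eta ->; rewrite mule0.
rewrite -LPintD//; last exact: cmeasM.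
apply: LPint_le => //.
  by apply: cmeasD => //; exact: cmeasM.
move=> eta; rewrite -EFinM.
case: ltP => h; rewrite /ind.
  by rewrite mule1 leeDr// lee_fin mulr_ge0// mulr_ge0// exprn_ge0.
by rewrite mule0 adde0 lee_fin normrM mulrCA ler_wpM2l.
Qed.

Lemma KCnorm_le_null B K k : null_above B K k -> KCnorm B k <= K%:E.
Proof. by move=> nk; apply: ereal_inf_lbound; exists K. Qed.

Lemma null_above_le B C K k : (0 <= B)%R -> (B <= C)%R -> conf_measurable k ->
  null_above B K k -> null_above C K k.
Proof.
move=> B0 BC mk [K0 nk]; split => //.
move: nk; apply: LPint_null => //; [exact: cmeas_ind..| | |].
- by move=> eta; exact: ind_ge0.
- by move=> eta; exact: ind_ge0.
move=> eta; rewrite /ind; case: ifP => [_ /eqP|/negbT + _].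
  by rewrite onee_eq0.
rewrite -leNgt => h; case: ifP => // hC; have := lt_le_trans hC h.
by rewrite ltNge ler_wpM2l// lerXn2r// nnegrE//; exact: le_trans BC.
Qed.

Lemma inKC_null B k : inKC B k -> exists K, null_above B K k.
Proof.
move=> [mk]; rewrite /KCnorm.
have [->|/set0P[_ [K [K0 nK] _]]] := eqVneq [set M%:E | M in
    [set M : R | (0 <= M)%R /\ LPint (fun eta : conf R d =>
      @ind R (M * B ^+ Defs.card eta < `|k eta|)%R) = 0]] set0.
  by rewrite ereal_inf0 ltxx.
by move=> _; exists K.
Qed.

Lemma KCnorm_le_scale B C (M : R) k k' : (0 <= M)%R -> inKC B k ->
  (forall K, null_above B K k -> KCnorm C k' <= (M * K)%:E) ->
  KCnorm C k' <= M%:E * KCnorm B k.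
Proof.
move=> M0 kB H; move: M0; rewrite le_eqVlt => /orP[/eqP M0|M0].
  (* An infimum is scaled by positive factors only; for [M = 0] any admissible constant suffices. *)
  have [K nK] := inKC_null kB; rewrite -M0 mul0e.
  by have := H K nK; rewrite -M0 mul0r.
rewrite /KCnorm -ereal_inf_pZl//; apply: le_ereal_inf_tmp.
by move=> _ [_ [K nK <-] <-]; rewrite -EFinM; exact: H.
Qed.

End pairing_theory.

(** * From bounds on pairings to the essential supremum *)

Section duality.
Context {R : realType} {d : nat}.
Notation T := (pt R d).
Implicit Types (G k : conf R d -> R).
Local Open Scope ereal_scope.

Lemma smeas_prod (w : T -> R) : measurable_fun setT w ->
  smeas (fun s : seq T => \prod_(x <- s) w x)%R.
Proof.
move=> mw n; pose x0 : T := [tuple 0%R | i < d].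
rewrite (_ : (fun _ => _) = (fun t : n.-tuple T =>
    \prod_(i <- iota 0 n) w (nth x0 t i))%R).
  by apply: measurable_prod => i _; apply: (measurableT_comp mw); exact: measurable_nth.
by apply/funext => t; rewrite -{1}(mkseq_nth x0 t) size_tuple big_map.
Qed.

Lemma conf_measurable_elam (w : T -> R) : measurable_fun setT w ->
  conf_measurable (elam w).
Proof.
move=> mw n.
rewrite (_ : (fun _ => _) = (fun t : n.-tuple T =>
    if uniq t then \prod_(x <- t) w x else 0)%R).
  apply: measurable_fun_ifT; [exact: smeas_uniq| |exact: measurable_cst].
  exact: smeas_prod.
by apply/funext => t; case: ifP => // u; rewrite confsE elam_confs.
Qed.

Lemma sint_prod_indic (A : set T) n : measurable A -> muRd d A < +oo ->
  sint n (fun s => (\prod_(x <- s) \1_A x)%R%:E) < +oo.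
Proof.
move=> mA A1.
have sm : smeas (fun s : seq T => (\prod_(x <- s) \1_A x)%R%:E : \bar R).
  by move=> j; apply: measurableT_comp => //; exact: smeas_prod.
have p0 (s : seq T) : 0 <= (\prod_(x <- s) \1_A x)%R%:E :> \bar R.
  by rewrite lee_fin; apply: prodr_ge0.
elim: n => [|n IH]; first by rewrite sint0// big_nil ltry.
rewrite sintS//; under eq_integral => x _.
  under eq_fun do rewrite big_cons EFinM.
  rewrite /sint ge0_integralZl//; last exact: sm.
  over.
rewrite ge0_integralZr//; last 2 first.
- by apply: measurableT_comp => //; exact: measurable_indic.
- by apply: integral_ge0.
rewrite integral_indic// setIT; apply: lte_mul_pinfty => //.
by rewrite ge0_fin_numE.
Qed.

(* [test_weight * test_sign] is the test function detecting that [k] exceeds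
   [M C^n] on a set of [n]-point configurations contained in [A]. *)
Definition test_weight (A : set T) (n : nat) (C M : R) (k : conf R d -> R)
    (eta : conf R d) : R :=
  ((if Defs.card eta == n then 1 else 0) *
  (if M * C ^+ Defs.card eta < `|k eta| then 1 else 0) * elam (\1_A) eta)%R.

(** The sign of [k], set to [-1] where [k] vanishes: it has modulus one everywhere, so
    multiplication by it leaves norms unchanged. *)
Definition test_sign (k : conf R d -> R) (eta : conf R d) : R :=
  (2 * (if 0 < k eta then 1 else 0) - 1)%R.

Lemma test_signM k eta : (test_sign k eta * k eta = `|k eta|)%R.
Proof.
rewrite /test_sign; case: ltP => h; first by rewrite gtr0_norm//; ring.
by rewrite ler0_norm//; ring.
Qed.

Lemma norm_test_sign k eta : (`|test_sign k eta| = 1)%R.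
Proof.
rewrite /test_sign; case: ltP => _; rewrite ?mulr1 ?mulr0.
  by rewrite ger0_norm; lra.
by rewrite sub0r normrN1.
Qed.

Lemma test_weight_ge0 A n C M k eta : (0 <= test_weight A n C M k eta)%R.
Proof.
rewrite mulr_ge0//; last by apply: prodr_ge0.
by rewrite mulr_ge0//; case: ifP.
Qed.

Lemma conf_measurable_test_weight A n C M k : measurable A ->
  conf_measurable k -> conf_measurable (test_weight A n C M k).
Proof.
move=> mA mk; apply: conf_measurableM.
  apply: conf_measurableM.
    exact: (conf_measurable_card (fun j => if j == n then 1 else 0)%R).
  apply: conf_measurable_lt; last exact: conf_measurable_norm.
  exact: (conf_measurable_card (fun n => M * C ^+ n)%R).
by apply: conf_measurable_elam; exact: measurable_indic.
Qed.

Lemma conf_measurable_test_sign k :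
  conf_measurable k -> conf_measurable (test_sign k).
Proof.
move=> mk; apply: conf_measurableB; last exact: conf_measurable_cst.
apply: conf_measurableM; first exact: conf_measurable_cst.
by apply: conf_measurable_lt => //; exact: conf_measurable_cst.
Qed.

(** Only the [n]-th term of the series survives, and it is finite because [A] has finite measure.
    Any [B] is allowed: the test function must reach [L_(2C)], where the comparison is assumed. *)
Lemma inLC_test A n B C M k : measurable A -> muRd d A < +oo -> (0 <= B)%R ->
  conf_measurable k ->
  inLC B (fun eta => test_weight A n C M k eta * test_sign k eta)%R.
Proof.
move=> mA A1 B0 mk.
have mw := conf_measurable_test_weight n C M mA mk.
have mG := conf_measurableM mw (conf_measurable_test_sign mk).
split => //.
pose f j : R := (if j == n then B ^+ j else 0)%R.
have f0 j : (0 <= f j)%R by rewrite /f; case: ifP => // _; exact: exprn_ge0.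
have sm : smeas (fun s : seq T => (\prod_(x <- s) \1_A x)%R%:E : \bar R).
  by move=> j; apply: measurableT_comp => //; exact: smeas_prod.
have p0 (s : seq T) : 0 <= (\prod_(x <- s) \1_A x)%R%:E :> \bar R.
  by rewrite lee_fin; apply: prodr_ge0.
apply: (@le_lt_trans _ _ (ssum (fun s => (f (size s))%:E *
    (\prod_(x <- s) \1_A x)%R%:E))).
  apply: LPint_le_ssum.
  - exact: (@cmeas_LC _ _ (fun n => B ^+ n)%R _ mG).
  - move=> j; apply: emeasurable_funM; [exact: (smeas_size f)|exact: sm].
  - by move=> eta; rewrite lee_fin mulr_ge0// exprn_ge0.
  - by move=> s; rewrite mule_ge0// lee_fin.
  move=> s us; rewrite -EFinM lee_fin normrM norm_test_sign mulr1.
  rewrite ger0_norm ?test_weight_ge0// /test_weight card_confs// elam_confs// /f.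
  have : (0 <= \prod_(x <- s) \1_A x :> R)%R by apply: prodr_ge0.
  set p := (\prod_(x <- s) _)%R => pp.
  case: ifP => _; last by rewrite !mul0r.
  rewrite mul1r mulrC; apply: ler_wpM2l; first exact: exprn_ge0.
  by case: (_ < _)%R; rewrite ?mul1r ?mul0r.
rewrite ssum_size// (@nneseriesD1 _ _ n)//; last first.
  by move=> j _; rewrite mule_ge0 ?sint_ge0// lee_fin divr_ge0.
rewrite [X in _ + X]eseries0 ?adde0; last first.
  by move=> j _ jn; rewrite /f (negbTE jn) mul0r mul0e.
apply: lte_mul_pinfty => //; first by rewrite lee_fin divr_ge0.
exact: sint_prod_indic.
Qed.

(** Let [G] be the test function for the set where [|k1 - k2|] exceeds [M' C^n], with
    [M' = M K + e]. Its pairing with [k1 - k2] is at least [M' ||G||_C] by construction and at most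
    [M K ||G||_C] by adjunction and comparison. Hence [G] is null, and exhausting the space by sets
    of finite measure shows that the exceptional set is null. *)
Theorem duality (B C K M : R) (T1 T2 : (conf R d -> R) -> conf R d -> R)
    (k k1 k2 : conf R d -> R) :
  (0 <= B)%R -> (1 <= C)%R -> (0 <= M)%R -> null_above B K k ->
  inKC C k -> inKC C k1 -> inKC C k2 ->
  (forall G, inLC C G -> inLC C (T1 G)) ->
  (forall G, inLC C G -> inLC C (T2 G)) ->
  (forall G, inLC C G -> pairing G k1 = pairing (T1 G) k) ->
  (forall G, inLC C G -> pairing G k2 = pairing (T2 G) k) ->
  (forall G, inLC (2 * C) G ->
    LCnorm B (fun eta => T1 G eta - T2 G eta)%R <= M%:E * LCnorm C G) ->
  KCnorm C (fun eta => k1 eta - k2 eta)%R <= (M * K)%:E.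
Proof.
move=> B0 C1 M0 nk kC k1C k2C P1 P2 ad1 ad2 cmp.
have C0 : (0 < C)%R by exact: lt_le_trans C1.
have K0 : (0 <= K)%R by case: nk.
have mk := kC.1; have mk1 := k1C.1; have mk2 := k2C.1.
pose kap eta := (k1 eta - k2 eta)%R.
have mkap : conf_measurable kap by exact: conf_measurableB.
have fin (F h : conf R d -> R) : inLC C F -> inKC C h ->
    LPint (fun eta => `|F eta * h eta|%:E) < +oo.
  move=> PF hC; have [K' nK'] := inKC_null hC.
  apply: le_lt_trans (LPint_mul_le (ltW C0) PF.1 hC.1 nK') _.
  by apply: lte_mul_pinfty => //; [rewrite lee_fin; case: nK'|case: PF].
(* The slack [e] turns the two bounds on the pairing into [e ||G||_C <= 0]. *)
apply/lee_addgt0Pr => e e0; rewrite -EFinD; apply: KCnorm_le_null.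
set M' := (M * K + e)%R.
have M'0 : (0 <= M')%R by rewrite addr_ge0 ?mulr_ge0// ltW.
split => //; apply/LPint_eq0_sint.
- exact: cmeas_ind.
- by move=> eta; exact: ind_ge0.
move=> n.
have [F [TF ndF mF]] := (sigma_finiteP [set: T] (muRd d)).1 (sigma_finiteT (muRd d)).
have test0 N : LCnorm C (test_weight (F N) n C M' kap) = 0.
  have [mA A1] := mF N.
  pose G eta := (test_weight (F N) n C M' kap eta * test_sign kap eta)%R.
  have mw := conf_measurable_test_weight n C M' mA mkap.
  have DG : inLC (2 * C) G by apply: inLC_test => //; rewrite mulr_ge0// ltW.
  have PG : inLC C G := inLC2 C0 DG.
  have nG : LCnorm C G = LCnorm C (test_weight (F N) n C M' kap).
    congr LPint; apply/funext => eta; congr EFin.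
    by rewrite normrM norm_test_sign mulr1.
  have PT1 := P1 G PG; have PT2 := P2 G PG.
  have up : pairing (T1 G) k <= pairing (T2 G) k + (M * K)%:E * LCnorm C G.
    have mD := conf_measurableB PT1.1 PT2.1.
    have mDk := conf_measurable_norm (conf_measurableM mD mk).
    have := @LPsigned_le _ _ (fun eta => T1 G eta * k eta)%R
      (fun eta => T2 G eta * k eta)%R
      (fun eta => `|(T1 G eta - T2 G eta) * k eta|)%R
      (conf_measurableM PT1.1 mk) (conf_measurableM PT2.1 mk) mDk
      (fin _ _ PT1 kC) (fin _ _ PT2 kC).
    move=> /(_ _ _)/le_trans; apply => //.
      by move=> eta; rewrite -mulrBl ler_norm.
    apply: leeD => //.
    apply: le_trans (LPint_mul_le B0 mD mk nk) _.
    rewrite mulrC EFinM -muleA; apply: lee_wpmul2l; first by rewrite lee_fin.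
    exact: cmp.
  have low : pairing G k2 + M'%:E * LCnorm C G <= pairing G k1.
    have mGC : conf_measurable (fun eta => M' * (`|G eta| * C ^+ Defs.card eta))%R.
      apply: conf_measurableM; first exact: conf_measurable_cst.
      apply: conf_measurableM; first exact: (conf_measurable_norm PG.1).
      exact: (conf_measurable_card (fun n => C ^+ n)%R).
    have h0 eta : (0 <= M' * (`|G eta| * C ^+ Defs.card eta))%R.
      by rewrite mulr_ge0// mulr_ge0// exprn_ge0// ltW.
    have := @LPsigned_ge _ _ (fun eta => G eta * k1 eta)%R
      (fun eta => G eta * k2 eta)%R
      (fun eta => M' * (`|G eta| * C ^+ Defs.card eta))%R
      (conf_measurableM PG.1 mk1) (conf_measurableM PG.1 mk2) mGC
      (fin _ _ PG k1C) (fin _ _ PG k2C) h0.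
    under [X in _ + LPint X]eq_fun do rewrite EFinM.
    rewrite LPintZ//; last 2 first.
    - exact: (@cmeas_LC _ _ (fun n => C ^+ n)%R _ PG.1).
    - by move=> eta; apply: LC_ge0; exact: ltW.
    apply => eta.
    have -> : (G eta * k1 eta - G eta * k2 eta =
        test_weight (F N) n C M' kap eta * `|kap eta|)%R.
      by rewrite -mulrBr -test_signM mulrA.
    rewrite normrM norm_test_sign mulr1 ger0_norm ?test_weight_ge0// mulrCA.
    rewrite /test_weight; case: (ltP (M' * _)%R) => hk; last first.
      by rewrite mulr0 !mul0r.
    apply: ler_wpM2l; last exact: ltW.
    by rewrite mulr1 mulr_ge0//; [case: ifP|apply: prodr_ge0].
  move: up low; rewrite -ad1// -ad2// => up low.
  have G0 : 0 <= LCnorm C G by apply: LCnorm_ge0; [exact: ltW|case: PG].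
  have p2 : pairing G k2 \is a fin_num.
    rewrite pairingE /LPsigned fin_numB; apply/andP; split.
      by apply: LPpos_lty; [exact: conf_measurableM PG.1 mk2|exact: fin].
    by apply: LPneg_lty; [exact: conf_measurableM PG.1 mk2|exact: fin].
  have := le_trans low up; rewrite leeD2lE// -nG.
  move: G0 PG.2; case: (LCnorm C G) => [r| |]//; rewrite lee_fin => r0 _.
  rewrite -!EFinM lee_fin /M' mulrDl gerDl => er; congr EFin; apply/eqP.
  by rewrite eq_le r0 andbT -(pmulr_rle0 _ e0).
have g0 N t : 0 <= on_uniq 0 (fun eta => (`|test_weight (F N) n C M' kap eta| *
    C ^+ Defs.card eta)%:E) t.
  by apply: on_uniq_ge0 => eta; apply: LC_ge0; exact: ltW.
have mg N : cmeas (fun eta => (`|test_weight (F N) n C M' kap eta| *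
    C ^+ Defs.card eta)%:E).
  apply: (@cmeas_LC _ _ (fun n => C ^+ n)%R).
  by apply: conf_measurable_test_weight => //; case: (mF N).
have g_int N : sint n (on_uniq 0 (fun eta => (`|test_weight (F N) n C M' kap eta| *
    C ^+ Defs.card eta)%:E)) = 0.
  by apply: (LPint_eq0_sint (mg N) _).1; [move=> eta; apply: LC_ge0; exact: ltW|
    exact: test0].
apply/eqP; rewrite eq_le; apply/andP; split; last first.
  by apply: sint_ge0 => s; apply: on_uniq_ge0 => eta; exact: ind_ge0.
(* Zero is written as the sum of the vanishing test integrals, whose integrands together dominate
   the indicator of the exceptional set. *)
rewrite [leRHS](_ : _ = \sum_(N <oo) sint n (on_uniq 0 (fun eta =>
    (`|test_weight (F N) n C M' kap eta| * C ^+ Defs.card eta)%:E))); last first.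
  by rewrite eseries0// => N _ _; exact: g_int.
rewrite /sint -integral_nneseries//; last by move=> N; exact: mg.
apply: ge0_le_integral => //.
- by move=> t _; apply: on_uniq_ge0 => eta; exact: ind_ge0.
- exact: cmeas_ind.
- apply: ge0_emeasurable_sum => // N _; exact: mg.
move=> t _.
(* The sets [F N] increase, so the finitely many points of [t] lie in a common one. *)
have [N FN] : exists N, all (fun x => x \in F N) t.
  elim: (tval t) => [|x s [N IH]]; first by exists 0%N.
  have : setT x by []; rewrite TF => -[N' _ FN'].
  exists (maxn N N') => /=; apply/andP; split.
    by apply: mem_set; move/subsetPset: (ndF _ _ (leq_maxr N N')); exact.
  apply: sub_all IH => y /set_mem yN; apply: mem_set.
  by move/subsetPset: (ndF _ _ (leq_maxl N N')); exact.
apply: le_trans (_ : on_uniq 0 (fun eta =>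
    (`|test_weight (F N) n C M' kap eta| * C ^+ Defs.card eta)%:E) t <= _); last first.
  rewrite (@nneseriesD1 _ _ N)//.
  by rewrite leeDl//; apply: nneseries_ge0.
rewrite /on_uniq; case: ifP => // ut.
rewrite (ger0_norm (test_weight_ge0 _ _ _ _ _ _)) /test_weight card_confs//.
rewrite size_tuple eqxx.
rewrite mul1r elam_confs// (_ : \prod_(x <- t) \1_(F N) x = 1)%R; last first.
  rewrite big_seq big1// => x xt; rewrite indicE.
  by move/allP: FN => /(_ x xt) ->.
rewrite mulr1 /ind; case: ifP => _; last by rewrite mul0r.
(* Here [1 <= C] enters: the weight [C^n] is at least the indicator. *)
by rewrite mul1r lee_fin exprn_ege1.
Qed.

End duality.

(** * Admissible parameters and dimension zero *)

Section activity_condition.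
Context {R : realType}.
Implicit Types (C beta z theta : R).

(** With [x = theta C beta] the claim is [z beta <= x e^(-x)], and [x e^(-x)] increases up to 1 and
    decreases afterwards. If [C beta > 1], then [1 < x <= C beta] and the value at [C beta] is at
    least [z beta] by the bound on [z]. Otherwise [x1 < x <= 1], and the value at [x1] is [z beta].
    Both monotonicities are derived from [1 + u <= e^u]. *)
Lemma alpha1_admissible C beta z x1 theta : 0 < C -> 0 < beta -> 0 < z ->
  z <= C * expR (- (C * beta)) -> smaller_root z beta x1 ->
  alpha1 C beta x1 < theta -> theta <= 1 ->
  z * expR (theta * C * beta) <= theta * C.
Proof.
move=> C0 b0 z0 zC [/andP[x10 x11] [zx1 _]] al th1.
have Cb0 : 0 < C * beta by rewrite mulr_gt0.
have th0 : 0 < theta.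
  apply: lt_trans al; rewrite /alpha1.
  by case: ifP => _; rewrite lt_max invr_gt0 ltr0n.
set x := theta * C * beta; have x0 : 0 < x by rewrite !mulr_gt0.
have xE : theta * C = x / beta by rewrite /x mulfK// gt_eqF.
have xy : x <= C * beta by rewrite /x -mulrA ger_pMl.
rewrite xE ler_pdivlMr// mulrAC.
move: al; rewrite /alpha1; case: ifP => Cb; rewrite !gt_max.
  move=> /and3P[_ h _].
  have x1' : 1 < x.
    by rewrite /x -mulrA -ltr_pdivrMr// div1r.
  have zy : z * beta <= C * beta * expR (- (C * beta)).
    by rewrite mulrAC ler_pM2r.
  apply: le_trans (ler_wpM2r (expR_ge0 x) zy) _.
  rewrite -[leLHS]mulrA -expRD.
  have -> : - (C * beta) + x = - (C * beta - x) by ring.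
  set y := C * beta in xy *.
  have e1 : 1 + (y - x) <= expR (y - x) by exact: expR_ge1Dx.
  rewrite expRN ler_pdivrMr ?expR_gt0//.
  apply: le_trans (_ : x * (1 + (y - x)) <= _); last by rewrite ler_pM2l.
  (* This product is [x (1 + (y - x)) - y]. *)
  have : 0 <= (x - 1) * (y - x) by rewrite mulr_ge0// subr_ge0// ltW.
  lra.
move=> /and3P[_ h _].
have xx1 : x1 < x by rewrite /x -mulrA -ltr_pdivrMr.
have xle1 : x <= 1 by apply: le_trans xy _; rewrite leNgt Cb.
rewrite -zx1 -mulrA -expRD (_ : - x1 + x = - (x1 - x)); last by ring.
rewrite expRN ler_pdivrMr ?expR_gt0//.
have e1 : 1 + (x1 - x) <= expR (x1 - x) by exact: expR_ge1Dx.
apply: le_trans (_ : x * (1 + (x1 - x)) <= _); last by rewrite ler_pM2l.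
have : 0 <= (1 - x) * (x - x1) by rewrite mulr_ge0// subr_ge0// ltW.
lra.
Qed.

Lemma alpha1_ge_half C beta x1 : 2^-1 <= alpha1 C beta x1.
Proof. by rewrite /alpha1; case: ifP => _; rewrite le_max lexx. Qed.

End activity_condition.

Section dimension0.
Context {R : realType}.
Notation T := (pt R 0).
Implicit Types (G U W : conf R 0 -> R).

Let o : T := [tuple].

Lemma confs_dim0 (eta : conf R 0) : eta = confs [::] \/ eta = confs [:: o].
Proof.
have e_o (x : T) : x = o by exact: tuple0.
case: (fset_0Vmem eta) => [->|[x xe]]; [left|right].
  by apply/fsetP => y; rewrite mem_confs.
by apply/fsetP => y; rewrite mem_confs (e_o y) inE eqxx -(e_o x).
Qed.

Lemma conf_measurable_dim0 G : conf_measurable G.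
Proof.
move=> n; have e (t t' : n.-tuple T) : t = t'.
  by apply: eq_from_tnth => i; rewrite [LHS]tuple0 [RHS]tuple0.
pose t0 : n.-tuple T := [tuple o | i < n].
rewrite (_ : (fun _ => _) = cst (if uniq t0 then G (conf_of t0) else 0)).
  exact: measurable_cst.
by apply/funext => t; rewrite (e t t0).
Qed.

(** The space has a single point, so tuples of length two or more repeat it and contribute
    nothing. *)
Lemma LPint_dim0 (H : conf R 0 -> \bar R) : (forall eta, 0 <= H eta)%E ->
  LPint H = (H (confs [::]) + H (confs [:: o]))%E.
Proof.
move=> H0; rewrite /LPint.
have F0 n (t : n.-tuple T) : (0 <= if uniq t then H (conf_of t) else 0)%E.
  by case: ifP.
have i0 n (F : n.-tuple T -> \bar R) : (forall t, 0 <= F t)%E -> (0 <= intRdn F)%E.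
  elim: n F => [|n IH] F F0'; first exact: F0'.
  by apply: IH.
rewrite (nneseries_split 0 2) => [|k _]; last first.
  by rewrite mule_ge0 ?i0// lee_fin invr_ge0.
rewrite [X in (_ + X)%E]eseries0 ?adde0; last first.
  move=> n; rewrite add0n => n2 _; rewrite (_ : intRdn _ = 0%E) ?mule0//.
  have z n' (F : n'.-tuple T -> \bar R) : (forall t, F t = 0%E) -> intRdn F = 0%E.
    by elim: n' F => [|n' IH] F F0'; [exact: F0'|apply: IH].
  apply: z => t; case: ifP => //; case: n n2 t => [|[|n]]// _ t.
  case: t => -[|x [|y s]]//= i; rewrite inE.
  have e_o (v : T) : v = o by exact: tuple0.
  by rewrite (e_o x) (e_o y) eqxx.
rewrite add0n big_ltn// big_ltn// big_geq// adde0 fact0 invr1 !mul1e.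
by [].
Qed.

Lemma RintRd_dim0 (f : T -> R) : RintRd f = f o.
Proof.
rewrite /RintRd /intRd /= -/o.
by rewrite !maxEle; case: ifP; case: ifP; lra.
Qed.

Lemma inLC_dim0 C G : 0 <= C -> inLC C G.
Proof.
move=> C0; split; first exact: conf_measurable_dim0.
by rewrite /LCnorm LPint_dim0 -?EFinD ?ltry// => eta; exact: LC_ge0.
Qed.

(** The inserted point is always [o]. Both subsets of the one-point configuration therefore lead
    back to it, which gives the sum [a o + b o]. *)
Lemma L2gen_dim0 (a b : T -> R) z G :
  L2gen a b z G (confs [::]) = z * G (confs [:: o]) /\
  L2gen a b z G (confs [:: o]) = z * ((a o + b o) * G (confs [:: o])).
Proof.
have e_o (x : T) : x = o by exact: tuple0.
split; rewrite L2gen_confs//=.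
  by rewrite big_seq1 RintRd_dim0 /wker !big_nil !mul1r.
rewrite !big_cons big_nil !RintRd_dim0 addr0 /wker /= !big_cons !big_nil.
rewrite !mulr1 !mul1r !(e_o (tsub _ _)).
have -> : confs [:: o; o] = confs [:: o].
  by apply/fsetP => y; rewrite !mem_confs !inE orbb.
by rewrite mulrDl.
Qed.

Variables (phi : T -> R) (phibar z eps C : R).
Hypothesis phi_ge0 : forall x, 0 <= phi x.
Hypothesis phi_le : forall x, phi x <= phibar.
Hypothesis eps_gt0 : 0 < eps.
Hypothesis z_ge0 : 0 <= z.
Hypothesis C_gt0 : 0 < C.

Lemma LV_dim0B (f g : conf R 0 -> R) eta :
  LV phi z (fun eta => f eta - g eta) eta = LV phi z f eta - LV phi z g eta.
Proof.
rewrite /LV !L2VE /L1.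
by case: (confs_dim0 eta) => ->; rewrite ?(L2gen_dim0 _ _ _ _).1 ?(L2gen_dim0 _ _ _ _).2; ring.
Qed.

(** The operators agree at the empty configuration. At the other one, the error [eps phibar] of the
    retained weight and [eps phibar^2] of the removed weight add up. *)
Lemma Lren_LV_dim0 (f : conf R 0 -> R) eta :
  `|Lren phi z eps f eta - LV phi z f eta| <=
  z * (eps * (phibar + phibar ^+ 2)) * `|f eta|.
Proof.
have pb0 : 0 <= phibar by exact: le_trans (phi_ge0 o) (phi_le o).
have c0 : 0 <= z * (eps * (phibar + phibar ^+ 2)).
  by rewrite mulr_ge0// mulr_ge0 ?(ltW eps_gt0)// addr_ge0// sqr_ge0.
rewrite /Lren /LV L2VE L2epsE.
rewrite (_ : _ - _ = L2gen (aeps phi eps) (beps phi eps) z f eta -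
   L2gen (fun=> 1) (fun v => - phi v) z f eta); last by rewrite /aeps /beps; ring.
case: (confs_dim0 eta) => ->.
  by rewrite !(L2gen_dim0 _ _ _ _).1 subrr normr0 mulr_ge0.
rewrite !(L2gen_dim0 _ _ _ _).2.
have [_ ha] := aepsP phi_ge0 phi_le eps_gt0 o.
have [_ hb] := bepsP phi_ge0 phi_le eps_gt0 o.
rewrite (_ : _ - _ = z * ((aeps phi eps o - 1) + (beps phi eps o + phi o))
   * f (confs [:: o])); last by ring.
rewrite !normrM ler_wpM2r// (ger0_norm z_ge0) ler_wpM2l//.
apply: le_trans (ler_normD _ _) _; rewrite mulrDr lerD//.
apply: le_trans hb _; rewrite -mulrA ler_pM2l// expr2 ler_wpM2l//.
Qed.

Lemma LCnorm_step_le_dim0 (TV : R -> (conf R 0 -> R) -> conf R 0 -> R) h f g :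
  generated_semigroup C (LV phi z) TV -> 0 <= h ->
  (LCnorm C (fun eta => f eta - g eta)%R <=
   LCnorm C (fun eta => f eta - g eta
     - h * (Lren phi z eps f eta - LV phi z g eta))%R
   + (h * (z * (eps * (phibar + phibar ^+ 2))))%:E * LCnorm C f)%E.
Proof.
move=> gT h0; have Cge0 := ltW C_gt0.
set kap := z * (eps * (phibar + phibar ^+ 2)).
have pb0 : 0 <= phibar by exact: le_trans (phi_ge0 o) (phi_le o).
have kap0 : 0 <= kap.
  by rewrite mulr_ge0// mulr_ge0 ?(ltW eps_gt0)// addr_ge0// sqr_ge0.
pose W : conf R 0 -> R^o := fun eta => f eta - g eta.
have PC G : inLC C G by exact: inLC_dim0.
have PL G : inLC (2 * C) G -> inLC C (LV phi z G) by move=> _; exact: inLC_dim0.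
have DW : inLC (2 * C) W by apply: inLC_dim0; rewrite mulr_ge0.
have gW := (generated_core C_gt0 gT PL).1 W DW.
have := generates_contraction_dissipative (inLC_add C_gt0) (inLC_scale C_gt0)
  (seminorm_nrm C_gt0 Cge0 (lexx C)) (generated_contraction C_gt0 gT)
  (PC W) (PC (LV phi z W)) h0 gW.
rewrite -lee_fin -!nrmE// => /le_trans; apply.
have mG G := @conf_measurable_dim0 G.
pose X eta := f eta - g eta - h * (Lren phi z eps f eta - LV phi z g eta).
pose Y eta := h * (Lren phi z eps f eta - LV phi z f eta).
have -> : W - h *: (LV phi z W : conf R 0 -> R^o) = (fun eta => X eta + Y eta).
  apply/funext => eta; rewrite /X /Y.
  transitivity (W eta - h * LV phi z W eta); first by [].
  by rewrite LV_dim0B /W; ring.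
apply: le_trans (LCnormD Cge0 (mG X) (mG Y)) _; apply: leeD => //.
rewrite LCnormZ// (ger0_norm h0) EFinM -muleA.
apply: lee_wpmul2l; first by rewrite lee_fin.
rewrite -(ger0_norm kap0) -LCnormZ//; apply: LPint_le.
- exact: (@cmeas_LC _ _ (fun n => C ^+ n)).
- exact: (@cmeas_LC _ _ (fun n => C ^+ n)).
- by move=> eta; rewrite lee_fin mulr_ge0// exprn_ge0.
- move=> eta; rewrite lee_fin ler_wpM2r ?exprn_ge0//.
  by rewrite normrM (ger0_norm kap0); exact: Lren_LV_dim0.
Qed.

End dimension0.

(** * Adjoint semigroups and the final estimate *)

Section adjoint_comparison.
Context {R : realType} {d : nat}.
Implicit Types (k : conf R d -> R).

Lemma KCnorm_ge0 (B : R) k : (0 <= KCnorm B k)%E.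
Proof. by apply: le_ereal_inf_tmp => _ [M [M0 _] <-]; rewrite lee_fin. Qed.

Lemma inKC_le (B C : R) k : 0 <= B -> B <= C -> inKC B k -> inKC C k.
Proof.
move=> B0 BC kB; have [K nK] := inKC_null kB; have mk := kB.1; split => //.
apply: le_lt_trans (KCnorm_le_null (null_above_le B0 BC mk nK)) _.
exact: ltry.
Qed.

Lemma adjoint_comparison (B B' C M : R) (t : R)
    (T1 T2 T1s T2s : R -> (conf R d -> R) -> conf R d -> R)
    (L1 L2 : (conf R d -> R) -> conf R d -> R) k :
  0 <= B' -> B' <= B -> B <= C -> 1 <= C -> 0 <= M -> 0 <= t ->
  generated_semigroup C L1 T1 -> generated_semigroup C L2 T2 ->
  adjoint_semigroup C T1 T1s -> adjoint_semigroup C T2 T2s ->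
  (forall G, inLC (2 * C) G ->
    LCnorm B (fun eta => T1 t G eta - T2 t G eta)%R <= M%:E * LCnorm C G)%E ->
  inKC B' k ->
  (KCnorm C (fun eta => T1s t k eta - T2s t k eta)%R <= M%:E * KCnorm B' k)%E.
Proof.
move=> B'0 B'B BC C1 M0 t0 g1 g2 a1 a2 cmp kB.
have kC : inKC C k by apply: inKC_le kB => //; exact: le_trans BC.
have [k1C ad1] := a1 t k t0 kC; have [k2C ad2] := a2 t k t0 kC.
apply: KCnorm_le_scale => // K nK.
apply: (duality (B := B) (T1 := T1 t) (T2 := T2 t) (k := k)) => //.
- exact: le_trans B'B.
- by apply: null_above_le nK => //; exact: kB.1.
- by case: g1 => h _ G PG; exact: h.
- by case: g2 => h _ G PG; exact: h.
Qed.

End adjoint_comparison.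

Theorem mainTheorem10 (R : realType) (d : nat) (C phibar alpha : R) :
  1 < C ->
  exists2 A : R, 0 < A &
  forall (phi : pt R d -> R) (beta z x1 : R),
    measurable_fun [set: pt R d] phi ->
    (forall x, 0 <= phi x) ->
    (forall x, phi (topp x) = phi x) ->
    intRd (fun x => (phi x)%:E) = beta%:E -> 0 < beta ->
    0 < z -> z <= C * expR (- (C * beta)) ->
    z <= 2 * C * expR (- (2 * C * beta)) ->
    (C * beta = ln 2 -> z < C / 2) ->
    (forall x, phi x <= phibar) ->
    (forall e : R, 0 < e -> exists x, phibar - e < phi x) ->
    smaller_root z beta x1 ->
    alpha1 C beta x1 < alpha -> alpha < 1 ->
    forall (TV TVs : R -> (conf R d -> R) -> conf R d -> R),
      generated_semigroup C (LV phi z) TV ->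
      adjoint_semigroup C TV TVs ->
    forall eps : R, 0 < eps ->
    forall (Tren Trens : R -> (conf R d -> R) -> conf R d -> R),
      generated_semigroup C (Lren phi z eps) Tren ->
      adjoint_semigroup C Tren Trens ->
    forall (k : conf R d -> R) (t : R),
      inKC (alpha * C) k -> 0 <= t ->
      (KCnorm C (fun eta => Trens t k eta - TVs t k eta)%R
        <= (eps * t * A)%:E * KCnorm (alpha * C) k)%E.
Proof.
move=> C1; have C0 : 0 < C by exact: lt_trans C1.
(* The constant is chosen before [phi] is given, when the sign of [phibar] is still unknown: hence
   the absolute values, and the leading 1 to make it positive. *)
pose q := Num.sqrt alpha; pose c := (q^-1 - 1)^-1.
(* The last term is only needed in dimension zero. *)
exists (1 + `|phibar| * c ^+ 2 + C * (`|phibar| + phibar ^+ 2)).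
  have : 0 <= `|phibar| * c ^+ 2 by rewrite mulr_ge0// sqr_ge0.
  have : 0 <= C * (`|phibar| + phibar ^+ 2).
    by rewrite mulr_ge0 ?(ltW C0)// addr_ge0// sqr_ge0.
  lra.
set A := 1 + _ + _.
move=> phi beta z x1 mphi phi0 phi_even int_phi b0 z0 zC _ _ phi_le _ root al al1.
move=> TV TVs gV aV eps e0 Tren Trens gR aR k t kB t0.
have al0 : 0 < alpha.
  by apply: lt_le_trans (ltW al); apply: lt_le_trans (alpha1_ge_half _ _ _);
     rewrite invr_gt0 ltr0n.
have pb0 : 0 <= phibar.
  exact: le_trans (phi0 [tuple 0 | i < d]) (phi_le _).
(* This removes [z] from the constant in dimension zero. *)
have zle : z <= C.
  apply: le_trans zC _; rewrite -[leRHS]mulr1 ler_pM2l// -expR0 ler_expR.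
  by rewrite oppr_le0 mulr_ge0// ltW.
have q0 : 0 < q by rewrite sqrtr_gt0.
have q2 : q ^+ 2 = alpha by rewrite sqr_sqrtr// ltW.
have q1 : q < 1 by rewrite -sqrtr1 ltr_sqrt.
have alq : alpha <= q by rewrite -q2 expr2 ger_pMl// ltW.
have zC' : z * expR (C * beta) <= C.
  by move: zC; rewrite expRN ler_pdivlMr ?expR_gt0.
(* [B] will be [alpha C] in positive dimension and [C] in dimension zero. *)
have step (B kappa : R) : alpha * C <= B -> B <= C -> 0 <= kappa ->
    kappa <= eps * A ->
    (forall f, inLC (2 * C) f -> inLC C (Lren phi z eps f)) ->
    (forall f, inLC (2 * C) f -> inLC C (LV phi z f)) ->
    (forall (h : R) f g, 0 <= h -> inLC (2 * C) f -> inLC (2 * C) g ->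
      (LCnorm B (fun eta => f eta - g eta)%R <=
       LCnorm B (fun eta => f eta - g eta
         - h * (Lren phi z eps f eta - LV phi z g eta))%R +
       (h * kappa)%:E * LCnorm C f)%E) ->
    (KCnorm C (fun eta => Trens t k eta - TVs t k eta)%R
        <= (eps * t * A)%:E * KCnorm (alpha * C) k)%E.
  move=> aB BC k0 kA P1 P2 K.
  have B0 : 0 <= B by apply: le_trans aB; rewrite mulr_ge0// ltW.
  have tk0 : 0 <= t * kappa by rewrite mulr_ge0.
  apply: (@le_trans _ _ ((t * kappa)%:E * KCnorm (alpha * C) k)%E).
    apply: (adjoint_comparison (B := B) _ aB BC (ltW C1) tk0 t0 gR gV aR aV) => //.
      by rewrite mulr_ge0// ltW.
    move=> G DG.
    exact: (generated_comparison C0 B0 BC k0 gR gV P1 P2 K DG t0).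
  apply: lee_wpmul2r; first exact: KCnorm_ge0.
  by rewrite lee_fin [eps * t]mulrC -mulrA ler_wpM2l.
have cn0 : 0 <= `|phibar| * c ^+ 2 by rewrite mulr_ge0// sqr_ge0.
have Cn0 : 0 <= C * (`|phibar| + phibar ^+ 2).
  by rewrite mulr_ge0 ?(ltW C0)// addr_ge0// sqr_ge0.
case: d => [|d] in phi mphi phi0 phi_even int_phi phi_le TV TVs gV aV
  Tren Trens gR aR k kB step *.
  apply: (step C (z * (eps * (phibar + phibar ^+ 2)))) => //.
  - by rewrite ger_pMl// ltW.
  - by rewrite mulr_ge0 ?(ltW z0)// mulr_ge0 ?(ltW e0)// addr_ge0// sqr_ge0.
  - rewrite mulrCA ler_pM2l// /A (ger0_norm pb0).
    rewrite (ger0_norm pb0) in cn0.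
    have : z * (phibar + phibar ^+ 2) <= C * (phibar + phibar ^+ 2).
      by rewrite ler_wpM2r// addr_ge0// sqr_ge0.
    lra.
  - by move=> f _; apply: inLC_dim0; exact: ltW.
  - by move=> f _; apply: inLC_dim0; exact: ltW.
  - by move=> h f g h0 _ _; exact: (LCnorm_step_le_dim0 phi0 phi_le e0 (ltW z0) C0 _ _ gV h0).
apply: (step (alpha * C) (eps * (phibar * c ^+ 2))) => //.
- by rewrite ger_pMl// ltW.
- by rewrite mulr_ge0 ?(ltW e0)// mulr_ge0// sqr_ge0.
- rewrite ler_pM2l// /A (ger0_norm pb0).
  by rewrite (ger0_norm pb0) in Cn0 *; lra.
- by move=> f; exact: (inLC_Lren mphi phi0 phi_even int_phi b0 (ltW z0) phi_le e0 C0 zC').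
- by move=> f; exact: (inLC_LV mphi phi0 phi_even int_phi b0 (ltW z0) C0 zC').
move=> h f g h0 Df Dg; rewrite -q2.
have := @LCnorm_step_le R d phi beta z mphi phi0 phi_even int_phi b0 (ltW z0)
  phibar eps phi_le e0 C q h f g C0.
rewrite q0 q1 mulrA => /(_ isT) H; apply: H => //.
(* The smallness condition is needed at level [q C], where [q >= alpha], for the perturbation, and
   then at level [q^2 C = alpha C] for dissipativity. *)
- apply: (alpha1_admissible (x1 := x1)) => //; last exact: ltW.
  exact: lt_le_trans alq.
- by rewrite q2; apply: (alpha1_admissible (x1 := x1)) => //; exact: ltW.
Qed.
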